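(* Let $A\in\mathbf{R}$ and let $h:(0,1)\to(0,\infty)$ be an integrable, locally absolutely continuous function. Define $\ell(\lambda)=-\frac{\lambda h'(\lambda)}{h(\lambda)}$ for almost every $\lambda\in(0,1)$, and suppose that: (1) $\ell$ is non-decreasing and $\ell(\lambda)\ge A$ almost everywhere; (2) $\int_0^1\lambda^{d/2}h(\lambda)|\ell(\lambda)|\,d\lambda<\infty$; (3) $\lim_{\lambda\downarrow0}\lambda^{d/2+1}h(\lambda)=0$; (4) the finite limit $h_1:=\lim_{\lambda\uparrow1}h(\lambda)$ exists. Let $b$ satisfy $d+2-2A\le b$ and $d-2<b<2(d-2)$. Let $t^\star=\sup\{t>0: r(t)\le d-2\}$. Then the Bayes multiple shrinkage estimator under the prior $\pi_{*a}(\theta)=\sum_{i=1}^k w_i\,\pi_a(\theta-\theta_i)$ is minimax provided $$a\ge\max\left\{1,\ \frac{D}{t^\star}\left(1+\frac1\rho\right)^2\right\},$$ where $0<\rho<1$ and $\rho\le\frac{2(d-2)-b}{2b-2(d-2)}$.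
   Context: One observes $X\sim N_d(\theta,I_d)$ with unknown $\theta\in\mathbf{R}^d$; estimators $\delta$ are judged by the quadratic risk $R(\theta,\delta)=\mathbf{E}_\theta\|\delta(X)-\theta\|^2$, and $\delta$ is minimax if $\sup_\theta R(\theta,\delta)=\inf_{\delta'}\sup_\theta R(\theta,\delta')$ (this minimax value equals $d$, the constant risk of $\delta_{mle}(X)=X$). The Bayes estimator under a prior is the posterior mean; if $m$ is the marginal density of $X$ under the prior, it equals $x+\nabla m(x)/m(x)$. For $a\ge1$, $\pi_a$ denotes the prior (density) on $\theta\in\mathbf{R}^d$ given hierarchically by $\theta\mid\lambda\sim N_d\left(0,\left(\frac{a}{\lambda}-1\right)I_d\right)$, $\lambda\sim h$, where $h$ is the mixing density on $(0,1)$ (its normalization does not affect the Bayes estimator). The function $r$ is the one associated with the unscaled case $a=1$: with $f_h(t)=\frac{1}{(2\pi)^{d/2}}\int_0^1\lambda^{d/2}h(\lambda)e^{-\lambda t/2}\,d\lambda$ (so that the marginal density of $X$ under $\pi_1$ is $f_h(\|x\|^2)$), $$r(t)=-\frac{2t f_h'(t)}{f_h(t)}=t\,\frac{\int_0^1\lambda^{d/2+1}e^{-t\lambda/2}h(\lambda)\,d\lambda}{\int_0^1\lambda^{d/2}e^{-t\lambda/2}h(\lambda)\,d\lambda},\qquad t\ge0.$$ $\theta_1,\ldots,\theta_k\in\mathbf{R}^d$ are different target points, $w_1,\ldots,w_k>0$ are fixed weights with $\sum_{i=1}^kw_i=1$, and $D=\max_{i\ne j}\|\theta_i-\theta_j\|^2$.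 *)

(* Defs.v *)
From HB Require Import structures.
From mathcomp Require Import all_boot all_order all_algebra.
From mathcomp Require Import all_classical all_reals all_analysis.

Set Implicit Arguments.
Unset Strict Implicit.
Unset Printing Implicit Defensive.

Import Order.TTheory GRing.Theory Num.Theory.
Import numFieldNormedType.Exports.

Local Open Scope classical_set_scope.
Local Open Scope ring_scope.

(* R^d is the type [d.-tuple R], whose measurable structure in the library is
   the product of the Borel structures of the coordinates. *)

Section lebesgue_cons.
Context {R : realType}.
Local Open Scope ereal_scope.

(* [measurableTypeR R] is the carrier R on which [lebesgue_measure] lives. *)
Definition tcons n (p : measurableTypeR R * n.-tuple R) : n.+1.-tuple R :=
  [the n.+1.-tuple R of p.1 :: p.2].

Definition tuncons n (t : n.+1.-tuple R) : measurableTypeR R * n.-tuple R :=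
  (tnth t ord0, [tuple of behead t]).

Lemma measurable_tcons n :
  measurable_fun [set: measurableTypeR R * n.-tuple R] (@tcons n).
Proof. exact: measurable_cons. Qed.

Lemma tconsK n : cancel (@tcons n) (@tuncons n).
Proof.
by move=> [x t]; rewrite /tuncons /tcons /=; congr (_, _); exact/val_inj.
Qed.

Lemma tunconsK n : cancel (@tuncons n) (@tcons n).
Proof. by move=> t; rewrite /tcons /= [RHS]tuple_eta; exact/val_inj. Qed.

Lemma measurable_tuncons n : measurable_fun [set: n.+1.-tuple R] (@tuncons n).
Proof.
apply/measurable_fun_pairP; split; first exact: measurable_tnth.
exact: measurable_behead.
Qed.

Variables (n : nat) (m : {sigma_finite_measure set (n.-tuple R) -> \bar R}).

Definition lebesgue_cons : set (n.+1.-tuple R) -> \bar R :=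
  pushforward (lebesgue_measure \x m) (@tcons n).

Let lebesgue_cons0 : lebesgue_cons set0 = 0.
Proof. by rewrite /lebesgue_cons /pushforward preimage_set0 measure0. Qed.

Let lebesgue_cons_ge0 A : 0 <= lebesgue_cons A.
Proof. by rewrite /lebesgue_cons /pushforward measure_ge0. Qed.

Let lebesgue_cons_sigma_additive : semi_sigma_additive lebesgue_cons.
Proof.
move=> F mF tF mUF; rewrite /lebesgue_cons /pushforward preimage_bigcup.
apply: measure_semi_sigma_additive.
- by move=> k; rewrite -[X in measurable X]setTI; exact: measurable_tcons.
- apply/trivIsetP => /= i j _ _ ij; rewrite -preimage_setI.
  by move/trivIsetP : tF => /(_ _ _ _ _ ij) ->//; rewrite preimage_set0.
- rewrite -preimage_bigcup -[X in measurable X]setTI.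
  exact: measurable_tcons.
Qed.

HB.instance Definition _ := isMeasure.Build _ _ _ lebesgue_cons
  lebesgue_cons0 lebesgue_cons_ge0 lebesgue_cons_sigma_additive.

Let lebesgue_cons_sigma_finite : sigma_finite setT lebesgue_cons.
Proof.
have /sigma_finiteP[F [TF ndF Foo]] := sigma_finiteT (@lebesgue_measure R).
have /sigma_finiteP[G [TG ndG Goo]] := sigma_finiteT m.
exists (fun k => @tuncons n @^-1` (F k `*` G k)).
  rewrite -preimage_bigcup (_ : \bigcup_k (F k `*` G k) = setT)//.
  rewrite -setXTT TF TG predeqE => -[x y]; split.
    by move=> [k _ []/= ? ?]; split; exists k.
  move=> [/= [i _ Fix] [j _ Gjy]]; exists (maxn i j) => //; split.
  - by move: x Fix; exact/subsetPset/ndF/leq_maxl.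
  - by move: y Gjy; exact/subsetPset/ndG/leq_maxr.
move=> k; have [mF Fkoo] := Foo k; have [mG Gkoo] := Goo k; split.
  rewrite -[X in measurable X]setTI.
  by apply: measurable_tuncons => //; exact: measurableX.
rewrite /lebesgue_cons /pushforward -comp_preimage (_ : _ @^-1` _ = F k `*` G k).
  by rewrite product_measure1E// lte_mul_pinfty// ge0_fin_numE.
by apply/funext => x; rewrite -[in RHS](tconsK x).
Qed.

HB.instance Definition _ := Measure_isSigmaFinite.Build _ _ _ lebesgue_cons
  lebesgue_cons_sigma_finite.

End lebesgue_cons.

(* Lebesgue measure on R^d, the d-fold product of the one-dimensional one *)
Fixpoint lebesgue_tuple (R : realType) (d : nat) :
    {sigma_finite_measure set (d.-tuple R) -> \bar R} :=
  match d with
  | 0 => \d_([tuple] : 0.-tuple R)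
  | d'.+1 => lebesgue_cons (lebesgue_tuple R d')
  end.

Section vectors.
Context {R : realType} {d : nat}.
Implicit Types x y : d.-tuple R.

Definition tsub x y : d.-tuple R := [tuple tnth x i - tnth y i | i < d].

Definition sqnorm x : R := \sum_(i < d) tnth x i ^+ 2.

(* The density of N_d(m, v I_d), for v > 0: the second parameter of the
   library's [normal_pdf] is the standard deviation. *)
Definition gauss_pdf (m : d.-tuple R) (v : R) x : R :=
  \prod_(i < d) normal_pdf (tnth m i) (Num.sqrt v) (tnth x i).

End vectors.

Section decision.
Context {R : realType} {d : nat}.
Local Open Scope ereal_scope.
Implicit Types (delta : d.-tuple R -> d.-tuple R) (theta x : d.-tuple R).

Definition risk theta delta : \bar R :=
  \int[lebesgue_tuple R d]_x
    (sqnorm (tsub (delta x) theta) * gauss_pdf theta 1 x)%:E.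

Definition sup_risk delta : \bar R :=
  ereal_sup [set risk theta delta | theta in [set: d.-tuple R]].

Definition minimax delta : Prop :=
  measurable_fun [set: d.-tuple R] delta /\
  sup_risk delta = ereal_inf
    [set sup_risk delta' | delta' in
       [set delta' | measurable_fun [set: d.-tuple R] delta']].

(* Prior densities take values in the extended reals because mixtures of
   normal densities may be infinite at the centre; they need not integrate
   to 1. *)
Definition marginal (prior : d.-tuple R -> \bar R) x : \bar R :=
  \int[lebesgue_tuple R d]_theta ((gauss_pdf theta 1 x)%:E * prior theta).

(* The Bayes estimator for quadratic loss: the posterior mean *)
Definition bayes (prior : d.-tuple R -> \bar R) x : d.-tuple R :=
  [tuple (fine (\int[lebesgue_tuple R d]_theta
           ((tnth theta i * gauss_pdf theta 1 x)%:E * prior theta))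
         / fine (marginal prior x))%R | i < d].

Definition prior_mix (h : R -> R) (a : R) theta : \bar R :=
  \int[lebesgue_measure]_(lambda in `]0%R, 1%R[)
    (gauss_pdf [tuple of nseq d 0%R] (a / lambda - 1) theta * h lambda)%:E.

Definition prior_multi (h : R -> R) (a : R) (k : nat) (w : 'I_k -> R)
    (target : 'I_k -> d.-tuple R) theta : \bar R :=
  \sum_(i < k) (w i)%:E * prior_mix h a (tsub theta (target i)).

End decision.

Section mixing.
Context {R : realType}.

Definition f_h (d : nat) (h : R -> R) (t : R) : R :=
  (2 * pi) `^ (- (d%:R / 2)) *
  \int[lebesgue_measure]_(lambda in `]0, 1[)
     (lambda `^ (d%:R / 2) * h lambda * expR (- (lambda * t / 2))).

Definition r_h (d : nat) (h : R -> R) (t : R) : R :=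
  - (2 * t * derive1 (f_h d h) t) / f_h d h t.

(* [sup] is 0 on an empty or unbounded set; this set is nonempty and bounded
   for the h under consideration. *)
Definition tstar (d : nat) (h : R -> R) : R :=
  sup [set t : R | 0 < t /\ r_h d h t <= d%:R - 2].

Definition ell (h : R -> R) (lambda : R) : R :=
  - (lambda * derive1 h lambda / h lambda).

(* Absolute continuity on the compact interval [u, v]; the second condition
   says that the intervals [x i, y i] do not overlap. *)
Definition abs_continuous (u v : R) (f : R -> R) : Prop :=
  forall e : R, 0 < e -> exists2 dlt : R, 0 < dlt &
    forall (n : nat) (x y : 'I_n -> R),
      (forall i, u <= x i /\ x i <= y i /\ y i <= v) ->
      (forall i j, i != j -> y i <= x j \/ y j <= x i) ->
      \sum_(i < n) (y i - x i) < dlt ->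
      \sum_(i < n) `|f (y i) - f (x i)| < e.

Definition loc_abs_continuous01 (f : R -> R) : Prop :=
  forall u v : R, 0 < u -> u <= v -> v < 1 -> abs_continuous u v f.

(* f is monotone off a null set: the statement for an f that is defined only
   almost everywhere on D, such as [ell h], where [derive1] takes an arbitrary
   value at the points at which h is not derivable *)
Definition ae_nondecreasing (D : set R) (f : R -> R) : Prop :=
  exists2 N : set R, lebesgue_measure.-negligible N &
    forall x y : R, (D `\` N) x -> (D `\` N) y -> x <= y -> f x <= f y.

(* The value is 0 when there is only one target point. *)
Definition sqdiam (d k : nat) (target : 'I_k -> d.-tuple R) : R :=
  \big[Num.max/0]_(p : 'I_k * 'I_k | p.1 != p.2)
    sqnorm (tsub (target p.1) (target p.2)).

End mixing.

(* Main.v *)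
(* Write p = d / 2 and let I_q(t) be the integral of l^q h(l) exp (- l t / 2) over
   (0, 1), so that r(t) = t I_(p+1)(t) / I_p(t). With t_j = |x - theta_j|^2 / a, the
   Bayes estimator is x + g(x), where
     g(x) = - (1 / a) (sum_j w_j (x - theta_j) I_(p+1)(t_j)) / (sum_j w_j I_p(t_j)).
   The field g and its partial derivatives are bounded, so by Stein's identity the
   risk exceeds d by the expectation of 2 div g + |g|^2, which is shown to be <= 0
   pointwise. A change of scale in the integrals turns the monotonicity of ell, which
   makes h(c l) / h(l) monotone, into the monotonicity of r, and the bound
   ell >= A into r <= b. Hence 2 div g + |g|^2 <= 0 is trivial when r(t_j) <= d - 2
   for all j. Otherwise some t_j is at least t^*, so by the choice of a all targets
   are far from x compared with their mutual distances, the vectors x - theta_j are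
   nearly parallel, and the inequality holds for each pair of targets separately.
   That d is a lower bound for the maximal risk follows from the Bayes risks of the
   priors N(0, v I_d) as v tends to infinity. *)

Require Import Defs.
From HB Require Import structures.
From mathcomp Require Import all_boot all_order all_algebra.
From mathcomp Require Import all_classical all_reals all_analysis.
From mathcomp Require Import measurable_realfun ring lra.

Set Implicit Arguments.
Unset Strict Implicit.
Unset Printing Implicit Defensive.

Import Order.TTheory GRing.Theory Num.Theory.
Import numFieldNormedType.Exports.

Local Open Scope classical_set_scope.
Local Open Scope ring_scope.

(** [ell] is controlled only almost everywhere, so both assumptions on it are first integrated into
    statements about [h] at every point: h(c x) / h(x) is nondecreasing and h(x) x^A is
    nonincreasing. This is where absolute continuity is spent; it rests on the fundamental theorem
    of calculus for absolutely continuous functions, derived here from Radon-Nikodym. The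
    inequalities for I_(q+1) / I_q then follow one pattern. The integral of (x - m) f over (0, 1) is
    zero, or has a known sign, for a suitable m; multiplying f by a monotone factor phi and
    subtracting phi(m) times the old integral leaves the integrand (x - m) (phi(x) - phi(m)) f,
    which has a constant sign. The final pairwise inequality is balanced by K = 1 / (1 + rho). Write
    c = d - 2 and n_j = |x - theta_j|^2. The bound on rho says that 2 (r - c) <= K r at the worst
    value r = b, and the bound on a yields |theta_j - theta_l|^2 <= (1 - K) (n_j + n_l), which means
    that twice the inner product of x - theta_j and x - theta_l is at least K (n_j + n_l). *)

(** * Scaling of Lebesgue measure on the line *)

Section lebesgue_scaling.
Context {R : realType}.
Variable c : R.
Hypothesis c0 : 0 < c.
Local Notation mu := (@lebesgue_measure R).

Let scale (x : measurableTypeR R) : measurableTypeR R := c * x.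

Let mscale_ : measurable_fun setT scale.
Proof. by apply: (@mulrl_measurable R). Qed.

Let k : {nonneg R} := NngNum (ltW c0).

(** Both sides are measures in A that agree on half-open intervals, and these determine Lebesgue
    measure. *)
Lemma lebesgue_measure_scale (A : set (measurableTypeR R)) : measurable A ->
  mu A = (c%:E * mu (scale @^-1` A))%E.
Proof.
move=> mA.
apply: (@lebesgue_measure_unique R (mscale k (pushforward mu scale))) => //.
move=> _ [[a b] _ <-] /=; rewrite /mscale /= /pushforward.
have -> : scale @^-1` `]a, b]%classic = `]a / c, b / c]%classic.
  by apply/seteqP; split => x /=; rewrite !in_itv/= ltr_pdivrMr// ler_pdivlMr// mulrC.
rewrite !lebesgue_measure_itv/= !lte_fin ltr_pM2r ?invr_gt0//.
case: ifPn => _; last by rewrite mule0.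
by rewrite -EFinD -EFinM; congr EFin; field; rewrite gt_eqF.
Qed.

Lemma ae_scale (P : R -> Prop) : {ae mu, forall x, P x} ->
  {ae mu, forall x, P (c * x)}.
Proof.
move=> [A [mA A0 PA]]; exists (scale @^-1` A); split.
- by rewrite -[X in measurable X]setTI; exact: mscale_.
- have := lebesgue_measure_scale mA; rewrite A0 => /esym/eqP.
  by rewrite mule_eq0 eqe gt_eqF//= => /eqP.
- by move=> x /= Px; exact: PA.
Qed.

Lemma ge0_integral_scale (D : set R) (f : R -> \bar R) : measurable D ->
  measurable_fun D f -> (forall x, D x -> 0 <= f x)%E ->
  (\int[mu]_(x in D) f x = c%:E * \int[mu]_(x in scale @^-1` D) f (c * x)%R)%E.
Proof.
move=> mD mf f0.
rewrite (@eq_measure_integral _ _ _ _ (mscale k (pushforward mu scale))); last first.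
  by move=> A mA _; exact: lebesgue_measure_scale.
rewrite ge0_integral_mscale//; congr (_ * _)%E.
by rewrite ge0_integral_pushforward// => x /set_mem; exact: f0.
Qed.

Lemma ge0_Rintegral_scale (f : R -> R) :
  measurable_fun (`]0, c[%classic : set R) f -> (forall x, 0 < x < c -> 0 <= f x) ->
  \int[mu]_(x in `]0, c[) f x = c * \int[mu]_(x in `]0, 1[) f (c * x).
Proof.
move=> mf f0; rewrite /Rintegral ge0_integral_scale//.
- have -> : scale @^-1` `]0, c[%classic = `]0, 1[%classic.
    apply/seteqP; split => x /=; by rewrite !in_itv/= pmulr_rgt0// gtr_pMr.
  (* If the integral is infinite, both sides are 0, because [fine] sends infinite values to 0. *)
  have [fin|] := boolP ((\int[mu]_(x in `]0%R, 1%R[) (f (c * x)%R)%:E)%E \is a fin_num).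
    by rewrite fineM.
  rewrite fin_numE negb_and !negbK => /orP[] /eqP ->.
    by rewrite gt0_muleNy ?lte_fin//= mulr0.
  by rewrite gt0_muley ?lte_fin//= mulr0.
- exact/measurable_EFinP.
Qed.

Lemma integrable_scale (f : R -> R) :
  mu.-integrable `]0, c[ (EFin \o f) ->
  mu.-integrable `]0, 1[ (EFin \o (fun x => f (c * x))).
Proof.
have cD : scale @^-1` `]0, c[%classic = `]0, 1[%classic.
  by apply/seteqP; split => x /=; by rewrite !in_itv/= pmulr_rgt0// gtr_pMr.
move=> /integrableP[mf foo].
have m0c : measurable (`]0, c[%classic : set R) by exact: measurable_itv.
have m01 : measurable (`]0, 1[%classic : set R) by exact: measurable_itv.
apply/integrableP; split.
  apply: (@measurable_comp _ _ _ _ _ _ `]0, c[%classic (EFin \o f) _ scale) => //.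
    by move=> _ [x x01 <-]; move: x01; rewrite -cD.
  exact: measurable_funTS.
move: foo; rewrite ge0_integral_scale//.
- rewrite cD => foo; rewrite -(@lte_pmul2l _ c%:E)// ?lte_fin//.
  by apply: (lt_le_trans foo); rewrite gt0_muley ?lte_fin.
- exact: measurableT_comp.
Qed.

End lebesgue_scaling.

(** * Absolutely continuous functions *)

Section absolute_continuity.
Context {R : realType}.
Implicit Types (F : R -> R) (p q : R * R) (s : seq (R * R)) (u v : R).

Definition apart p q := (p.2 <= q.1) || (q.2 <= p.1).

Lemma apartC : symmetric apart.
Proof. by move=> p q; rewrite /apart orbC. Qed.

(* Absolute continuity on the whole line, with the finite families of
   non-overlapping intervals given as sequences. *)
Definition abs_continuousT F := forall e : R, 0 < e ->
  exists2 dlt : R, 0 < dlt & forall s, all (fun p => p.1 <= p.2) s ->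
    pairwise apart s -> \sum_(p <- s) (p.2 - p.1) < dlt ->
    \sum_(p <- s) `|F p.2 - F p.1| < e.

Definition clamp u v (x : R) := Num.max u (Num.min x v).

Lemma clamp_itv u v x : u <= v -> u <= clamp u v x <= v.
Proof.
by move=> uv; rewrite /clamp le_max lexx ge_max uv ge_min lexx orbT.
Qed.

Lemma clamp_id u v x : u <= x <= v -> clamp u v x = x.
Proof. by case/andP=> ux xv; rewrite /clamp (min_idPl xv) (max_idPr ux). Qed.

Lemma clamp_le u v x y : x <= y -> clamp u v x <= clamp u v y.
Proof.
by move=> xy; rewrite /clamp ge_max !le_max lexx/= le_min !ge_min xy lexx ?orbT.
Qed.

Lemma clamp_dist u v x y : u <= v -> x <= y ->
  clamp u v y - clamp u v x <= y - x.
Proof.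
move=> uv xy; rewrite /clamp.
case: (leP x v) => xv; case: (leP y v) => yv; case: (leP u x) => ux;
  case: (leP u y) => uy; case: (leP u v) => uv'; lra.
Qed.

(** Constant continuation outside [u, v] turns local absolute continuity into a property on the
    whole line, where Stieltjes measures are available. *)
Lemma abs_continuous_clamp u v F : u <= v -> abs_continuous u v F ->
  abs_continuousT (F \o clamp u v).
Proof.
move=> uv acF e e0; have [dlt dlt0 H] := acF _ e0; exists dlt => // s s1 s2 s3.
pose z : R * R := (0, 0).
have := H (size s) (fun i => clamp u v (nth z s i).1)
                   (fun i => clamp u v (nth z s i).2).
have nthle i : (i < size s)%N -> (nth z s i).1 <= (nth z s i).2.
  by move=> i_s; move/allP : s1; apply; rewrite mem_nth.
rewrite [in X in _ -> X](big_nth z) big_mkord; apply.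
- move=> i; have /andP[? _] := clamp_itv (nth z s i).1 uv.
  have /andP[_ ?] := clamp_itv (nth z s i).2 uv.
  by split => //; split => //; exact/clamp_le/nthle.
- move=> i j ij.
  have : apart (nth z s i) (nth z s j).
    have /(pairwiseP z) H2 := s2.
    move: ij; rewrite -val_eqE neq_ltn => /orP[] ij.
      by apply: H2 => //; rewrite inE ltn_ord.
    by rewrite apartC; apply: H2 => //; rewrite inE ltn_ord.
  by case/orP => ?; [left|right]; exact: clamp_le.
- apply: le_lt_trans s3; rewrite (big_nth z) big_mkord; apply: ler_sum => i _.
  exact/clamp_dist/nthle.
Qed.

(** Covers obtained from an outer measure may overlap, while absolute continuity only concerns
    non-overlapping families. Replacing two overlapping intervals by their hull does not increase
    the total length. *)
Lemma merge_itvs s : all (fun p => p.1 <= p.2) s ->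
  exists s', [/\ all (fun p => p.1 <= p.2) s', pairwise apart s',
    \sum_(p <- s') (p.2 - p.1) <= \sum_(p <- s) (p.2 - p.1) &
    forall p, p \in s -> exists2 q, q \in s' & q.1 <= p.1 /\ p.2 <= q.2].
Proof.
have insert n : forall p s, size s = n -> p.1 <= p.2 ->
    all (fun p => p.1 <= p.2) s -> pairwise apart s ->
    exists s', [/\ all (fun p => p.1 <= p.2) s', pairwise apart s',
      \sum_(p <- s') (p.2 - p.1) <= p.2 - p.1 + \sum_(p <- s) (p.2 - p.1) &
      forall q, q \in p :: s -> exists2 r, r \in s' & r.1 <= q.1 /\ q.2 <= r.2].
  elim: n => [|n IH] p r sn p12 r1 r2.
    move/size0nil: sn => -> ; exists [:: p]; rewrite /= p12; split => //.
      by rewrite big_seq1 big_nil addr0.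
    by move=> q; rewrite inE => /eqP ->; exists p; rewrite ?inE.
  have [/hasP[q qr npq]|/hasPn npr] := boolP (has (fun q => ~~ apart p q) r).
    have perm := perm_to_rem qr.
    have q12 : q.1 <= q.2 by move/allP : r1; exact.
    move: npq; rewrite /apart negb_or -!ltNge => /andP[pq qp].
    (* The hull may overlap further members of the family, so it is inserted anew into the family
       without q; hence the induction on the size. *)
    pose h := (Num.min p.1 q.1, Num.max p.2 q.2).
    have [] := IH h (rem q r).
    - by rewrite size_rem// sn.
    - by rewrite /h/= le_max !ge_min p12.
    - by apply/allP => x /mem_rem xr; move/allP : r1; exact.
    - by apply: subseq_pairwise r2; exact: rem_subseq.
    move=> s' [s1 s2 s3 s4]; exists s'; split => //.
      rewrite (perm_big _ perm)/= big_cons; apply: (le_trans s3).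
      rewrite addrA lerD2r /h /=.
      by case: (leP p.1 q.1) => ?; case: (leP p.2 q.2) => ?; lra.
    have [t ts' [th1 th2]] := s4 h (mem_head _ _).
    have tp : t.1 <= p.1 /\ p.2 <= t.2.
      split; first by rewrite (le_trans th1)// ge_min lexx.
      by rewrite (le_trans _ th2)// le_max lexx.
    have tq : t.1 <= q.1 /\ q.2 <= t.2.
      split; first by rewrite (le_trans th1)// ge_min lexx orbT.
      by rewrite (le_trans _ th2)// le_max lexx orbT.
    move=> x; rewrite inE => /predU1P[->|]; first by exists t.
    rewrite (perm_mem perm) inE => /predU1P[->|xr]; first by exists t.
    by apply: s4; rewrite inE xr orbT.
  exists (p :: r); split; first by rewrite /= p12.
  - by rewrite /= r2 andbT; apply/allP => q /npr; rewrite negbK.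
  - by rewrite big_cons.
  - by move=> q qpr; exists q.
elim: s => [_|p s IH /=/andP[p12 s12]].
  by exists [::]; split => //; rewrite !big_nil.
have [s' [s1 s2 s3 s4]] := IH s12.
have [t [t1 t2 t3 t4]] := insert _ p s' erefl p12 s1 s2.
exists t; split => //; first by rewrite big_cons (le_trans t3)// lerD2l.
move=> q; rewrite inE => /predU1P[->|/s4[r rs' [rq qr]]].
  exact/t4/mem_head.
have [|x xt [xr rx]] := t4 r; first by rewrite inE rs' orbT.
by exists x => //; split; [exact: le_trans rq|exact: le_trans rx].
Qed.

End absolute_continuity.

(** * Stieltjes measures of absolutely continuous functions *)

Section ac_measure.
Context {R : realType}.
Implicit Types (F : R -> R) (p q : R * R) (s : seq (R * R)) (u v : R).

Lemma abs_continuousT_delta F x (e : R) : abs_continuousT F -> 0 < e ->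
  exists2 dlt, 0 < dlt & forall y, `|y - x| < dlt -> `|F y - F x| < e.
Proof.
move=> acF e0; have [dlt dlt0 H] := acF _ e0; exists dlt => // y yx.
have [xy|yx'] := leP x y.
  have := H [:: (x, y)]; rewrite /= !big_seq1/= xy => -> //.
  by rewrite ger0_norm ?subr_ge0// in yx.
have := H [:: (y, x)]; rewrite /= !big_seq1/= (ltW yx') distrC => -> //.
by rewrite distrC ger0_norm ?subr_ge0 ?ltW// in yx.
Qed.

Lemma abs_continuousT_continuous F : abs_continuousT F -> continuous F.
Proof.
move=> acF x; apply/cvgrPdist_lt => e e0.
have [dlt dlt0 H] := abs_continuousT_delta x acF e0.
by exists dlt => //= y xy; rewrite distrC; apply: H; rewrite distrC.
Qed.

Lemma lebesgue_stieltjes_itv (G : cumulative R R) x y : x <= y ->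
  lebesgue_stieltjes_measure G `]x, y]%classic = (G y - G x)%:E.
Proof.
move=> xy; rewrite /lebesgue_stieltjes_measure /measure_extension.
by rewrite measurable_mu_extE/= ?wlength_itv_bnd//; exact: is_ocitv.
Qed.

(** Cover N by intervals of total length less than [dlt]. After merging, the increments of G over
    finitely many of them add up to less than e, and these increments bound the Stieltjes
    measure. *)
Lemma abs_continuousT_null (G : cumulative R R) (N : set (measurableTypeR R)) :
  abs_continuousT G -> measurable N -> lebesgue_measure N = 0%E ->
  lebesgue_stieltjes_measure G N = 0%E.
Proof.
move=> acG mN N0; apply/eqP; rewrite eq_le measure_ge0 andbT.
apply/lee_addgt0Pr => e e0; rewrite add0e.
have [dlt dlt0 H] := acG _ e0.
have : (lebesgue_measure N < dlt%:E)%E by rewrite N0 lte_fin.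
rewrite /lebesgue_measure /lebesgue_stieltjes_measure /measure_extension.
move=> /ereal_inf_lt[_ [K [mK NK] <-]] Kdlt.
(* Empty intervals are rewritten with equal endpoints, so that the endpoints are always ordered. *)
have Kitv i : {p : R * R | p.1 <= p.2 & K i = `]p.1, p.2]%classic}.
  apply: cid2; have [x _ Kx] := mK i; exists (x.1, Num.max x.1 x.2) => /=.
    by rewrite le_max lexx.
  rewrite -Kx; case: (leP x.1 x.2) => // x21; rewrite !set_itv_ge//=.
    by rewrite bnd_simp ltxx.
  by rewrite bnd_simp -leNgt ltW.
pose I i : R * R := s2val (Kitv i).
have I12 i : (I i).1 <= (I i).2 by rewrite /I; case: (Kitv i).
have KI i : K i = `](I i).1, (I i).2]%classic by rewrite /I; case: (Kitv i).
have lenK i : wlength idfun (K i) = ((I i).2 - (I i).1)%:E.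
  by rewrite KI wlength_itv_bnd.
have mKi i : measurable (K i : set (measurableTypeR R)).
  by rewrite KI; exact: measurable_itv.
(* Absolute continuity speaks of finite families only: the bound is proved for the finite unions
   [U n] and passes to the whole cover by continuity from below. *)
pose U n := \big[setU/set0]_(i < n) K i.
have mU n : measurable (U n : set (measurableTypeR R)).
  exact: bigsetU_measurable.
have Ue n : (lebesgue_stieltjes_measure G (U n) <= e%:E)%E.
  pose s := [seq I i | i <- iota 0 n].
  have s12 : all (fun p => p.1 <= p.2) s by apply/allP => _ /mapP[i _ ->].
  have [s' [s1 s2 s3 s4]] := merge_itvs s12.
  have ss' : \sum_(p <- s') (p.2 - p.1) < dlt.
    apply: (le_lt_trans s3); rewrite big_map -lte_fin.
    apply: le_lt_trans Kdlt; rewrite -sumEFin.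
    under eq_bigr do rewrite -lenK.
    rewrite -[X in iota 0 X]subn0; apply: nneseries_lim_ge => i _ _.
    by rewrite lenK lee_fin subr_ge0.
  have := H s' s1 s2 ss' => /ltW; rewrite -lee_fin; apply: le_trans.
  pose W (r : seq (R * R)) : set (measurableTypeR R) :=
    \big[setU/set0]_(q <- r) `]q.1, q.2]%classic.
  have mW r : measurable (W r).
    elim: r => [|q r IH]; rewrite /W ?big_nil// big_cons.
    by apply: measurableU; [exact: measurable_itv|exact: IH].
  apply: (@le_trans _ _ (lebesgue_stieltjes_measure G (W s'))).
    apply: le_measure; rewrite ?inE//.
    rewrite /U; apply: (@subset_trans _ (\bigcup_(i < n) K i)).
      by rewrite bigcup_mkord.
    move=> x [i /= ni]; rewrite KI /= in_itv/= => /andP[x1 x2].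
    have [|q qs' [q1 q2]] := s4 (I i).
      by apply: map_f; rewrite mem_iota.
    rewrite /W (big_rem _ qs')/=; left.
    by rewrite /= in_itv/= (le_lt_trans q1)//= (le_trans x2).
  rewrite -sumEFin; elim: s' s1 {s2 s3 s4 ss'} => [|p s' IH] /=.
    by rewrite /W !big_nil measure0.
  move=> /andP[p12 s'12]; rewrite /W !big_cons.
  apply: (@le_trans _ _ (lebesgue_stieltjes_measure G `]p.1, p.2]%classic
    + lebesgue_stieltjes_measure G (W s'))%E).
    by apply: measureU2; [exact: measurable_itv|exact: mW].
  apply: leeD; last exact: IH.
  by rewrite lebesgue_stieltjes_itv// lee_fin ler_norm.
have mUK : measurable (\bigcup_n U n : set (measurableTypeR R)).
  exact: bigcup_measurable.
apply: (@le_trans _ _ (lebesgue_stieltjes_measure G (\bigcup_n U n))).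
  apply: le_measure; rewrite ?inE//.
  move=> x /NK[i _ Kx]; exists i.+1 => //.
  by rewrite /U -bigcup_mkord; exists i => /=.
apply: (@cvge_to_le _ \oo _ _ (lebesgue_stieltjes_measure G \o U)).
  apply: nondecreasing_cvg_mu => //.
  by move=> n m nm; rewrite subsetEset; exact: subset_bigsetU.
by apply: nearW => n; exact: Ue.
Qed.

(** The density is the Radon-Nikodym derivative of the Stieltjes measure of F, which is dominated by
    Lebesgue measure because F is absolutely continuous. *)
Lemma nondecreasing_abs_continuous_integral F u v :
  {homo F : x y / x <= y} -> abs_continuousT F ->
  exists2 f : R -> R, lebesgue_measure.-integrable setT (EFin \o f) &
    forall x, u <= x -> x <= v ->
      F x - F u = \int[lebesgue_measure]_(t in `]u, x]) f t.
Proof.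
move=> ndF acF.
have rcF : right_continuous F.
  by apply: right_continuousW; exact: abs_continuousT_continuous.
pose G : cumulative R R := HB.pack F (isCumulative.Build R _ R F ndF rcF).
have mD : measurable (`]u, v]%classic : set (measurableTypeR R)).
  exact: measurable_itv.
have GE x y : x <= y -> lebesgue_stieltjes_measure G `]x, y]%classic = (F y - F x)%:E.
  exact: lebesgue_stieltjes_itv.
(* Restricting to the bounded interval makes the measure finite, so the density is integrable on the
   whole line. *)
pose nu := mrestr (lebesgue_stieltjes_measure G) mD.
have nufin : fin_num_fun nu.
  move=> A mA; rewrite ge0_fin_numE ?measure_ge0//.
  have [uv|vu] := leP u v; last first.
    by rewrite /nu /mrestr set_itv_ge ?bnd_simp -?leNgt 1?ltW// setI0 measure0.
  apply: (@le_lt_trans _ _ (lebesgue_stieltjes_measure G `]u, v]%classic)).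
    rewrite /nu /mrestr; apply: le_measure; rewrite ?inE//.
    exact: measurableI.
  by rewrite GE ?ltry.
pose fm : {finite_measure set (measurableTypeR R) -> \bar R} :=
  HB.pack nu (@Measure_isFinite.Build _ _ _ nu nufin).
have dom : charge_of_finite_measure fm `<< (@lebesgue_measure R).
  apply/null_content_dominatesP => A mA A0.
  rewrite /charge_of_finite_measure /=/nu /mrestr; apply/eqP.
  rewrite -measure_le0 -(abs_continuousT_null (G := G) acF mA A0).
  by apply: le_measure; rewrite ?inE//; exact: measurableI.
exists (fine \o Radon_Nikodym (charge_of_finite_measure fm) (@lebesgue_measure R)).
  apply: eq_integrable (Radon_Nikodym_integrable dom) => //= x _.
  by rewrite fineK// Radon_Nikodym_fin_num.
move=> x ux xv.
have := Radon_Nikodym_integral dom (measurable_itv `]u, x]).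
rewrite {1}/charge_of_finite_measure /= /nu /mrestr.
rewrite (_ : `]u, x] `&` `]u, v] = `]u, x])%classic; last first.
  apply/seteqP; split => [t []//|t /= tux]; split => //=.
  by move: tux; rewrite !in_itv/= => /andP[-> /le_trans->].
rewrite GE// /Rintegral => RN.
rewrite [X in fine X](_ : _ = (F x - F u)%:E)// RN.
by apply: eq_integral => t _; rewrite /= fineK// Radon_Nikodym_fin_num.
Qed.

End ac_measure.

(** * Total variation and the fundamental theorem of calculus *)

Section ac_variation.
Context {R : realType}.
Implicit Types (F : R -> R) (p q : R * R) (s : seq (R * R)) (u v : R).
Local Notation TV := total_variation.

Lemma variation_itvs F x y (l : seq R) : itv_partition x y l ->
  exists s, [/\ all (fun p => p.1 <= p.2) s, pairwise apart s,
    (forall p, p \in s -> x <= p.1 /\ p.2 <= y),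
    \sum_(p <- s) (p.2 - p.1) = y - x &
    \sum_(p <- s) `|F p.2 - F p.1| = variation x y F l].
Proof.
elim: l x => [x [_ /= /eqP <-]|z l IH x].
  by exists [::]; split; rewrite ?big_nil ?subrr// /variation big_nil.
move=> [/= /andP[xz zl] lasty].
have zy : z <= y.
  by have := itv_partition_le (conj zl lasty : itv_partition z y l).
have [s [s1 s2 s3 s4 s5]] := IH z (conj zl lasty).
exists ((x, z) :: s); rewrite /= !big_cons /= s4 s5 (ltW xz) s2 andbT; split=> //.
- by apply/allP => p /s3[zp _]; rewrite /apart/= zp.
- move=> p; rewrite inE => /predU1P[->//|/s3[zp py]]; split => //.
  by rewrite (le_trans (ltW xz)).
- by rewrite addrC addrA subrK.
- rewrite /variation /= big_nat_recl//=; congr (_ + _).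
Qed.

Lemma total_variation_itvs F x y (e : R) : x <= y -> 0 < e ->
  TV x y F \is a fin_num ->
  exists s, [/\ all (fun p => p.1 <= p.2) s, pairwise apart s,
    (forall p, p \in s -> x <= p.1 /\ p.2 <= y),
    \sum_(p <- s) (p.2 - p.1) = y - x &
    fine (TV x y F) <= \sum_(p <- s) `|F p.2 - F p.1| + e].
Proof.
move=> xy e0 fin; have [_ [_ [l lP <-] <-]] := ub_ereal_sup_adherent e0 fin.
rewrite -/(TV x y F) -{1}(fineK fin) -EFinB lte_fin => h.
have [s [s1 s2 s3 s4 s5]] := variation_itvs F lP.
by exists s; split => //; rewrite s5 -lerBlDr ltW.
Qed.

(** On an interval shorter than the [dlt] that belongs to e = 1 the variation is at most 1, and
    finitely many steps of length [dlt / 2] cover [u, v]. *)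
Lemma abs_continuousT_tv_fin F u v : abs_continuousT F -> u <= v ->
  TV u v F \is a fin_num.
Proof.
move=> acF uv; have [dlt dlt0 H] := acF _ ltr01.
have short x y : x <= y -> y - x < dlt -> (TV x y F <= 1)%E.
  move=> xy yx; apply: ge_ereal_sup => _ [_ [l lP <-] <-].
  have [s [s1 s2 s3 s4 s5]] := variation_itvs F lP.
  by rewrite lee_fin -s5 ltW// H// s4.
have steps n : (TV u (u + n%:R * (dlt / 2)) F <= n%:R%:E)%E.
  elim: n => [|n IH]; first by rewrite mul0r addr0 total_variationxx.
  rewrite (@total_variationD _ _ _ (u + n%:R * (dlt / 2))).
  - rewrite -[in leRHS]natr1 EFinD leeD// short//.
      by rewrite lerD2l ler_wpM2r ?ler_nat// divr_ge0// ltW.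
    by rewrite opprD addrACA subrr add0r -mulrBl -natrB// subSnn mul1r; lra.
  - by rewrite lerDl mulr_ge0// divr_ge0// ltW.
  - by rewrite lerD2l ler_wpM2r ?ler_nat// divr_ge0// ltW.
pose n := Num.truncn ((v - u) / (dlt / 2)).
have vn : v <= u + n.+1%:R * (dlt / 2).
  rewrite -lerBlDl -ler_pdivrMr ?divr_gt0// ltW// truncnS_gt//.
rewrite ge0_fin_numE ?total_variation_ge0//.
apply: le_lt_trans (ltry n.+1%:R); apply: le_trans (steps n.+1).
by rewrite (total_variationD F uv vn) leeDl// total_variation_ge0.
Qed.

(** Each interval of a short family is refined by a partition that nearly attains the variation over
    it. The refined family is still non-overlapping and no longer in total, so the absolute
    continuity of F applies to it. *)
Lemma total_variation_abs_continuous F u v : u <= v -> abs_continuousT F ->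
  abs_continuousT (fun x => fine (TV u (clamp u v x) F)).
Proof.
move=> uv acF e e0.
have fin x y : x <= y -> TV x y F \is a fin_num by exact: abs_continuousT_tv_fin.
have e20 : 0 < e / 2 by rewrite divr_gt0.
have [dlt dlt0 H] := acF _ e20; exists dlt => // s s1 s2 s3.
have approx (n : R) : 0 < n -> forall s, all (fun p => p.1 <= p.2) s ->
    pairwise apart s -> exists s', [/\ all (fun p => p.1 <= p.2) s',
      pairwise apart s',
      (forall q, q \in s' -> exists2 p, p \in s & p.1 <= q.1 /\ q.2 <= p.2),
      \sum_(p <- s') (p.2 - p.1) <= \sum_(p <- s) (p.2 - p.1) &
      \sum_(p <- s) fine (TV p.1 p.2 F) <=
        \sum_(p <- s') `|F p.2 - F p.1| + n *+ size s].
  move=> n0; elim=> [_ _|p r IH /= /andP[p12 r12] /andP[pr rr]].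
    by exists [::]; split; rewrite ?big_nil ?mulr0n ?addr0.
  have [r' [r1 r2 r3 r4 r5]] := IH r12 rr.
  have [t [t1 t2 t3 t4 t5]] := total_variation_itvs p12 n0 (fin _ _ p12).
  exists (t ++ r'); rewrite all_cat t1 r1 pairwise_cat t2 r2 !big_cat !big_cons/=.
  split => //.
  - rewrite andbT; apply/allrelP => x y /t3[px xp] /r3[q /(allP pr) pq [qy yq]].
    case/orP: pq => h; rewrite /apart; apply/orP; [left|right].
      by rewrite (le_trans xp)// (le_trans h).
    by rewrite (le_trans yq)// (le_trans h).
  - move=> q; rewrite mem_cat => /orP[/t3 pq|/r3[x xr xq]].
      by exists p => //; exact: mem_head.
    by exists x => //; rewrite inE xr orbT.
  - by rewrite lerD// t4.
  - by rewrite mulrS; lra.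
pose s' := [seq (clamp u v p.1, clamp u v p.2) | p <- s].
have s'1 : all (fun p => p.1 <= p.2) s'.
  by rewrite all_map; apply/sub_all : s1 => p /= ?; exact: clamp_le.
have s'2 : pairwise apart s'.
  rewrite pairwise_map; apply: sub_pairwise s2 => p q /orP[] pq; apply/orP.
    by left; exact: clamp_le.
  by right; exact: clamp_le.
have s'3 : \sum_(p <- s') (p.2 - p.1) < dlt.
  rewrite big_map; apply: le_lt_trans s3; rewrite big_seq [leRHS]big_seq.
  by apply: ler_sum => p ps; apply: clamp_dist => //; move/allP : s1; exact.
(* This error per interval adds up to at most e / 3; with e / 2 from the refined family the total
   stays below e. *)
have n0 : 0 < e / 3 / (size s).+1%:R by rewrite !divr_gt0.
have [r [r1 r2 _ r4 r5]] := approx _ n0 _ s'1 s'2.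
have := H r r1 r2 (le_lt_trans r4 s'3).
have -> : \sum_(p <- s) `|fine (TV u (clamp u v p.2) F) -
    fine (TV u (clamp u v p.1) F)| = \sum_(p <- s') fine (TV p.1 p.2 F).
  rewrite big_map; apply: eq_big_seq => p ps /=.
  have p12 : p.1 <= p.2 by move/allP : s1; exact.
  have /andP[uc _] := clamp_itv p.1 uv.
  have c12 := clamp_le u v p12.
  rewrite (total_variationD F uc c12) fineD ?fin// addrAC subrr add0r.
  by rewrite ger0_norm// fine_ge0// total_variation_ge0.
have : e / 3 / (size s).+1%:R *+ size s' <= e / 3.
  rewrite size_map -mulr_natr -mulrA ler_piMr ?divr_ge0 ?ltW//.
  by rewrite mulrC ltr_pdivrMr// mul1r ltr_nat.
move=> h1 h2; apply: (le_lt_trans r5); rewrite (le_lt_trans (lerD (ltW h2) h1))//; lra.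
Qed.

(** Jordan decomposition: F is the difference of its variation function V and of V - F, both
    nondecreasing and absolutely continuous, so the monotone case applies to each. *)
Lemma abs_continuous_integral F u v : u < v -> abs_continuous u v F ->
  exists2 f : R -> R, lebesgue_measure.-integrable setT (EFin \o f) &
    forall x, u <= x -> x <= v ->
      F x - F u = \int[lebesgue_measure]_(t in `]u, x]) f t.
Proof.
move=> uv acF; have uv' := ltW uv.
pose F1 := F \o clamp u v.
have acF1 : abs_continuousT F1 by exact: abs_continuous_clamp.
have fin x y : x <= y -> TV x y F1 \is a fin_num by exact: abs_continuousT_tv_fin.
pose V x := fine (TV u (clamp u v x) F1).
have acV : abs_continuousT V by exact: total_variation_abs_continuous.
have ucl x : u <= clamp u v x by have /andP[] := clamp_itv x uv'.
have F1c x : F1 (clamp u v x) = F1 x.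
  by rewrite /F1/= clamp_id// clamp_itv.
have VB x y : x <= y -> V y - V x = fine (TV (clamp u v x) (clamp u v y) F1).
  move=> xy; rewrite /V (total_variationD F1 (ucl x) (clamp_le u v xy)).
  by rewrite fineD ?fin ?clamp_le// addrAC subrr add0r.
have VF x y : x <= y -> `|F1 y - F1 x| <= V y - V x.
  move=> xy; have cxy := clamp_le u v xy.
  have := total_variation_ge F1 cxy; rewrite VB// !F1c.
  by rewrite -lee_fin fineK// fin.
have ndV : {homo V : x y / x <= y}.
  by move=> x y /VF VF'; rewrite -subr_ge0 (le_trans _ VF').
(* W is nondecreasing because the variation over an interval dominates the increment of F. *)
pose W x := V x - F1 x.
have acW : abs_continuousT W.
  move=> e e0; have e20 : 0 < e / 2 by rewrite divr_gt0.
  have [d1 d10 H1] := acV _ e20; have [d2 d20 H2] := acF1 _ e20.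
  exists (Num.min d1 d2); first by rewrite lt_min d10.
  move=> s s1 s2; rewrite lt_min => /andP[sd1 sd2].
  rewrite (splitr e); apply: le_lt_trans (ltrD (H1 _ s1 s2 sd1) (H2 _ s1 s2 sd2)).
  rewrite -big_split/=; apply: ler_sum => p _; rewrite /W.
  by rewrite opprD addrACA -opprD; exact: ler_normB.
have ndW : {homo W : x y / x <= y}.
  move=> x y /VF; rewrite /W ler_norml => /andP[_ ?]; lra.
have [f intf fE] := nondecreasing_abs_continuous_integral u v ndV acV.
have [g intg gE] := nondecreasing_abs_continuous_integral u v ndW acW.
exists (f \- g) => [|x ux xv].
  rewrite (_ : _ \o _ = (EFin \o f) \- (EFin \o g))%E; first exact: integrableB.
  by apply/funext => x.
have mI : measurable (`]u, x]%classic : set (measurableTypeR R)).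
  exact: measurable_itv.
rewrite /= RintegralB//; [|exact: integrableS intf|exact: integrableS intg].
rewrite -fE// -gE// /W.
have <- : F1 x = F x by rewrite /F1/= clamp_id// ux.
have <- : F1 u = F u by rewrite /F1/= clamp_id// lexx uv'.
lra.
Qed.

Lemma abs_continuous_derivable F u v : u < v -> abs_continuous u v F ->
  exists2 f : R -> R, (forall x, u <= x -> x <= v ->
      F x - F u = \int[lebesgue_measure]_(t in `]u, x]) f t) &
    lebesgue_measure.-integrable setT (EFin \o f) /\
    {ae lebesgue_measure, forall x, u < x < v ->
      derivable F x 1 /\ derive1 F x = f x}.
Proof.
move=> uv acF; have [f intf fE] := abs_continuous_integral uv acF.
exists f => //; split => //.
have locf : locally_integrable setT f.
  by apply: open_integrable_locally => //; exact: openT.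
have intfy y : lebesgue_measure.-integrable
    [set` Interval (BRight u) (BRight y)] (EFin \o f).
  by apply: integrableS intf => //; exact: measurable_itv.
have := FTC1 intfy locf; apply: filterS.
  exact: (ae_filter_ringOfSetsType lebesgue_measure).
move=> x /= H /andP[ux xv].
have [dF F'] := H ux.
pose H0 := (fun x => \int[lebesgue_measure]_(t in `]u, x]) f t) : R -> R.
have FE : \forall y \near x, H0 y + F u = F y.
  near=> y; rewrite /H0 -fE ?subrK//.
    by apply/ltW; near: y; exact: lt_nbhsr.
  by apply/ltW; near: y; exact: lt_nbhsl.
have isF : is_derive x 1 F (f x).
  apply: (@near_eq_is_derive _ _ _ (fun y => H0 y + F u)) => //.
  have isH : is_derive x 1 H0 (f x).
    by apply: DeriveDef; [exact: dF|rewrite -derive1E; exact: F'].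
  by rewrite -[f x]addr0; apply: is_deriveD.
by split; [exact: ex_derive|rewrite derive1E derive_val].
Unshelve. all: by end_near. Qed.

(** Absolute continuity is essential here: the negative of the Cantor function decreases although
    its derivative vanishes almost everywhere. *)
Lemma abs_continuous_nondecreasing F u v : u < v -> abs_continuous u v F ->
  {ae lebesgue_measure, forall x, u < x < v -> derivable F x 1 -> 0 <= derive1 F x} ->
  F u <= F v.
Proof.
move=> uv acF F'0.
have [f fE [intf derF]] := abs_continuous_derivable uv acF.
rewrite -subr_ge0 fE ?(ltW uv)//.
rewrite -Rintegral_itv_bndo_bndc; last first.
  by apply: integrableS intf => //; exact: measurable_itv.
apply: fine_ge0.
(* The density is nonnegative only almost everywhere, so it is replaced by its absolute value under
   the integral. *)
rewrite (@ae_eq_integral _ (measurableTypeR R) R lebesgue_measure `]u, v[%classic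
  (fun x => `|f x|%:E) (fun x => (f x)%:E)).
- by apply: integral_ge0 => x _; rewrite lee_fin.
- exact: measurable_itv.
- by apply: measurable_int; apply: integrableS intf => //; exact: measurable_itv.
- apply/measurable_EFinP/measurableT_comp => //; apply/measurable_EFinP.
  by apply: measurable_int; apply: integrableS intf => //; exact: measurable_itv.
- apply: filterS2 derF F'0; first exact: (ae_filter_ringOfSetsType lebesgue_measure).
  move=> x H1 H2 /=; rewrite in_itv/= => uxv.
  by have [dF dFf] := H1 uxv; rewrite ger0_norm// -dFf H2.
Qed.

End ac_variation.

(** * The mixing density *)

Lemma derivable_is_derive1 {R : realType} (f : R -> R) (x : R) :
  derivable f x 1 -> is_derive x 1 f (derive1 f x).
Proof. by move=> df; rewrite derive1E; exact/derivableP. Qed.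

Lemma is_derive_derive1 {R : realType} (f : R -> R) (x l : R) :
  is_derive x 1 f l -> derive1 f x = l.
Proof. by move=> df; rewrite derive1E derive_val. Qed.

Section ac_closure.
Context {R : realType}.
Implicit Types (F G : R -> R) (u v x y c : R).

(** Transfers absolute continuity to combinations of logarithms; two dominating functions are
    provided because the applications involve [h] at two arguments, or [h] together with the
    identity. *)
Lemma abs_continuous_dominated u v F1 F2 G (K : R) : 0 < K ->
  (forall x y, u <= x -> x <= y -> y <= v ->
     `|G y - G x| <= K * (`|F1 y - F1 x| + `|F2 y - F2 x|)) ->
  abs_continuous u v F1 -> abs_continuous u v F2 -> abs_continuous u v G.
Proof.
move=> K0 GF ac1 ac2 e e0; have eK : 0 < e / K / 2 by rewrite !divr_gt0.
have [d1 d10 H1] := ac1 _ eK; have [d2 d20 H2] := ac2 _ eK.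
exists (Num.min d1 d2); first by rewrite lt_min d10.
move=> n x y xy na; rewrite lt_min => /andP[l1 l2].
apply: (@le_lt_trans _ _ (\sum_(i < n)
    K * (`|F1 (y i) - F1 (x i)| + `|F2 (y i) - F2 (x i)|))).
  by apply: ler_sum => i _; have [? [? ?]] := xy i; exact: GF.
rewrite -mulr_sumr big_split/= -ltr_pdivlMl// mulrC [X in _ < X]splitr.
exact: ltrD (H1 _ _ _ xy na l1) (H2 _ _ _ xy na l2).
Qed.

Lemma abs_continuous_id u v : abs_continuous u v id.
Proof.
move=> e e0; exists e => // n x y xy _; apply: le_lt_trans.
by apply: ler_sum => i _; have [_ [? _]] := xy i; rewrite ger0_norm// subr_ge0.
Qed.

Lemma abs_continuous_scale u v F c : 0 < c ->
  abs_continuous (c * u) (c * v) F -> abs_continuous u v (fun x => F (c * x)).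
Proof.
move=> c0 acF e e0; have [d d0 H] := acF _ e0.
exists (d / c); first by rewrite divr_gt0.
move=> n x y xy na l; apply: (H n (fun i => c * x i) (fun i => c * y i)).
- by move=> i; rewrite !ler_pM2l.
- by move=> i j /na; rewrite !ler_pM2l.
- rewrite ltr_pdivlMr// in l; apply: le_lt_trans l.
  by rewrite mulrC mulr_sumr; apply: ler_sum => i _; rewrite mulrBr.
Qed.

(** A positive lower bound for [h] on a compact interval makes the logarithm Lipschitz on the values
    of [h]. *)
Lemma abs_continuous_gt0 u v F : u <= v -> abs_continuous u v F ->
  (forall x, u <= x <= v -> 0 < F x) ->
  exists2 m : R, 0 < m & forall x, u <= x <= v -> m <= F x.
Proof.
move=> uv acF F0.
have cF : continuous (F \o clamp u v).
  exact/abs_continuousT_continuous/abs_continuous_clamp.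
have [z zuv zmin] := EVT_min uv (continuous_subspaceT cF).
exists (F (clamp u v z)); first by apply: F0; exact: clamp_itv.
by move=> x xuv; have := zmin x; rewrite /= in_itv/= (clamp_id xuv); exact.
Qed.

Lemma ln_dist (m : R) x y : 0 < m -> m <= x -> m <= y ->
  `|ln y - ln x| <= m^-1 * `|y - x|.
Proof.
move=> m0.
suff H a b : m <= a -> a <= b -> `|ln b - ln a| <= m^-1 * `|b - a|.
  by case: (leP x y) => [xy mx _|/ltW yx _ my]; [|rewrite distrC [X in _ * X]distrC]; exact: H.
move=> ma ab; have a0 := lt_le_trans m0 ma; have b0 := lt_le_trans a0 ab.
rewrite !ger0_norm ?subr_ge0 ?ler_ln//.
rewrite -ln_div ?posrE//; apply: (@le_trans _ _ (b / a - 1)).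
  have := @le_ln1Dx R (b / a - 1); rewrite subrKC; apply.
  by rewrite ltrBrDr addNr divr_gt0.
have -> : b / a - 1 = a^-1 * (b - a) by field; rewrite gt_eqF.
by rewrite ler_wpM2r ?subr_ge0// lef_pV2 ?posrE.
Qed.

End ac_closure.

Section mixing_density.
Context {R : realType}.
Variable h : R -> R.
Hypothesis h_gt0 : forall x : R, 0 < x -> x < 1 -> 0 < h x.
Hypothesis h_ac : loc_abs_continuous01 h.
Local Notation mu := (@lebesgue_measure R).

Lemma ae_derivable_mixing u v : 0 < u -> u < v -> v < 1 ->
  {ae mu, forall x, u < x < v -> derivable h x 1}.
Proof.
move=> u0 uv v1.
have [f _ [_ H]] := abs_continuous_derivable uv (h_ac u0 (ltW uv) v1).
apply: filterS H; first exact: (ae_filter_ringOfSetsType mu).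
by move=> x H /H[].
Qed.

(** The logarithmic derivative of h(c z) / h(z) is (ell(z) - ell(c z)) / z, which is nonnegative
    almost everywhere since c z <= z. The ratio is stated without divisions. *)
Lemma mixing_ratio_nondecreasing c x y : ae_nondecreasing `]0, 1[ (ell h) ->
  0 < c -> c < 1 -> 0 < x -> x <= y -> y < 1 ->
  h (c * x) * h y <= h (c * y) * h x.
Proof.
move=> [N negN ndN] c0 c1 x0; rewrite le_eqVlt => /predU1P[->//|xy] y1.
have y0 := lt_trans x0 xy.
have c01 z : 0 < z -> z < 1 -> 0 < c * z /\ c * z < 1.
  by move=> z0 z1; rewrite mulr_gt0//; split => //; rewrite mulr_ilt1 ?ltW.
have [cx0 cx1] := c01 _ x0 (lt_trans xy y1).
have [cy0 cy1] := c01 _ y0 y1.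
have x1 := lt_trans xy y1.
have cxy : c * x < c * y by rewrite ltr_pM2l.
have ac1 := h_ac x0 (ltW xy) y1.
have ac2 := h_ac cx0 (ltW cxy) cy1.
have [m m0 hm] : exists2 m : R, 0 < m & forall z, x <= z <= y -> m <= h z.
  apply: abs_continuous_gt0 (ltW xy) ac1 _ => z /andP[xz zy].
  by apply: h_gt0; [exact: lt_le_trans xz|exact: le_lt_trans y1].
have [m' m'0 hm'] : exists2 m : R, 0 < m & forall z, c * x <= z <= c * y -> m <= h z.
  apply: abs_continuous_gt0 (ltW cxy) ac2 _ => z /andP[xz zy].
  by apply: h_gt0; [exact: lt_le_trans xz|exact: le_lt_trans cy1].
pose G z := ln (h (c * z)) - ln (h z).
have acG : abs_continuous x y G.
  apply: (@abs_continuous_dominated _ _ _ (fun z => h (c * z)) h _ (m'^-1 + m^-1)).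
  - by rewrite addr_gt0 ?invr_gt0.
  - move=> a b xa ab bB; have xb := le_trans xa ab; have ay := le_trans ab bB.
    have := @ln_dist _ m' (h (c * a)) (h (c * b)) m'0.
    rewrite !hm' ?ler_pM2l ?xa ?xb//= => /(_ isT isT) l1.
    have := @ln_dist _ m (h a) (h b) m0.
    rewrite !hm ?xa ?xb//= => /(_ isT isT) l2.
    have -> : G b - G a = ln (h (c * b)) - ln (h (c * a)) - (ln (h b) - ln (h a)).
      by rewrite /G; lra.
    apply: (le_trans (ler_normB _ _)); apply: (le_trans (lerD l1 l2)).
    have ? : 0 <= m'^-1 by rewrite invr_ge0 ltW.
    have ? : 0 <= m^-1 by rewrite invr_ge0 ltW.
    by rewrite mulrDr lerD// ler_wpM2r// ?lerDl ?lerDr.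
  - exact: abs_continuous_scale.
  - exact: ac1.
have : G x <= G y.
  apply: (abs_continuous_nondecreasing xy acG).
  (* Both z and c z must avoid the points of non-derivability and the exceptional set N; scaling
     preserves null sets. *)
  have der1 := ae_derivable_mixing x0 xy y1.
  have der2 := ae_scale c0 (ae_derivable_mixing cx0 cxy cy1).
  have N1 : {ae mu, forall z, ~ N z}.
    by move: negN => [B [? ? NB]]; exists B; split => // z /= /contrapT /NB.
  have N2 := ae_scale c0 N1.
  have aeF := ae_filter_ringOfSetsType mu.
  apply: filterS2 (filterI der1 der2) (filterI N1 N2).
  move=> z [d1 d2] [Nz Ncz] /andP[xz zy] _.
  rewrite /= xz zy in d1; have {}d1 := d1 isT.
  rewrite /= !ltr_pM2l// xz zy in d2; have {}d2 := d2 isT.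
  have z0 := lt_trans x0 xz; have z1 := lt_trans zy y1.
  have [cz0 cz1] := c01 _ z0 z1.
  have hz := h_gt0 z0 z1; have hcz := h_gt0 cz0 cz1.
  have := ndN (c * z) z; rewrite /= !in_itv/= cz0 cz1 z0 z1.
  have czz : c * z <= z by rewrite ler_piMl ?ltW.
  move=> /(_ (conj isT Ncz) (conj isT Nz) czz); rewrite /ell => ell_le.
  have D1 : is_derive z 1 (fun z => ln (h z)) ((h z)^-1 * derive1 h z).
    apply: is_derive1_comp; first exact: is_derive1_ln.
    exact: derivable_is_derive1 d1.
  have D2 : is_derive z 1 (fun z => ln (h (c * z))) ((h (c * z))^-1 * (derive1 h (c * z) * c)).
    apply: (@is_derive1_comp _ (fun w => ln w) (fun z => h (c * z))).
      exact: is_derive1_ln.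
    apply: (@is_derive1_comp _ h (fun z => c * z)).
      exact: derivable_is_derive1 d2.
    have := @is_deriveZ _ _ _ id c z 1 1 _.
    by rewrite /GRing.scale/= mulr1; apply; exact: is_derive_id.
  rewrite (is_derive_derive1 (is_deriveB D2 D1)).
  rewrite -(pmulr_rge0 _ z0).
  by move: ell_le; rewrite -subr_ge0; congr (_ <= _); ring.
rewrite /G -!ln_div ?posrE ?h_gt0// ler_ln ?posrE ?divr_gt0 ?h_gt0//.
by rewrite ler_pdivrMr ?h_gt0// mulrAC ler_pdivlMr ?h_gt0.
Qed.

(** The logarithmic derivative of h(z) z^A is (A - ell(z)) / z, which is at most 0 almost
    everywhere. *)
Lemma mixing_powR_nonincreasing A x y :
  {ae mu, forall z : R, 0 < z -> z < 1 -> A <= ell h z} ->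
  0 < x -> x <= y -> y < 1 -> h y * y `^ A <= h x * x `^ A.
Proof.
move=> ellA x0; rewrite le_eqVlt => /predU1P[->//|xy] y1.
have y0 := lt_trans x0 xy; have x1 := lt_trans xy y1.
have ac1 := h_ac x0 (ltW xy) y1.
have [m m0 hm] : exists2 m : R, 0 < m & forall z, x <= z <= y -> m <= h z.
  apply: abs_continuous_gt0 (ltW xy) ac1 _ => z /andP[xz zy].
  by apply: h_gt0; [exact: lt_le_trans xz|exact: le_lt_trans y1].
pose G z := - (ln (h z) + A * ln z).
have acG : abs_continuous x y G.
  apply: (@abs_continuous_dominated _ _ _ h id _ (m^-1 + `|A| * x^-1)).
  - by rewrite ltr_pwDl ?invr_gt0// mulr_ge0// invr_ge0 ltW.
  - move=> a b xa ab bB; have xb := le_trans xa ab; have ay := le_trans ab bB.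
    have := @ln_dist _ m (h a) (h b) m0.
    rewrite !hm ?xa ?xb//= => /(_ isT isT) l1.
    have l2 := ln_dist x0 xa xb.
    have -> : G b - G a = - (ln (h b) - ln (h a)) - A * (ln b - ln a).
      by rewrite /G; ring.
    apply: (le_trans (ler_normB _ _)); rewrite normrN normrM.
    apply: (le_trans (lerD l1 (ler_wpM2l (normr_ge0 A) l2))).
    have ? : 0 <= m^-1 by rewrite invr_ge0 ltW.
    have ? : 0 <= `|A| * x^-1 by rewrite mulr_ge0// invr_ge0 ltW.
    by rewrite mulrDr mulrA lerD// ler_wpM2r// ?lerDl ?lerDr.
  - exact: ac1.
  - exact: abs_continuous_id.
have : G x <= G y.
  apply: (abs_continuous_nondecreasing xy acG).
  have der1 := ae_derivable_mixing x0 xy y1.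
  have aeF := ae_filter_ringOfSetsType mu.
  apply: filterS2 der1 ellA => z d1 ell_ge /andP[xz zy] _.
  rewrite xz zy in d1; have {}d1 := d1 isT.
  have z0 := lt_trans x0 xz; have z1 := lt_trans zy y1.
  have hz := h_gt0 z0 z1; have := ell_ge z0 z1; rewrite /ell => {}ell_ge.
  have D1 : is_derive z 1 (fun z => ln (h z)) ((h z)^-1 * derive1 h z).
    apply: is_derive1_comp; first exact: is_derive1_ln.
    exact: derivable_is_derive1 d1.
  have D2 : is_derive z 1 (fun z => A * ln z) (A * z^-1).
    exact: (@is_deriveZ _ _ _ (@ln R) A z 1 z^-1 (is_derive1_ln z0)).
  rewrite (is_derive_derive1 (is_deriveN (is_deriveD D1 D2))).
  rewrite -(pmulr_rge0 _ z0).
  move: ell_ge; rewrite -subr_ge0; congr (_ <= _); field.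
  by rewrite !gt_eqF.
have hx := h_gt0 x0 x1; have hy := h_gt0 y0 y1.
rewrite /G lerN2 -!ln_powR -!lnM ?posrE ?powR_gt0//.
by rewrite ler_ln ?posrE ?mulr_gt0 ?powR_gt0.
Qed.

End mixing_density.

(** * Laplace transforms of the mixing density *)

Lemma nondecreasing_derive1_ge0 {R : realType} (f : R -> R) (x : R) :
  0 < x -> (forall y z, 0 < y -> y <= z -> f y <= f z) -> derivable f x 1 ->
  0 <= derive1 f x.
Proof.
move=> x0 ndf df; rewrite derive1E /derive.
apply: limr_ge; first exact: df.
near=> e; rewrite /= scaler1.
have e0 : e != 0 by near: e; exact: nbhs_dnbhs_neq.
have xe : 0 < e + x.
  rewrite -ltrBlDr sub0r; near: e; apply: nbhs_dnbhs.
  by apply: lt_nbhsr; rewrite oppr_lt0.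
case/orP: (lt_total e0) => [e0'|e0'].
  rewrite /GRing.scale/= nmulr_rge0 ?invr_lt0// subr_le0 ndf//.
  by rewrite gerDr ltW.
rewrite /GRing.scale/= pmulr_rge0 ?invr_gt0// subr_ge0 ndf//.
by rewrite lerDr ltW.
Unshelve. all: by end_near. Qed.

Section laplace.
Context {R : realType}.
Variable h : R -> R.
Hypothesis h_gt0 : forall x : R, 0 < x -> x < 1 -> 0 < h x.
Local Notation mu := (@lebesgue_measure R).
Hypothesis h_int : mu.-integrable `]0, 1[ (EFin \o h).
Implicit Types q t : R.

Definition laplace_fun q t (x : R) : R := x `^ q * h x * expR (- (x * t / 2)).

Definition laplace q t : R := \int[mu]_(x in `]0, 1[) laplace_fun q t x.

Let mI : measurable (`]0, 1[%classic : set (measurableTypeR R)). Proof. exact: measurable_itv. Qed.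

Lemma laplace_fun_gt0 q t x : 0 < x < 1 -> 0 < laplace_fun q t x.
Proof.
by case/andP=> x0 x1; rewrite !mulr_gt0 ?expR_gt0 ?powR_gt0 ?h_gt0.
Qed.

Lemma powR_le1 q x : 0 <= q -> 0 < x < 1 -> x `^ q <= 1.
Proof.
move=> q0 /andP[x0 x1].
by have := @ge0_ler_powR R q q0 x 1; rewrite powR1; apply; rewrite ?nnegrE// ltW.
Qed.

Lemma laplace_fun_le q t (T : R) x : 0 <= q -> `|t| <= T -> 0 < x < 1 ->
  laplace_fun q t x <= h x * expR (T / 2).
Proof.
move=> q0 tT /[dup] x01 /andP[x0 x1].
have hx : 0 <= h x by exact/ltW/h_gt0.
rewrite /laplace_fun ler_pM ?expR_ge0//.
- by rewrite mulr_ge0// powR_ge0.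
- by rewrite ler_piMl// powR_le1.
- rewrite ler_expR -mulNr -[in leLHS]mulrN ler_pM2r//.
  apply: (le_trans (ler_norm _)); rewrite normrM normrN (gtr0_norm x0).
  by apply: le_trans tT; rewrite ler_piMl// ltW.
Qed.

Lemma measurable_laplace_fun q t :
  measurable_fun (`]0, 1[%classic : set R) (laplace_fun q t).
Proof.
have /measurable_EFinP mh : measurable_fun (`]0, 1[%classic : set R) (EFin \o h).
  exact: measurable_int h_int.
apply: measurable_funM; first apply: measurable_funM => //.
  by apply: measurable_funTS; exact: measurable_powR.
apply: measurable_funTS; apply: measurableT_comp => //.
apply: measurableT_comp => //; apply: measurable_funM => //.
exact: measurable_funM.
Qed.

Lemma integrable_laplace_fun q t : 0 <= q ->
  mu.-integrable `]0, 1[ (EFin \o laplace_fun q t).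
Proof.
move=> q0.
have ih : mu.-integrable `]0, 1[ (fun x => (expR (`|t| / 2))%:E * (h x)%:E)%E.
  exact: integrableZl.
apply: (le_integrable mI _ _ ih).
  by apply/measurable_EFinP; exact: measurable_laplace_fun.
move=> x /=; rewrite in_itv/= => x01.
rewrite lee_fin (ger0_norm (ltW (laplace_fun_gt0 q t x01))).
apply: le_trans (ler_norm _); rewrite mulrC.
exact: laplace_fun_le.
Qed.

Lemma Rintegral01_gt0 (f : R -> R) : mu.-integrable `]0, 1[ (EFin \o f) ->
  (forall x, 0 < x < 1 -> 0 < f x) -> 0 < \int[mu]_(x in `]0, 1[) f x.
Proof.
move=> intf f0; have f0' x : `]0, 1[%classic x -> 0 <= f x.
  by rewrite /= in_itv/= => /f0/ltW.
rewrite lt_neqAle Rintegral_ge0// andbT; apply/negP => /eqP/esym f00.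
have : (\int[mu]_(x in `]0%R, 1%R[) `|(EFin \o f) x|)%E = 0%E.
  transitivity (\int[mu]_(x in `]0%R, 1%R[) (f x)%:E)%E.
    by apply: eq_integral => x /set_mem /f0' fx; rewrite /= ger0_norm.
  by rewrite -[LHS]fineK ?integrable_fin_num// [fine _]f00.
move/(ae_eq_integral_abs mu mI (measurable_int _ intf)) => [B [mB B0 fB]].
have : (mu `]0%R, 1%R[ <= mu B)%E.
  apply: le_measure; rewrite ?inE// => x /= x01; apply: fB => /=.
  move=> /(_ x01) [fx0]; move: x01; rewrite in_itv/= => /f0.
  by rewrite fx0 ltxx.
by rewrite B0 lebesgue_measure_itv/= lte_fin ltr01 oppr0 adde0 lee_fin ler10.
Qed.

Lemma laplace_gt0 q t : 0 <= q -> 0 < laplace q t.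
Proof.
move=> q0; apply: Rintegral01_gt0; first exact: integrable_laplace_fun.
by move=> x x01; exact: laplace_fun_gt0.
Qed.

Lemma laplace_funS q t x : 0 < x -> laplace_fun (q + 1) t x = x * laplace_fun q t x.
Proof.
move=> x0; rewrite /laplace_fun powRD ?powRr1 ?ltW//; first by ring.
by apply/implyP => _; rewrite gt_eqF.
Qed.

Lemma laplaceS q t :
  laplace (q + 1) t = \int[mu]_(x in `]0, 1[) (x * laplace_fun q t x).
Proof.
apply: eq_Rintegral => x /set_mem /=; rewrite in_itv/= => /andP[x0 _].
exact: laplace_funS.
Qed.

Lemma integrable_laplace_funS q t : 0 <= q ->
  mu.-integrable `]0, 1[ (EFin \o (fun x => x * laplace_fun q t x)).
Proof.
move=> q0; apply: eq_integrable (@integrable_laplace_fun (q + 1) t _) => //.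
  move=> x /set_mem /=; rewrite in_itv/= => /andP[x0 _].
  by rewrite laplace_funS.
by rewrite addr_ge0.
Qed.

Lemma laplaceS_lt q t : 0 <= q -> laplace (q + 1) t < laplace q t.
Proof.
move=> q0; rewrite -subr_gt0 laplaceS -RintegralB//; last 2 first.
- exact: integrable_laplace_fun.
- exact: integrable_laplace_funS.
apply: Rintegral01_gt0.
  rewrite (_ : _ \o _ = (EFin \o laplace_fun q t) \-
    (EFin \o (fun x => x * laplace_fun q t x)%R))%E; last by apply/funext.
  by apply: integrableB => //; [exact: integrable_laplace_fun|exact: integrable_laplace_funS].
move=> x x01; rewrite subr_gt0 gtr_pMl; last exact: laplace_fun_gt0.
by case/andP: x01.
Qed.

Lemma is_derive_laplace q t : 0 <= q ->
  is_derive t 1 (laplace q) (- (laplace (q + 1) t / 2)).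
Proof.
move=> q0.
have intf (x : R) : `]t - 1, t + 1[%classic x -> mu.-integrable `]0, 1[ (EFin \o laplace_fun q x).
  by move=> _; exact: integrable_laplace_fun.
have dexp (x y : R) : is_derive x 1 (laplace_fun q ^~ y) (- (y / 2 * laplace_fun q x y)).
  rewrite /laplace_fun.
  have D1 : is_derive x 1 (fun s : R => - (y * s / 2)) (- (y / 2)).
    rewrite (_ : (fun s : R => _) = (fun s => (- (y / 2)) *: s)); last first.
      by apply/funext => s; rewrite /GRing.scale/=; ring.
    have := @is_deriveZ _ _ _ id (- (y / 2)) x 1 1 (is_derive_id _ _).
    by rewrite /GRing.scale/= mulr1.
  have D2 : is_derive x 1 (fun s => expR (- (y * s / 2)))
      (expR (- (y * x / 2)) * - (y / 2)).
    exact: (@is_derive1_comp _ expR (fun s => - (y * s / 2)) _ _ _ (is_derive_expR _) D1).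
  have := @is_deriveZ _ _ _ (fun s => expR (- (y * s / 2))) (y `^ q * h y) x 1 _ D2.
  by move=> D3; apply: (is_derive_eq D3); rewrite /GRing.scale/=; ring.
have p1E (x y : R) : partial1of2 (laplace_fun q) x y = - (y / 2 * laplace_fun q x y).
  by rewrite /partial1of2 derive1E derive_val.
have derf1 (x y : R) : `]t - 1, t + 1[%classic x -> `]0, 1[%classic y ->
    derivable (laplace_fun q ^~ y) x 1 by move=> _ _; exact: ex_derive.
(* Differentiation brings down a factor y / 2 <= 1, and parameters within distance 1 of t are
   bounded by |t| + 1, so G dominates the derivatives uniformly. *)
pose G y := `|h y| * expR ((`|t| + 1) / 2).
have intG : mu.-integrable `]0, 1[ (EFin \o G).
  rewrite (_ : _ \o _ = fun y => (expR ((`|t| + 1) / 2)%R)%:E * `|(h y)%:E|)%E; last first.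
    by apply/funext => y; rewrite /G/= -EFinM mulrC.
  by apply: integrableZl => //; exact: integrable_abse.
have G_ge0 y : 0 <= G y by rewrite mulr_ge0// expR_ge0.
have G_ub (x y : R) : `]t - 1, t + 1[%classic x -> `]0, 1[%classic y ->
    `|partial1of2 (laplace_fun q) x y| <= G y.
  rewrite /= !in_itv/= => /andP[x1 x2] /[dup] y01 /andP[y0 y1].
  rewrite p1E normrN ger0_norm; last first.
    by rewrite mulr_ge0 ?divr_ge0 ?ltW// laplace_fun_gt0.
  apply: (@le_trans _ _ (laplace_fun q x y)).
    by rewrite ler_piMl ?(ltW (laplace_fun_gt0 _ _ y01))//; lra.
  rewrite /G ger0_norm; last exact/ltW/h_gt0.
  apply: laplace_fun_le => //; rewrite ler_norml.
  have := ler_norm t; have := ler_norm (- t); rewrite normrN => ? ?.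
  by apply/andP; split; lra.
have tI : `]t - 1, t + 1[%classic t by rewrite /= in_itv/=; apply/andP; split; lra.
apply: DeriveDef.
  exact: (derivable_under_integral mI tI intf derf1 G_ge0 intG G_ub).
rewrite -derive1E (differentiation_under_integral mI tI intf derf1 G_ge0 intG G_ub).
rewrite (_ : - _ = (- 2^-1) * laplace (q + 1) t); last by ring.
rewrite laplaceS -RintegralZl//; last exact: integrable_laplace_funS.
by apply: eq_Rintegral => y _; rewrite p1E; ring.
Qed.

End laplace.

(** * Monotonicity of the quotient I_(q+1) / I_q and of r *)

Section laplace_monotonicity.
Context {R : realType}.
Variable h : R -> R.
Hypothesis h_gt0 : forall x : R, 0 < x -> x < 1 -> 0 < h x.
Local Notation mu := (@lebesgue_measure R).
Hypothesis h_int : mu.-integrable `]0, 1[ (EFin \o h).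
Implicit Types q t m : R.

Let mI : measurable (`]0, 1[%classic : set (measurableTypeR R)).
Proof. exact: measurable_itv. Qed.

Let int01 (f : R -> R) := mu.-integrable `]0, 1[ (EFin \o f).

Let int01Z (f : R -> R) (k : R) : int01 f -> int01 (fun x => k * f x).
Proof. by move=> intf; exact: (@integrableZl _ _ _ _ _ mI k (EFin \o f) intf). Qed.

Let le_int01 (f g : R -> R) : int01 f -> int01 g ->
  (forall x, 0 < x < 1 -> f x <= g x) ->
  \int[mu]_(x in `]0, 1[) f x <= \int[mu]_(x in `]0, 1[) g x.
Proof.
move=> intf intg fg; apply: (@le_Rintegral _ _ _ mu _ f g mI intf intg).
by move=> x /=; rewrite in_itv/=; exact: fg.
Qed.

Let int01_Zl (f : R -> R) (k : R) : int01 f ->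
  k * \int[mu]_(x in `]0, 1[) f x = \int[mu]_(x in `]0, 1[) (k * f x).
Proof. by move=> intf; rewrite RintegralZl. Qed.

Lemma integrable_centered (f : R -> R) m : int01 f -> int01 (fun x => x * f x) ->
  int01 (fun x => (x - m) * f x).
Proof.
move=> intf intxf.
rewrite /int01 (_ : _ \o _ = (EFin \o (fun x => x * f x)%R) \-
  (fun x => m%:E * (f x)%:E))%E; last first.
  by apply/funext => x /=; rewrite mulrBl EFinB.
by apply: integrableB => //; exact: integrableZl.
Qed.

Lemma Rintegral_centered (f : R -> R) m : int01 f -> int01 (fun x => x * f x) ->
  \int[mu]_(x in `]0, 1[) ((x - m) * f x) =
  \int[mu]_(x in `]0, 1[) (x * f x) - m * \int[mu]_(x in `]0, 1[) f x.
Proof.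
move=> intf intxf; rewrite -RintegralZl// -RintegralB//.
  by apply: eq_Rintegral => x _; rewrite mulrBl.
exact: int01Z.
Qed.

Lemma laplace_centered q t m : 0 <= q ->
  \int[mu]_(x in `]0, 1[) ((x - m) * laplace_fun h q t x) =
  laplace h (q + 1) t - m * laplace h q t.
Proof.
move=> q0; rewrite Rintegral_centered ?laplaceS//.
- exact: integrable_laplace_fun.
- exact: integrable_laplace_funS.
Qed.

(** I_(q+1) / I_q is the mean of the probability density proportional to [laplace_fun h q s].
    Passing from s to t multiplies that density by the decreasing factor exp (- x (t - s) / 2),
    which lowers the mean. *)
Lemma laplace_mean_nonincreasing q s t : 0 <= q -> s <= t ->
  laplace h (q + 1) t * laplace h q s <= laplace h (q + 1) s * laplace h q t.
Proof.
move=> q0 st; have Ls := laplace_gt0 h_gt0 h_int s q0.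
rewrite -ler_pdivlMr// mulrAC -subr_le0.
set m := _ / _.
rewrite -laplace_centered//.
have int_c u : int01 (fun x => (x - m) * laplace_fun h q u x).
  apply: integrable_centered; first exact: integrable_laplace_fun.
  exact: integrable_laplace_funS.
(* A vanishing integral, weighted by the value at m of the factor exp (- x (t - s) / 2); comparing
   with it leaves an integrand of constant sign. *)
have E0 : expR (- (m * (t - s) / 2)) * \int[mu]_(x in `]0, 1[)
    ((x - m) * laplace_fun h q s x) = 0.
  by rewrite laplace_centered// /m (divfK (lt0r_neq0 Ls)) subrr mulr0.
rewrite -[leRHS]E0 int01_Zl//; apply: le_int01; [exact: int_c|exact/int01Z/int_c|].
move=> x x01.
have -> : laplace_fun h q t x = expR (- (x * (t - s) / 2)) * laplace_fun h q s x.
  rewrite /laplace_fun mulrCA; congr (_ * _); rewrite -expRD; congr expR.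
  by rewrite mulrBr; lra.
rewrite mulrCA -subr_ge0 -mulrBl.
set W := laplace_fun _ _ _ _; have W0 : 0 < W by exact: laplace_fun_gt0.
rewrite mulrA; apply: mulr_ge0; last exact: ltW.
have [xm|mx] := leP x m.
  rewrite mulr_le0 ?subr_le0// ler_expR lerN2 ler_pM2r//.
  by rewrite ler_wpM2r// subr_ge0.
rewrite mulr_ge0 ?subr_ge0// ?(ltW mx)// ler_expR lerN2 ler_pM2r//.
by rewrite ler_wpM2r ?subr_ge0// ltW.
Qed.

Section ratio_monotone.
Hypothesis h_ratio : forall c x y : R,
  0 < c -> c < 1 -> 0 < x -> x <= y -> y < 1 -> h (c * x) * h y <= h (c * y) * h x.

(** With c = s / t and m the mean at s, the claim says that c m is at most the mean at t. On (0, c)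
    the substitution l = c x turns exp (- l t / 2) into exp (- x s / 2) and h(l) into h(c x), whose
    quotient by h(x) is nondecreasing and so pushes the mean above m. On [c, 1) every l is at least
    c m, because m < 1. *)
Lemma laplace_r_nondecreasing q s t : 0 <= q -> 0 < s -> s <= t ->
  s * laplace h (q + 1) s / laplace h q s <= t * laplace h (q + 1) t / laplace h q t.
Proof.
move=> q0 s0; rewrite le_eqVlt => /predU1P[<-//|st].
have t0 := lt_trans s0 st.
have Ls := laplace_gt0 h_gt0 h_int s q0; have Lt := laplace_gt0 h_gt0 h_int t q0.
have q10 : 0 <= q + 1 by rewrite addr_ge0.
have Ls1 := laplace_gt0 h_gt0 h_int s q10.
pose c := s / t; pose m := laplace h (q + 1) s / laplace h q s.
have c0 : 0 < c by rewrite divr_gt0.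
have c1 : c < 1 by rewrite ltr_pdivrMr// mul1r.
have ct : c * t = s by rewrite /c divfK ?gt_eqF.
have m0 : 0 < m by exact: divr_gt0 Ls1 Ls.
have m1 : m < 1 by rewrite (ltr_pdivrMr _ _ Ls) mul1r; exact: laplaceS_lt.
suff : 0 <= laplace h (q + 1) t - c * m * laplace h q t.
  rewrite subr_ge0 -(ler_pdivlMr _ _ Lt) => H.
  have -> : s * laplace h (q + 1) s / laplace h q s = t * (c * m).
    by rewrite (mulrA t) (mulrC t) ct /m mulrA.
  by rewrite -(mulrA t) (ler_pM2l t0).
rewrite -laplace_centered//.
pose F x := laplace_fun h q t (c * x).
have int_c u v : int01 (fun x => (x - v) * laplace_fun h q u x).
  apply: integrable_centered; first exact: integrable_laplace_fun.
  exact: integrable_laplace_funS.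
have sub0c : `]0, c[%classic `<=` `]0, 1[%classic.
  by move=> x /=; rewrite !in_itv/= => /andP[-> /lt_trans->].
have m0c : measurable (`]0, c[%classic : set (measurableTypeR R)) by exact: measurable_itv.
have int0c (f : R -> R) : int01 f -> mu.-integrable `]0, c[ (EFin \o f).
  by move=> intf; exact: (integrableS mI m0c sub0c).
have intF : int01 F.
  by apply: integrable_scale => //; apply: int0c; exact: integrable_laplace_fun.
have intxF' : int01 (fun x => (c * x) * laplace_fun h q t (c * x)).
  apply: (@integrable_scale _ _ _ (fun x => x * laplace_fun h q t x)) => //.
  by apply: int0c; exact: integrable_laplace_funS.
have intxF : int01 (fun x => x * F x).
  rewrite /int01 (_ : _ \o _ = fun x => (c^-1)%:E * ((c * x) * F x)%:E)%E.
    by have := int01Z c^-1 intxF'.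
  by apply/funext => x /=; congr EFin; rewrite -(mulrA c) mulKf ?gt_eqF.
have split01 : `]0, 1[%classic = `]0, c[ `|` `[c, 1[%classic :> set R.
  rewrite -itv_bndbnd_setU ?bnd_simp//; exact: ltW.
rewrite split01 Rintegral_setU//; last 2 first.
- by rewrite -split01; exact: int_c.
- apply/disj_setPLR => x /=; rewrite !in_itv/= => /andP[_ xc].
  by rewrite leNgt xc.
apply: addr_ge0; last first.
  apply: Rintegral_ge0 => x /=; rewrite in_itv/= => /andP[cx x1].
  have x0 := lt_le_trans c0 cx.
  rewrite mulr_ge0 ?(ltW (laplace_fun_gt0 _ _ _ _)) ?x0// subr_ge0.
  by rewrite (le_trans _ cx)// ler_piMr// ltW.
have mf (f : R -> R) : int01 f -> measurable_fun (`]0, c[%classic : set R) f.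
  by move=> /int0c /measurable_int /measurable_EFinP.
have -> : \int[mu]_(x in `]0, c[) ((x - c * m) * laplace_fun h q t x) =
    c ^+ 2 * \int[mu]_(x in `]0, 1[) ((x - m) * F x).
  rewrite Rintegral_centered//.
  transitivity (\int[mu]_(x in `]0, c[) (x * laplace_fun h q t x) -
      c * m * \int[mu]_(x in `]0, c[) laplace_fun h q t x).
    rewrite -RintegralZl//; last by apply: int0c; exact: integrable_laplace_fun.
    rewrite -RintegralB//; first by apply: eq_Rintegral => x _; rewrite mulrBl.
      by apply: int0c; exact: integrable_laplace_funS.
    by apply: int0c; apply: int01Z; exact: integrable_laplace_fun.
  rewrite !(ge0_Rintegral_scale c0).
  - have -> : \int[mu]_(x in `]0, 1[) (c * x * laplace_fun h q t (c * x)) =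
        c * \int[mu]_(x in `]0, 1[) (x * F x).
      by rewrite -RintegralZl//; apply: eq_Rintegral => x _; rewrite mulrA.
    by rewrite -/(F _); ring.
  - by apply: mf; exact: integrable_laplace_fun.
  - move=> x /andP[x0 xc]; apply/ltW/laplace_fun_gt0 => //.
    by rewrite x0 (lt_trans xc).
  - by apply: mf; exact: integrable_laplace_funS.
  - move=> x /andP[x0 xc]; rewrite mulr_ge0 ?(ltW x0)//.
    by apply/ltW/laplace_fun_gt0 => //; rewrite x0 (lt_trans xc).
rewrite mulr_ge0 ?sqr_ge0//.
have hm := h_gt0 m0 m1.
(* The value at x = m of the factor by which the rescaled weight [F] differs from the weight at s,
   times a vanishing integral. *)
have E0 : c `^ q * h (c * m) / h m * \int[mu]_(x in `]0, 1[)
    ((x - m) * laplace_fun h q s x) = 0.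
  by rewrite laplace_centered// /m (divfK (lt0r_neq0 Ls)) subrr mulr0.
rewrite -[leLHS]E0 int01_Zl//; apply: le_int01.
- exact: int01Z.
- exact: integrable_centered.
move=> x /andP[x0 x1].
have hx := h_gt0 x0 x1.
have -> : F x = c `^ q * (x `^ q * expR (- (x * s / 2))) * h (c * x).
  rewrite /F /laplace_fun powRM ?(ltW c0) ?(ltW x0)// -ct.
  rewrite (_ : c * x * t = x * (c * t)); [ring|by ring].
rewrite /laplace_fun -subr_ge0.
set e := expR _; have e0 : 0 <= e by exact: expR_ge0.
have -> : (x - m) * (c `^ q * (x `^ q * e) * h (c * x)) -
    c `^ q * h (c * m) / h m * ((x - m) * (x `^ q * h x * e)) =
    c `^ q * x `^ q * e / h m * ((x - m) * (h (c * x) * h m - h (c * m) * h x)).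
  by field; rewrite gt_eqF.
apply: mulr_ge0.
  by rewrite divr_ge0 ?(ltW hm)// !mulr_ge0// powR_ge0.
have [xm|mx] := leP x m.
  by rewrite mulr_le0 ?subr_le0// h_ratio.
by rewrite mulr_ge0 ?subr_ge0 ?(ltW mx)// h_ratio// ltW.
Qed.

(** This is r' >= 0 with denominators cleared. It serves to bound I_(q+2), which enters the
    divergence of the shrinkage field. *)
Lemma laplace_r_derive_ge0 q t : 0 <= q -> 0 <= t ->
  t * laplace h (q + 1 + 1) t * laplace h q t <=
  2 * laplace h (q + 1) t * laplace h q t + t * laplace h (q + 1) t ^+ 2.
Proof.
move=> q0; have q10 : 0 <= q + 1 by rewrite addr_ge0.
rewrite le_eqVlt => /predU1P[<-|t0].
  rewrite !mul0r addr0 !mulr_ge0//; apply/ltW; exact: laplace_gt0.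
have L0 s := laplace_gt0 h_gt0 h_int s q0.
pose r s := s * laplace h (q + 1) s / laplace h q s.
have D0 : is_derive t 1 (laplace h q) (- (laplace h (q + 1) t / 2)).
  exact: is_derive_laplace.
have D1 : is_derive t 1 (laplace h (q + 1)) (- (laplace h (q + 1 + 1) t / 2)).
  exact: is_derive_laplace.
have D2 : is_derive t 1 (fun s => s * laplace h (q + 1) s) _ := is_deriveM (is_derive_id t 1) D1.
have D3 : is_derive t 1 (fun s => (laplace h q s)^-1) _ := is_deriveV (lt0r_neq0 (L0 t)) D0.
have D4 : is_derive t 1 r _ := is_deriveM D2 D3.
have : 0 <= derive1 r t.
  apply: nondecreasing_derive1_ge0 t0 _ _; last exact: ex_derive.
  by move=> y z y0 yz; exact: laplace_r_nondecreasing.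
rewrite (is_derive_derive1 D4) /GRing.scale/=.
have Lt := L0 t; set A := laplace h q t in Lt *; set B := laplace h (q + 1) t.
set C := laplace h (q + 1 + 1) t => H.
have : 0 <= 2 * A ^+ 2 * ((t * B) * (- A ^- 2 * - (B / 2)) + A^-1 * (t * - (C / 2) + B * 1)).
  by rewrite mulr_ge0// mulr_ge0// ?sqr_ge0.
rewrite (_ : 2 * _ * _ = 2 * B * A + t * B ^+ 2 - t * C * A) ?subr_ge0//.
by field; rewrite gt_eqF.
Qed.

End ratio_monotone.
End laplace_monotonicity.

Lemma is_derive_continuous {R : realType} (f : R -> R) (x l : R) :
  is_derive x 1 f l -> {for x, continuous f}.
Proof.
by move=> df; apply/differentiable_continuous/derivable1_diffP/ex_derive.
Qed.

(** * Upper bound for r, and why r exceeds d - 2 somewhere *)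

Section laplace_bounds.
Context {R : realType}.
Variable h : R -> R.
Hypothesis h_gt0 : forall x : R, 0 < x -> x < 1 -> 0 < h x.
Local Notation mu := (@lebesgue_measure R).
Hypothesis h_int : mu.-integrable `]0, 1[ (EFin \o h).
Implicit Types q t m : R.

Lemma Rintegral_le0 (D : set (measurableTypeR R)) (f : R -> R) : measurable D ->
  mu.-integrable D (EFin \o f) -> (forall x, D x -> f x <= 0) ->
  \int[mu]_(x in D) f x <= 0.
Proof.
move=> mD intf f0; rewrite -(mul0r (fine (mu D))) -Rintegral_cst//.
by apply: le_Rintegral => //; exact: integrable0.
Qed.

(* [(x - 2 * p / t) x^(p - 1) exp (- t x / 2)] is the derivative of
   [- 2 / t * x^p exp (- t x / 2)]. *)
Lemma Rintegral_gamma_centered (p t e : R) : 0 < t -> 0 < e -> e < 1 ->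
  let g x := (x - 2 * p / t) * (x `^ (p - 1) * expR (- (x * t / 2))) in
  mu.-integrable `[e, 1] (EFin \o g) /\
  \int[mu]_(x in `[e, 1]) g x =
    2 / t * (e `^ p * expR (- (e * t / 2)) - expR (- (t / 2))).
Proof.
move=> t0 e0 e1 g.
have dexp (x : R) : is_derive x 1 (fun x : R => expR (- (x * t / 2)))
    (expR (- (x * t / 2)) * - (t / 2)).
  have D1 : is_derive x 1 (fun s : R => - (s * t / 2)) (- (t / 2)).
    rewrite (_ : (fun s : R => _) = (fun s => (- (t / 2)) *: s)); last first.
      by apply/funext => s; rewrite /GRing.scale/=; ring.
    have := @is_deriveZ _ _ _ id (- (t / 2)) x 1 1 (is_derive_id _ _).
    by rewrite /GRing.scale/= mulr1.
  exact: (@is_derive1_comp _ expR (fun s => - (s * t / 2)) _ _ _ (is_derive_expR _) D1).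
pose F (x : R) : R := - (2 / t) * (x `^ p * expR (- (x * t / 2))).
have dF (x : R) : 0 < x -> is_derive x 1 F (g x).
  move=> x0.
  have D := is_deriveM (is_derive1_powR p x0) (dexp x).
  have := @is_deriveZ _ _ _ _ (- (2 / t)) x 1 _ D.
  move=> D3; apply: (is_derive_eq D3); rewrite /GRing.scale/= /g.
  have -> : x `^ p = x * x `^ (p - 1).
    rewrite -[in X in _ = X * _](powRr1 (ltW x0)) -powRD ?(addrC 1) ?subrK//.
    by apply/implyP => _; rewrite gt_eqF.
  by field; rewrite gt_eqF.
have cg (x : R) : 0 < x -> {for x, continuous g}.
  move=> x0; apply: cvgM; first by apply: cvgB; [exact: cvg_id|exact: cvg_cst].
  apply: cvgM; first exact: (is_derive_continuous (is_derive1_powR (p - 1) x0)).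
  exact: (is_derive_continuous (dexp x)).
have cgw : {within `[e, 1], continuous g}.
  apply: continuous_in_subspaceT => x /set_mem /=; rewrite in_itv/= => /andP[ex _].
  exact/cg/(lt_le_trans e0).
have cF (x : R) : 0 < x -> {for x, continuous F}.
  by move=> x0; exact: (is_derive_continuous (dF x x0)).
split.
  by apply: continuous_compact_integrable => //; exact: segment_compact.
rewrite /Rintegral (@continuous_FTC2 _ g F e 1)//.
- by rewrite /= /F powR1 !mul1r; ring.
- split.
  + move=> x; rewrite in_itv/= => /andP[ex _].
    have ? := dF x (lt_trans e0 ex); exact: ex_derive.
  + apply: cvg_at_right_filter; exact: cF.
  + apply: cvg_at_left_filter; exact: cF.
- move=> x; rewrite in_itv/= => /andP[ex _].
  exact: is_derive_derive1 (dF x (lt_trans e0 ex)).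
Qed.

(** [laplace_fun h q t] is the nonincreasing function h(x) x^A times the gamma weight x^(p-1) exp (-
    t x / 2) with p = q + 1 - A. That weight has mean m = 2 p / t on the positive half-line, and
    neither the nonincreasing factor nor the cut at 1 can raise a mean. *)
Lemma laplace_r_le A q t : 0 <= q -> 0 <= t -> 0 < q + 1 - A ->
  (forall x y, 0 < x -> x <= y -> y < 1 -> h y * y `^ A <= h x * x `^ A) ->
  t * laplace h (q + 1) t <= 2 * (q + 1 - A) * laplace h q t.
Proof.
move=> q0; rewrite le_eqVlt => /predU1P[<- p0 _|t0 p0 hA].
  by rewrite mul0r !mulr_ge0// ltW// laplace_gt0.
pose p := q + 1 - A; pose m := 2 * p / t.
have Lq := laplace_gt0 h_gt0 h_int t q0.
have m0 : 0 < m by rewrite divr_gt0 ?mulr_gt0.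
(* For m >= 1 the inequality I_(q+1) < I_q suffices; otherwise m lies in (0, 1), where h(m) is
   available as a comparison value. *)
have [m1|m1] := leP 1 m.
  apply: (@le_trans _ _ (t * laplace h q t)).
    by rewrite ler_pM2l//; exact/ltW/laplaceS_lt.
  by rewrite ler_pM2r//; move: m1; rewrite ler_pdivlMr// mul1r.
have int_c : mu.-integrable `]0, 1[ (EFin \o (fun x => (x - m) * laplace_fun h q t x)).
  apply: integrable_centered; first exact: integrable_laplace_fun.
  exact: integrable_laplace_funS.
suff : \int[mu]_(x in `]0, 1[) ((x - m) * laplace_fun h q t x) <= 0.
  rewrite (laplace_centered h_gt0 h_int t m q0) subr_le0 => H.
  have tm : t * m = 2 * p by rewrite /m mulrC divfK ?gt_eqF.
  by rewrite -/p -tm -mulrA (ler_pM2l t0).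
set X := \int[mu]_(x in `]0, 1[) _.
have km : 0 < h m * m `^ A by rewrite mulr_gt0 ?powR_gt0// h_gt0.
(* The gamma weight may be singular at 0, so the comparison is made on [e, 1). The part below e is
   negative and dropped, and the boundary term at e is of order e^p. *)
have XC e : 0 < e -> e < m -> X <= h m * m `^ A * (2 / t) * e `^ p.
  move=> e0 em; have e1 := lt_trans em m1.
  have split01 : `]0, 1[%classic = `]0, e[ `|` `[e, 1[%classic :> set R.
    rewrite -itv_bndbnd_setU ?bnd_simp//; exact: ltW.
  have sub0 : (`]0, e[%classic : set R) `<=` `]0, 1[%classic.
    by rewrite split01; exact: subsetUl.
  have sub1 : (`[e, 1[%classic : set R) `<=` `]0, 1[%classic.
    by rewrite split01; exact: subsetUr.
  have m01 : measurable (`]0, 1[%classic : set (measurableTypeR R)) by exact: measurable_itv.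
  have m0e : measurable (`]0, e[%classic : set (measurableTypeR R)) by exact: measurable_itv.
  have me1 : measurable (`[e, 1[%classic : set (measurableTypeR R)) by exact: measurable_itv.
  have mE1 : measurable (`[e, 1]%classic : set (measurableTypeR R)) by exact: measurable_itv.
  rewrite /X split01 Rintegral_setU//; last 2 first.
  - by rewrite -split01.
  - apply/disj_setPLR => x /=; rewrite !in_itv/= => /andP[_ xc].
    by rewrite leNgt xc.
  rewrite -[leRHS]add0r; apply: lerD.
    apply: Rintegral_le0 => //; first exact: (integrableS m01 m0e sub0).
    move=> x /=; rewrite in_itv/= => /andP[x0 xe].
    rewrite mulr_le0_ge0//; first by rewrite subr_le0 ltW// (lt_trans xe).
    by apply/ltW/laplace_fun_gt0 => //; rewrite x0 (lt_trans xe).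
  have [intg Eg] := @Rintegral_gamma_centered p t e t0 e0 e1.
  pose g x := (x - m) * (x `^ (p - 1) * expR (- (x * t / 2))).
  have intg' : mu.-integrable `[e, 1[ (EFin \o g).
    by apply: (integrableS mE1 me1 _ intg) => x /=; rewrite !in_itv/= => /andP[-> /ltW].
  have intkg : mu.-integrable `[e, 1[ (EFin \o (fun x => h m * m `^ A * g x)).
    exact: (@integrableZl _ _ _ _ _ me1 (h m * m `^ A) (EFin \o g) intg').
  apply: (@le_trans _ _ (\int[mu]_(x in `[e, 1[) (h m * m `^ A * g x))).
    apply: le_Rintegral => //; first exact: (integrableS m01 me1 sub1).
    move=> x /=; rewrite in_itv/= => /andP[ex x1].
    have x0 := lt_le_trans e0 ex.
    rewrite /laplace_fun.
    have -> : x `^ q = x `^ A * x `^ (p - 1).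
      rewrite -powRD; last by apply/implyP => _; rewrite gt_eqF.
      by congr (_ `^ _); rewrite /p; ring.
    set E := expR _; have E0 : 0 <= E by exact: expR_ge0.
    rewrite -subr_ge0 /g -/E.
    set B := x `^ (p - 1).
    have -> : h m * m `^ A * ((x - m) * (B * E)) - (x - m) * (x `^ A * B * h x * E) =
      B * E * ((x - m) * (h m * m `^ A - h x * x `^ A)) by ring.
    apply: mulr_ge0; first by rewrite mulr_ge0// powR_ge0.
    have [xm|mx] := leP x m.
      by rewrite mulr_le0 ?subr_le0// hA.
    by rewrite mulr_ge0 ?subr_ge0 ?(ltW mx)// hA// ltW.
  rewrite RintegralZl// Rintegral_itv_bndo_bndc// Eg.
  rewrite -!mulrA ler_pM2l//; last by rewrite h_gt0.
  rewrite ler_pM2l ?powR_gt0// ler_pM2l// ler_pM2l ?invr_gt0//.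
  apply: (@le_trans _ _ (e `^ p * expR (- (e * t / 2)))).
    by rewrite mulrA gerBl expR_ge0.
  rewrite ler_piMr ?powR_ge0// -[leRHS]expR0 ler_expR oppr_le0.
  by rewrite divr_ge0// mulr_ge0// ltW.
rewrite leNgt; apply/negP => X0.
set C := h m * m `^ A * (2 / t) in XC.
have C0 : 0 < C by rewrite mulr_gt0// divr_gt0.
have pp : 0 < p by [].
(* Chosen so that C e^p <= X / 2, which contradicts X <= C e^p for positive X. *)
pose e := Num.min (m / 2) ((X / (2 * C)) `^ (p^-1)).
have e0 : 0 < e by rewrite lt_min divr_gt0//= powR_gt0// divr_gt0// mulr_gt0.
have em : e < m by rewrite gt_min; apply/orP; left; lra.
have := XC e e0 em; apply/negP; rewrite -ltNge.
have eX : e `^ p <= X / (2 * C).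
  have -> : X / (2 * C) = ((X / (2 * C)) `^ p^-1) `^ p.
    rewrite -powRrM mulVf ?gt_eqF// powRr1//.
    by apply: divr_ge0; [exact: ltW|apply: mulr_ge0 => //; exact: ltW].
  apply: ge0_ler_powR; rewrite ?nnegrE ?powR_ge0 ?(ltW e0) ?(ltW pp)//.
  by rewrite ge_min lexx orbT.
apply: (@le_lt_trans _ _ (C * (X / (2 * C)))); first by rewrite ler_pM2l.
rewrite (_ : C * _ = X / 2); first lra.
by field; rewrite gt_eqF.
Qed.

Lemma powR_mul_expR_le q (u : R) : 0 < q -> 0 <= u ->
  u `^ q * expR (- (u / 2)) <= (2 * q) `^ q.
Proof.
move=> q0 u0; rewrite expRN ler_pdivrMr ?expR_gt0//.
have -> : expR (u / 2) = expR (u / (2 * q)) `^ q.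
  rewrite -expRM; congr expR; field; rewrite gt_eqF//.
rewrite -powRM ?expR_ge0 ?mulr_ge0 ?(ltW q0)//.
apply: ge0_ler_powR; rewrite ?nnegrE ?mulr_ge0 ?expR_ge0 ?(ltW q0)//.
rewrite -ler_pdivrMl ?mulr_gt0// mulrC.
by apply: le_trans (expR_ge1Dx _); rewrite lerDr.
Qed.

(** If r <= 2 q - 2 held everywhere, t^(q-1) I_q(t) would be nondecreasing. But t^q I_q(t) is
    bounded, since (x t)^q exp (- x t / 2) is, so t^(q-1) I_q(t) is O(1 / t). With q = d / 2 the
    threshold is d - 2. *)
Lemma laplace_r_unbounded q : 1 < q ->
  ~ (forall t, 0 < t -> t * laplace h (q + 1) t <= (2 * q - 2) * laplace h q t).
Proof.
move=> q1 H; have q0 : 0 < q := lt_trans ltr01 q1.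
pose f t := t `^ (q - 1) * laplace h q t.
have df t : 0 < t -> is_derive t 1 f
    (t `^ (q - 1 - 1) / 2 * ((2 * q - 2) * laplace h q t - t * laplace h (q + 1) t)).
  move=> t0.
  have D0 := is_derive_laplace h_gt0 h_int t (ltW q0).
  have D := is_deriveM (is_derive1_powR (q - 1) t0) D0.
  apply: (is_derive_eq D); rewrite /GRing.scale/=.
  have -> : t `^ (q - 1) = t * t `^ (q - 1 - 1).
    rewrite -[in X in _ = X * _](powRr1 (ltW t0)) -powRD ?(addrC 1) ?subrK//.
    by apply/implyP => _; rewrite gt_eqF.
  by set a := laplace _ _ _; set b := laplace _ _ _; field.
pose C := (2 * q) `^ q * \int[mu]_(x in `]0, 1[) h x.
have m01 : measurable (`]0, 1[%classic : set (measurableTypeR R)) by exact: measurable_itv.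
have fC t : 0 < t -> t * f t <= C.
  move=> t0; rewrite /f mulrA.
  have -> : t * t `^ (q - 1) = t `^ q.
    rewrite -[in X in X * _](powRr1 (ltW t0)) -powRD ?(addrC 1) ?subrK//.
    by apply/implyP => _; rewrite gt_eqF.
  have intl := integrable_laplace_fun h_gt0 h_int t (ltW q0).
  rewrite /C -!RintegralZl//; apply: le_Rintegral => //.
  - exact: (@integrableZl _ _ _ _ _ m01 (t `^ q) _ intl).
  - exact: (@integrableZl _ _ _ _ _ m01 ((2 * q) `^ q) _ h_int).
  move=> x /=; rewrite in_itv/= => /andP[x0 x1]; rewrite /laplace_fun.
  have := powR_mul_expR_le q0 (ltW (mulr_gt0 x0 t0)).
  rewrite (powRM q (ltW x0) (ltW t0)) => B.
  have -> : t `^ q * (x `^ q * h x * expR (- (x * t / 2))) =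
    x `^ q * t `^ q * expR (- (x * t / 2)) * h x by ring.
  by rewrite ler_wpM2r// ltW// h_gt0.
have f1 : 0 < f 1 by rewrite mulr_gt0 ?powR_gt0// laplace_gt0// ltW.
have f_nd T : 1 < T -> f 1 <= f T.
  move=> T1; apply: (@ger0_derive1_ndecr _ f 1 T) => //.
  - move=> x; rewrite in_itv/= => /andP[x1 _].
    have ? := df x (lt_trans ltr01 x1); exact: ex_derive.
  - move=> x; rewrite in_itv/= => /andP[x1 _]; have x0 := lt_trans ltr01 x1.
    rewrite (is_derive_derive1 (df x x0)) mulr_ge0 ?divr_ge0 ?powR_ge0//.
    by rewrite subr_ge0 H.
  - apply: derivable_within_continuous => x; rewrite in_itv/= => /andP[x1 _].
    have ? := df x (lt_le_trans ltr01 x1); exact: ex_derive.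
  - exact: ltW.
(* At this T the value T f(1) = C + f(1) exceeds the bound C. *)
pose T := C / f 1 + 1.
have C0 : 0 < C.
  by apply: lt_le_trans (fC 1 ltr01); rewrite mul1r.
have T1 : 1 < T by rewrite /T ltrDr divr_gt0.
have T0 := lt_trans ltr01 T1.
have := le_trans (_ : T * f 1 <= T * f T) (fC T T0).
rewrite ler_pM2l// => /(_ (f_nd T T1)).
by rewrite /T mulrDl divfK ?gt_eqF// mul1r gerDl leNgt f1.
Qed.

End laplace_bounds.

(** * Stein's identity for normal densities *)

Section normal_moments.
Context {R : realType}.
Local Notation mu := (@lebesgue_measure R).
Implicit Types (m s x : R).

Lemma normal_pdf_prod m s x : s != 0 ->
  normal_pdf m s x = normal_peak s * normal_fun m s x.
Proof. by move=> s0; rewrite normal_pdfE. Qed.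

Lemma is_derive_normal_pdf m s x : s != 0 ->
  is_derive x 1 (normal_pdf m s) (- ((x - m) / s ^+ 2 * normal_pdf m s x)).
Proof.
move=> s0; rewrite normal_pdfE//.
have D1 : is_derive x 1 (fun x => x - m) 1.
  have := is_deriveB (is_derive_id x (1 : R)) (is_derive_cst m x (1 : R)).
  by move=> D; apply: (is_derive_eq D); rewrite subr0.
have D2 : is_derive x 1 (fun x => - (x - m) ^+ 2 / (s ^+ 2 *+ 2)) (- ((x - m) / s ^+ 2)).
  have D := @is_deriveZ _ _ _ _ (- (s ^+ 2 *+ 2)^-1) x 1 _ (is_deriveM D1 D1).
  rewrite (_ : (fun x => _) = (fun x => (- (s ^+ 2 *+ 2)^-1) *: ((x - m) * (x - m)))).
    apply: (is_derive_eq D); rewrite /GRing.scale/=.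
    by field.
  by apply/funext => y; rewrite /GRing.scale/=; field.
have D3 : is_derive x 1 (normal_fun m s) (normal_fun m s x * - ((x - m) / s ^+ 2)).
  exact: (@is_derive1_comp _ expR (fun x => - (x - m) ^+ 2 / (s ^+ 2 *+ 2)) _ _ _
    (is_derive_expR _) D2).
have D := @is_deriveZ _ _ _ _ (normal_peak s) x 1 _ D3.
by apply: (is_derive_eq D); rewrite /GRing.scale/=; ring.
Qed.

Lemma mul_expRN_le1 x : x * expR (- x) <= 1.
Proof.
rewrite expRN ler_pdivrMr ?expR_gt0// mul1r.
by apply: le_trans (expR_ge1Dx _); rewrite lerDr.
Qed.

(** Doubling the variance absorbs a quadratic factor. This single comparison yields both
    integrability and decay at infinity of functions of quadratic growth times the density. *)
Lemma normal_pdf_moment_bound m s : 0 < s ->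
  exists2 C, 0 <= C & forall x,
    (1 + (x - m) ^+ 2) * normal_pdf m s x <= C * normal_pdf m (s * Num.sqrt 2) x.
Proof.
move=> s0; have r0 : 0 < s * Num.sqrt 2 by rewrite mulr_gt0// sqrtr_gt0.
pose C := (1 + 4 * s ^+ 2) * normal_peak s / normal_peak (s * Num.sqrt 2).
have p1 := normal_peak_ge0 s; have p2 := normal_peak_gt0 (lt0r_neq0 r0).
exists C; first by rewrite divr_ge0 ?(ltW p2)// mulr_ge0// addr_ge0// mulr_ge0// sqr_ge0.
move=> x; rewrite !normal_pdf_prod ?lt0r_neq0// /C [leRHS]mulrA divfK ?lt0r_neq0//.
rewrite [leLHS]mulrCA -[leRHS]mulrA [leRHS]mulrCA ler_wpM2l//.
rewrite /normal_fun exprMn sqr_sqrtr//.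
(* The narrow density carries exp (- 2 t) and the wide one exp (- t), so what remains is (1 + 4 s^2
   t) exp (- t) <= 1 + 4 s^2. *)
set t := (x - m) ^+ 2 / (4 * s ^+ 2).
have t0 : 0 <= t by apply: divr_ge0; [exact: sqr_ge0|apply: mulr_ge0 => //; exact: sqr_ge0].
have -> : - (x - m) ^+ 2 / (s ^+ 2 * 2 *+ 2) = - t.
  by rewrite /t; field; rewrite gt_eqF.
have -> : - (x - m) ^+ 2 / (s ^+ 2 *+ 2) = - t + - t.
  by rewrite /t; field; rewrite gt_eqF.
rewrite expRD mulrA ler_wpM2r ?expR_ge0//.
have -> : (x - m) ^+ 2 = 4 * s ^+ 2 * t by rewrite /t; field; rewrite gt_eqF.
rewrite mulrDl mul1r lerD//.
  by rewrite -[leRHS]expR0 ler_expR oppr_le0.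
rewrite -[leLHS]mulrA ler_piMr ?mul_expRN_le1//; apply: mulr_ge0 => //; exact: sqr_ge0.
Qed.

Lemma normal_pdf_vanish m s (e : R) : s != 0 -> 0 < e ->
  exists K, forall x, K <= `|x| -> normal_pdf m s x <= e.
Proof.
move=> s0 e0; pose K := normal_peak s * (s ^+ 2 *+ 2) / e.
have p0 := normal_peak_gt0 s0.
have s20 : 0 < s ^+ 2 *+ 2 by rewrite pmulrn_lgt0// exprn_even_gt0.
have K0 : 0 < K by rewrite divr_gt0// mulr_gt0.
exists (`|m| + (1 + K)) => x Kx.
have y1 : 1 + K <= `|x - m|.
  by rewrite -lerBrDl in Kx; apply: (le_trans Kx); exact: lerB_dist.
have yy : K <= (x - m) ^+ 2.
  rewrite -real_normK ?num_real// expr2.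
  have y0 : K <= `|x - m| by lra.
  apply: (le_trans y0); rewrite ler_peMr ?normr_ge0//; lra.
rewrite normal_pdf_prod// /normal_fun mulNr expRN.
have u0 : 0 < (x - m) ^+ 2 / (s ^+ 2 *+ 2) by rewrite divr_gt0// (lt_le_trans K0).
set u := (x - m) ^+ 2 / _ in u0 *.
have : u <= expR u by apply: le_trans (expR_ge1Dx _); rewrite lerDr.
rewrite -(lef_pV2 (expR_gt0 _ : _ \is Num.pos)) ?posrE// => eu.
apply: (@le_trans _ _ (normal_peak s * u^-1)); first by rewrite ler_wpM2l// ltW.
rewrite /u invf_div mulrA ler_pdivrMr ?(lt_le_trans K0 yy)// [leRHS]mulrC.
by rewrite -ler_pdivrMr.
Qed.

Lemma integral_derive_vanish (F f : R -> R) :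
  (forall x, is_derive x 1 F (f x)) -> continuous f ->
  mu.-integrable setT (EFin \o f) ->
  (forall e, 0 < e -> exists K, forall x, K <= `|x| -> `|F x| <= e) ->
  (\int[mu]_x (f x)%:E = 0)%E.
Proof.
move=> dF cf intf F0.
pose I n : set R := `[- n.+1%:R, n.+1%:R]%classic.
pose f_ n := (EFin \o f) \_ (I n).
have mIn n : measurable (I n : set (measurableTypeR R)) by exact: measurable_itv.
have cvg1 : (\int[mu]_x f_ n x)%E @[n --> \oo] --> (\int[mu]_x (f x)%:E)%E.
  apply: (@dominated_cvg _ _ _ mu setT measurableT f_ (EFin \o f) (abse \o (EFin \o f))).
  - move=> n; apply/(measurable_restrictT _ _).1 => //.
    by apply: measurable_funTS; exact: measurable_int intf.
  - move=> x _; apply: cvg_near_cst; near=> n.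
    rewrite /f_ patchE mem_set// /I /= in_itv/= -ler_norml.
    near: n; exists (Num.bound `|x|) => // n /= xn.
    rewrite (le_trans (ltW (archi_boundP (normr_ge0 x))))// ler_nat.
    exact: leq_trans xn _.
  - by [].
  - exact: integrable_abse.
  - move=> n x _; rewrite /f_ patchE; case: ifPn => //= _.
    by rewrite normr0 lee_fin.
have E n : (\int[mu]_x f_ n x)%E = (F n.+1%:R - F (- n.+1%:R))%:E.
  rewrite /f_ -integral_mkcond.
  have lt1 : - n.+1%:R < n.+1%:R :> R by rewrite gtrN.
  rewrite (@continuous_FTC2 _ f F)//.
  - exact: continuous_subspaceT.
  - have cF x : {for x, continuous F}.
      by have ? := dF x; apply/differentiable_continuous/derivable1_diffP/ex_derive.
    split.
    + by move=> x _; have ? := dF x; exact: ex_derive.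
    + by apply: cvg_at_right_filter; exact: cF.
    + by apply: cvg_at_left_filter; exact: cF.
  - by move=> x _; have ? := dF x; rewrite derive1E derive_val.
have cvg2 : (\int[mu]_x f_ n x)%E @[n --> \oo] --> (0 : \bar R)%E.
  under eq_fun do rewrite E.
  apply: cvg_EFin; first exact: nearW.
  apply/cvgrPdist_le => e e0; have [K FK] := F0 _ (divr_gt0 e0 (ltr0Sn _ 1)).
  exists (Num.bound `|K|) => // n /= Kn.
  have Kn' : K <= n.+1%:R.
    apply: (le_trans (ler_norm _)); rewrite (le_trans (ltW (archi_boundP (normr_ge0 K))))// ler_nat.
    exact: leq_trans Kn _.
  rewrite sub0r normrN (le_trans (ler_normB _ _))// [leRHS]splitr.
  by rewrite lerD// FK// ?normrN ger0_norm.
by apply: cvg_unique cvg1 cvg2.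
Unshelve. all: by end_near. Qed.

End normal_moments.

Lemma norm_le1Dsqr {R : realFieldType} (y : R) : `|y| <= 1 + y ^+ 2.
Proof.
rewrite -[in leRHS]real_normK ?num_real//.
by have := sqr_ge0 (`|y| - 1); rewrite sqrrB1; have := sqr_ge0 `|y|; lra.
Qed.

Section normal_stein.
Context {R : realType}.
Local Notation mu := (@lebesgue_measure R).
Implicit Types (m s x : R).

Lemma integrable_normal_quadratic m s (f : R -> R) (K : R) : 0 < s ->
  measurable_fun setT f -> (forall x, `|f x| <= K * (1 + (x - m) ^+ 2)) ->
  mu.-integrable setT (EFin \o (fun x => f x * normal_pdf m s x)).
Proof.
move=> s0 mf fK; have [C C0 HC] := normal_pdf_moment_bound m s0.
have ig : mu.-integrable setT (fun x => (K * C)%:E * (normal_pdf m (s * Num.sqrt 2) x)%:E)%E.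
  apply: integrableZl => //; exact: integrable_normal_pdf.
apply: (le_integrable measurableT _ _ ig).
  apply/measurable_EFinP/measurable_funM => //; exact: measurable_normal_pdf.
move=> x _; rewrite lee_fin; apply: le_trans (ler_norm _).
rewrite normrM (ger0_norm (normal_pdf_ge0 _ _ _)).
have K0 : 0 <= K.
  have := fK m; rewrite subrr expr0n addr0 mulr1; exact: le_trans.
apply: (@le_trans _ _ (K * (1 + (x - m) ^+ 2) * normal_pdf m s x)).
  by rewrite ler_wpM2r// normal_pdf_ge0.
by rewrite -!mulrA ler_wpM2l.
Qed.

Lemma normal_quadratic_vanish m s (f : R -> R) (K e : R) : 0 < s ->
  (forall x, `|f x| <= K * (1 + (x - m) ^+ 2)) -> 0 < e ->
  exists L, forall x, L <= `|x| -> `|f x * normal_pdf m s x| <= e.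
Proof.
move=> s0 fK e0; have [C C0 HC] := normal_pdf_moment_bound m s0.
have K0 : 0 <= K.
  have := fK m; rewrite subrr expr0n addr0 mulr1; exact: le_trans.
have r0 : s * Num.sqrt 2 != 0 by rewrite mulf_neq0 ?gt_eqF// sqrtr_gt0.
have KC : 0 < 1 + K * C by rewrite ltr_pwDl// mulr_ge0.
have [L HL] := normal_pdf_vanish m r0 (divr_gt0 e0 KC).
exists L => x /HL; rewrite ler_pdivlMr// => xe.
rewrite normrM (ger0_norm (normal_pdf_ge0 _ _ _)).
apply: (@le_trans _ _ (K * (1 + (x - m) ^+ 2) * normal_pdf m s x)).
  by rewrite ler_wpM2r// normal_pdf_ge0.
apply: (le_trans _ xe); rewrite -mulrA.
apply: (@le_trans _ _ (K * (C * normal_pdf m (s * Num.sqrt 2) x))).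
  by rewrite ler_wpM2l.
rewrite [leRHS]mulrC mulrA ler_wpM2r ?normal_pdf_ge0//.
by rewrite lerDr.
Qed.

(** The integrand is the derivative of - s^2 g times the density, which vanishes at infinity. *)
Lemma normal_stein m s (g g' : R -> R) (K : R) : 0 < s ->
  (forall x, is_derive x 1 g (g' x)) -> continuous g' ->
  (forall x, `|g x| <= K * (1 + `|x - m|)) -> (forall x, `|g' x| <= K) ->
  (\int[mu]_x (((x - m) * g x - s ^+ 2 * g' x) * normal_pdf m s x)%:E = 0)%E.
Proof.
move=> s0 dg cg' gK g'K.
have sn0 : s != 0 by rewrite gt_eqF.
have K0 : 0 <= K by apply: le_trans (g'K 0).
pose F x := (- s ^+ 2 * g x) * normal_pdf m s x.
have cg : continuous g.
  by move=> x; have ? := dg x; apply/differentiable_continuous/derivable1_diffP/ex_derive.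
have cpdf : continuous (normal_pdf m s) by exact: continuous_normal_pdf.
have cxm : continuous (fun x => x - m).
  by move=> x; apply: cvgB; [exact: cvg_id|exact: cvg_cst].
have cf : continuous (fun x => (x - m) * g x - s ^+ 2 * g' x).
  move=> x; apply: cvgB; first by apply: cvgM; [exact: cxm|exact: cg].
  by apply: cvgM; [exact: cvg_cst|exact: cg'].
have le_quad x : `|x - m| <= 1 + (x - m) ^+ 2 by exact: norm_le1Dsqr.
have quad1 x : `|x - m| * (1 + `|x - m|) <= 2 * (1 + (x - m) ^+ 2).
  rewrite mulrDr mulr1 -expr2 real_normK ?num_real//.
  by have := le_quad x; have := sqr_ge0 (x - m); lra.
apply: (@integral_derive_vanish _ F (fun x => ((x - m) * g x - s ^+ 2 * g' x) * normal_pdf m s x)).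
- move=> x.
  have D1 := @is_deriveZ _ _ _ g (- s ^+ 2) x 1 _ (dg x).
  have D := is_deriveM D1 (is_derive_normal_pdf m x sn0).
  apply: (is_derive_eq D); rewrite /GRing.scale/= /GRing.scale/=.
  by field.
- by move=> x; apply: cvgM; [exact: cf|exact: cpdf].
- apply: (@integrable_normal_quadratic _ _ _ (2 * K + s ^+ 2 * K)) => //.
    exact: continuous_measurable_fun.
  move=> x; rewrite (le_trans (ler_normB _ _))// !normrM mulrDl lerD//.
    apply: (@le_trans _ _ (`|x - m| * (K * (1 + `|x - m|)))).
      by rewrite ler_wpM2l.
    by rewrite mulrCA mulrC -[leRHS]mulrA [leRHS]mulrCA [leRHS]mulrC ler_wpM2r.
  rewrite (ger0_norm (ltW s0)) -expr2 -[leRHS]mulrA ler_wpM2l ?sqr_ge0//.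
  apply: (le_trans (g'K x)); rewrite ler_peMr// lerDl sqr_ge0//.
- move=> e e0; apply: (@normal_quadratic_vanish _ _ _ (s ^+ 2 * K * 2)) => // x.
  move: (sqr_ge0 s); set s2 := s ^+ 2 => s20.
  rewrite normrM normrN (ger0_norm s20).
  have -> : s2 * K * 2 * (1 + (x - m) ^+ 2) = s2 * (K * (2 * (1 + (x - m) ^+ 2))) by ring.
  apply: ler_wpM2l => //; apply: (le_trans (gK x)); apply: ler_wpM2l => //.
  by have := le_quad x; have := sqr_ge0 (x - m); lra.
Qed.

Lemma normal_centered m s : 0 < s ->
  (\int[mu]_x ((x - m) * normal_pdf m s x)%:E = 0)%E.
Proof.
move=> s0; rewrite -[RHS](@normal_stein m s (cst 1) (cst 0) 1 s0)//.
- by apply: eq_integral => x _; rewrite /= mulr1 mulr0 subr0.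
- by move=> x; exact: cvg_cst.
- by move=> x; rewrite normr1 mul1r lerDl.
- by move=> x; rewrite normr0.
Qed.

Lemma normal_variance m s : 0 < s ->
  (\int[mu]_x ((x - m) ^+ 2 * normal_pdf m s x)%:E = (s ^+ 2)%:E)%E.
Proof.
move=> s0.
have dxm x : is_derive x 1 (fun x => x - m) 1.
  have D := is_deriveB (is_derive_id x (1 : R)) (is_derive_cst m x (1 : R)).
  by apply: (is_derive_eq D); rewrite subr0.
have H := @normal_stein m s (fun x => x - m) (cst 1) 1 s0 dxm.
have int2 : mu.-integrable setT (EFin \o (fun x => (x - m) ^+ 2 * normal_pdf m s x)).
  apply: (@integrable_normal_quadratic _ _ _ 1) => //.
    by apply: measurable_funX; exact: measurable_funB.
  by move=> x; rewrite mul1r ger0_norm ?sqr_ge0// lerDr.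
have ints : mu.-integrable setT (fun x => (s ^+ 2)%:E * (normal_pdf m s x)%:E)%E.
  by apply: integrableZl => //; exact: integrable_normal_pdf.
have : (\int[mu]_x (((x - m) ^+ 2 * normal_pdf m s x)%:E -
    (s ^+ 2)%:E * (normal_pdf m s x)%:E) = 0)%E.
  rewrite -[RHS]H//.
  - by apply: eq_integral => x _; rewrite -EFinM -EFinB mulr1 -mulrBl expr2.
  - by move=> x; exact: cvg_cst.
  - by move=> x; rewrite mul1r lerDr.
  - by move=> x; rewrite normr1.
rewrite integralB// integralZl//; last exact: integrable_normal_pdf.
rewrite integral_normal_pdf mule1.
have fin : (\int[mu]_x ((x - m) ^+ 2 * normal_pdf m s x)%:E)%E \is a fin_num.
  exact: integrable_fin_num int2.
by rewrite -(fineK fin) -EFinB => /eqP; rewrite eqe subr_eq0 => /eqP ->.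
Qed.

End normal_stein.

(** * Integration over R^d and Stein's identity there *)

Section tuple_integral.
Context {R : realType}.
Local Notation mu := (@lebesgue_measure R).

Lemma ge0_integral_tupleS d (f : d.+1.-tuple R -> \bar R) :
  measurable_fun setT f -> (forall x, 0 <= f x)%E ->
  (\int[lebesgue_tuple R d.+1]_x f x =
   \int[mu]_s \int[lebesgue_tuple R d]_y f (tcons (s, y)))%E.
Proof.
move=> mf f0; rewrite /= /lebesgue_cons ge0_integral_pushforward//=.
- rewrite preimage_setT fubini_tonelli1//.
  by apply: measurableT_comp => //; exact: measurable_tcons.
- exact: measurable_tcons.
Qed.

Lemma integrable_tupleS d (f : d.+1.-tuple R -> \bar R) :
  (lebesgue_tuple R d.+1).-integrable setT f ->
  (mu \x lebesgue_tuple R d)%E.-integrable setT (f \o @tcons R d).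
Proof.
move=> /integrableP[mf foo]; apply/integrableP; split.
  by apply: measurableT_comp => //; exact: measurable_tcons.
move: foo; rewrite /= /lebesgue_cons ge0_integral_pushforward//=.
- exact: measurable_tcons.
- exact: measurableT_comp.
Qed.

Lemma integral_tupleS d (f : d.+1.-tuple R -> \bar R) :
  (lebesgue_tuple R d.+1).-integrable setT f ->
  (\int[lebesgue_tuple R d.+1]_x f x =
    \int[mu \x lebesgue_tuple R d]_p f (tcons p))%E.
Proof.
move=> intf; have intc := integrable_tupleS intf.
have mf := measurable_int _ intf.
rewrite /= /lebesgue_cons integral_pushforward ?preimage_setT//.
exact: measurable_tcons.
Qed.

Lemma tnth_tcons0 d (s : R) (y : d.-tuple R) : tnth (tcons (s, y)) ord0 = s.
Proof. by []. Qed.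

Lemma tnth_tconsS d (s : R) (y : d.-tuple R) i :
  tnth (tcons (s, y)) (lift ord0 i) = tnth y i.
Proof. by rewrite /tcons/= -[RHS](tnthS s). Qed.

Lemma ge0_integral_tuple_prod d (k : 'I_d -> R -> R) (c : 'I_d -> R) :
  (forall i, measurable_fun setT (k i)) -> (forall i s, 0 <= k i s) ->
  (forall i, \int[mu]_s (k i s)%:E = (c i)%:E)%E ->
  (\int[lebesgue_tuple R d]_x (\prod_(i < d) k i (tnth x i))%:E =
    (\prod_(i < d) c i)%:E)%E.
Proof.
elim: d k c => [|d IH] k c mk k0 kc.
  rewrite big_ord0; under eq_integral do rewrite big_ord0.
  by rewrite integral_cst//= mul1e diracT.
have mprod n (g : 'I_n -> R -> R) : (forall i, measurable_fun setT (g i)) ->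
    measurable_fun setT (fun x : n.-tuple R => \prod_(i < n) g i (tnth x i)).
  move=> mg; apply: measurable_prod => i _.
  by apply: measurableT_comp (mg i) _; exact: measurable_tnth.
rewrite ge0_integral_tupleS; last 2 first.
- by apply/measurable_EFinP; exact: mprod.
- by move=> x; rewrite lee_fin prodr_ge0.
transitivity (\int[mu]_s ((k ord0 s)%:E * (\prod_(i < d) c (lift ord0 i))%:E))%E.
  apply: eq_integral => s _.
  rewrite -(IH (fun i => k (lift ord0 i)))//.
  rewrite -ge0_integralZl//.
  - apply: eq_integral => y _; rewrite big_ord_recl EFinM; congr (_ * _)%E.
    by congr EFin; apply: eq_bigr => i _; rewrite tnth_tconsS.
  - by apply/measurable_EFinP; exact: (mprod _ (fun i => k (lift ord0 i))).
  - by move=> x _; rewrite lee_fin prodr_ge0.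
  - by rewrite lee_fin.
rewrite ge0_integralZr//.
- by rewrite kc big_ord_recl EFinM.
- by apply/measurable_EFinP; exact: mk.
- by move=> s _; rewrite lee_fin.
- rewrite lee_fin prodr_ge0// => i _.
  by rewrite -lee_fin -kc integral_ge0// => s _; rewrite lee_fin.
Qed.

Lemma gauss_pdf_cons d (m0 s v : R) (m y : d.-tuple R) :
  gauss_pdf (tcons (m0, m)) v (tcons (s, y)) =
  normal_pdf m0 (Num.sqrt v) s * gauss_pdf m v y.
Proof.
rewrite /gauss_pdf big_ord_recl; congr (_ * _).
by apply: eq_bigr => i _; rewrite !tnth_tconsS.
Qed.

Lemma gauss_pdf_ge0 d (m : d.-tuple R) v x : 0 <= gauss_pdf m v x.
Proof. by apply: prodr_ge0 => i _; exact: normal_pdf_ge0. Qed.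

Lemma measurable_gauss_pdf d (m : d.-tuple R) v : measurable_fun setT (gauss_pdf m v).
Proof.
apply: measurable_prod => i _.
apply: measurableT_comp; first exact: measurable_normal_pdf.
exact: measurable_tnth.
Qed.

Section gauss_coordinate.
Variables (d : nat) (m : d.-tuple R) (v : R) (i : 'I_d).
Local Notation pdf := (normal_pdf (tnth m i) (Num.sqrt v)).

Lemma ge0_integral_gauss_coord (f : R -> R) (c : R) :
  measurable_fun setT f -> (forall s, 0 <= f s) ->
  (\int[mu]_s (f s * pdf s)%:E = c%:E)%E ->
  (\int[lebesgue_tuple R d]_x (f (tnth x i) * gauss_pdf m v x)%:E = c%:E)%E.
Proof.
move=> mf f0 fc.
pose k j s := if j == i then f s * pdf s else normal_pdf (tnth m j) (Num.sqrt v) s.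
have -> : c = \prod_(j < d) if j == i then c else 1.
  by rewrite (bigD1 i)//= eqxx big1 ?mulr1// => j /negbTE ->.
rewrite -(@ge0_integral_tuple_prod d k).
- apply: eq_integral => x _; congr EFin.
  rewrite [RHS](bigD1 i)//= /gauss_pdf (bigD1 i)//= /k eqxx mulrA; congr (_ * _).
  by apply: eq_bigr => j /negbTE ->.
- move=> j; rewrite /k; case: (j == i); last exact: measurable_normal_pdf.
  by apply: measurable_funM => //; exact: measurable_normal_pdf.
- move=> j s; rewrite /k; case: ifP => _; last exact: normal_pdf_ge0.
  by rewrite mulr_ge0// normal_pdf_ge0.
- by move=> j; rewrite /k; case: ifP => _; rewrite ?fc// integral_normal_pdf.
Qed.

Lemma integrable_gauss_coord (f : R -> R) : measurable_fun setT f ->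
  mu.-integrable setT (EFin \o (fun s => f s * pdf s)) ->
  (lebesgue_tuple R d).-integrable setT
    (EFin \o (fun x => f (tnth x i) * gauss_pdf m v x)).
Proof.
move=> mf intf; apply/integrableP; split.
  apply/measurable_EFinP/measurable_funM; last exact: measurable_gauss_pdf.
  by apply: measurableT_comp => //; exact: measurable_tnth.
have fin : (\int[mu]_s `|(f s * pdf s)%:E|)%E \is a fin_num.
  exact: integrable_fin_num (integrable_abse intf).
under eq_integral do rewrite /= normrM (ger0_norm (gauss_pdf_ge0 _ _ _)).
rewrite (@ge0_integral_gauss_coord (fun s => `|f s|)
  (fine (\int[mu]_s `|(f s * pdf s)%:E|)%E)) ?ltry//.
  exact: measurableT_comp.
rewrite fineK//; apply: eq_integral => s _ /=.
by rewrite normrM (ger0_norm (normal_pdf_ge0 _ _ _)).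
Qed.

Lemma integral_gauss_coord (f : R -> R) : measurable_fun setT f ->
  mu.-integrable setT (EFin \o (fun s => f s * pdf s)) ->
  (\int[lebesgue_tuple R d]_x (f (tnth x i) * gauss_pdf m v x)%:E =
   \int[mu]_s (f s * pdf s)%:E)%E.
Proof.
move=> mf intf.
have mnf : measurable_fun setT (fun s => `|f s|) by exact: measurableT_comp.
have intnf : mu.-integrable setT (EFin \o (fun s => `|f s| * pdf s)).
  apply: eq_integrable (integrable_abse intf) => // s _ /=.
  by rewrite normrM (ger0_norm (normal_pdf_ge0 _ _ _)).
pose f1 s := `|f s| + f s.
have mf1 : measurable_fun setT f1 by exact: measurable_funD.
have f10 s : 0 <= f1 s.
  by rewrite /f1 -lerBlDr sub0r -normrN ler_norm.
have intf1 : mu.-integrable setT (EFin \o (fun s => f1 s * pdf s)).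
  rewrite (_ : _ \o _ = (EFin \o (fun s => `|f s| * pdf s)%R) \+
      (EFin \o (fun s => f s * pdf s)%R))%E; first exact: integrableD.
  by apply/funext => s /=; rewrite -EFinD -mulrDl.
have E (g : R -> R) : measurable_fun setT g -> (forall s, 0 <= g s) ->
    mu.-integrable setT (EFin \o (fun s => g s * pdf s)) ->
    (\int[lebesgue_tuple R d]_x (g (tnth x i) * gauss_pdf m v x)%:E =
     \int[mu]_s (g s * pdf s)%:E)%E.
  move=> mg g0 intg; have fin := integrable_fin_num measurableT intg.
  by rewrite (@ge0_integral_gauss_coord g _ mg g0 (esym (fineK fin))) fineK.
transitivity (\int[lebesgue_tuple R d]_x ((f1 (tnth x i) * gauss_pdf m v x)%:E -
    (`|f (tnth x i)| * gauss_pdf m v x)%:E))%E.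
  by apply: eq_integral => x _; rewrite -EFinB -mulrBl /f1 addrAC subrr add0r.
rewrite integralB//; [|exact: (integrable_gauss_coord mf1 intf1)|
  exact: (integrable_gauss_coord mnf intnf)].
rewrite (E f1 mf1 f10 intf1) (E (fun s => `|f s|) mnf (fun s => normr_ge0 _) intnf).
rewrite -integralB//.
by apply: eq_integral => s _; rewrite -EFinB -mulrBl /f1 addrAC subrr add0r.
Qed.

End gauss_coordinate.

Lemma integral_gauss_pdf d (m : d.-tuple R) v :
  (\int[lebesgue_tuple R d]_x (gauss_pdf m v x)%:E = 1)%E.
Proof.
rewrite /gauss_pdf.
rewrite (@ge0_integral_tuple_prod d (fun i => normal_pdf (tnth m i) (Num.sqrt v)) (fun=> 1)).
- by rewrite big1.
- by move=> i; exact: measurable_normal_pdf.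
- by move=> i s; exact: normal_pdf_ge0.
- by move=> i; rewrite integral_normal_pdf.
Qed.

(** Partial derivatives in coordinate i are expressed as one-dimensional derivatives along
    [s |-> tset x i s]. *)
Definition tset d (x : d.-tuple R) (i : 'I_d) (s : R) : d.-tuple R :=
  [tuple if j == i then s else tnth x j | j < d].

Lemma tset_tcons0 d (s u : R) (y : d.-tuple R) :
  tset (tcons (s, y)) ord0 u = tcons (u, y).
Proof.
apply: eq_from_tnth => j; rewrite tnth_mktuple.
case: (unliftP ord0 j) => [i ->|->]; last by rewrite eqxx.
by rewrite !tnth_tconsS.
Qed.

Lemma tset_tconsS d (s u : R) (y : d.-tuple R) i :
  tset (tcons (s, y)) (lift ord0 i) u = tcons (s, tset y i u).
Proof.
apply: eq_from_tnth => j; rewrite tnth_mktuple.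
case: (unliftP ord0 j) => [k ->|->] //.
by rewrite !tnth_tconsS tnth_mktuple (inj_eq (@lift_inj _ _)).
Qed.

Section gauss_stein.

Lemma integrable_gauss_stein d (theta : d.-tuple R) i (G G' : d.-tuple R -> R) (K : R) :
  measurable_fun setT G -> measurable_fun setT G' ->
  (forall x, `|G x| <= K) -> (forall x, `|G' x| <= K) ->
  (lebesgue_tuple R d).-integrable setT (EFin \o
    (fun x => ((tnth x i - tnth theta i) * G x - G' x) * gauss_pdf theta 1 x)).
Proof.
move=> mG mG' GK G'K.
pose f s := K * (1 + `|s - tnth theta i|).
have mf : measurable_fun setT f.
  apply: measurable_funM => //; apply: measurable_funD => //.
  by apply: measurableT_comp => //; exact: measurable_funB.
have K0 : 0 <= K by apply: le_trans (GK theta).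
have intf : mu.-integrable setT
    (EFin \o (fun s => f s * normal_pdf (tnth theta i) (Num.sqrt 1) s)).
  apply: (@integrable_normal_quadratic _ _ _ _ (2 * K)) => //.
  move=> s; rewrite ger0_norm ?mulr_ge0 ?addr_ge0//.
  rewrite (mulrC 2) -mulrA ler_wpM2l//.
  by have := norm_le1Dsqr (s - tnth theta i); have := sqr_ge0 (s - tnth theta i); lra.
have intg := integrable_gauss_coord mf intf.
apply: (le_integrable measurableT _ _ intg).
  apply/measurable_EFinP/measurable_funM; last exact: measurable_gauss_pdf.
  apply: measurable_funB => //; apply: measurable_funM => //.
  by apply: measurable_funB => //; exact: measurable_tnth.
have f0 s : 0 <= f s by rewrite /f mulr_ge0// addr_ge0.
move=> x _; rewrite lee_fin normrM [leRHS]normrM ler_wpM2r// (ger0_norm (f0 _)).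
rewrite (le_trans (ler_normB _ _))// normrM /f mulrDr mulr1 addrC lerD//.
by rewrite mulrC ler_wpM2r.
Qed.

(** By induction on d the first coordinate is split off. If i is that coordinate, it is integrated
    first, by the one-dimensional identity; otherwise the others are integrated first, by the
    induction hypothesis. *)
Lemma gauss_stein d (theta : d.-tuple R) i (G G' : d.-tuple R -> R) (K : R) :
  measurable_fun setT G -> measurable_fun setT G' ->
  (forall (x : d.-tuple R) (s : R),
    is_derive s 1 (fun u => G (tset x i u)) (G' (tset x i s))) ->
  (forall x : d.-tuple R, continuous (fun u => G' (tset x i u))) ->
  (forall x, `|G x| <= K) -> (forall x, `|G' x| <= K) ->
  (\int[lebesgue_tuple R d]_x
    (((tnth x i - tnth theta i) * G x - G' x) * gauss_pdf theta 1 x)%:E = 0)%E.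
Proof.
elim: d theta i G G' => [theta []//|d IH theta i G G' mG mG' dG cG' GK G'K].
have intH := integrable_gauss_stein theta i mG mG' GK G'K.
rewrite (integral_tupleS intH).
have intHc := integrable_tupleS intH.
case/tupleP: theta intH intHc => m0 m intH intHc.
have -> : [tuple of m0 :: m] = tcons (m0, m) by [].
have mcons s : measurable_fun setT (fun y : d.-tuple R => tcons (s, y)).
  by apply: measurableT_comp (@measurable_tcons _ _) _; exact: measurable_pair1.
case: (unliftP ord0 i) => [j ij|i0].
  rewrite -(integral12_prod_meas1 intHc).
  rewrite (eq_integral (cst 0%E)) ?integral_cst ?mul0e// => s _.
  rewrite /fubini_F /= ij.
  under eq_integral do rewrite gauss_pdf_cons !tnth_tconsS mulrCA EFinM.
  have IHs : (\int[lebesgue_tuple R d]_y (((tnth y j - tnth m j) * G (tcons (s, y)) -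
      G' (tcons (s, y))) * gauss_pdf m 1 y)%:E = 0)%E.
    apply: (IH m j (fun y => G (tcons (s, y))) (fun y => G' (tcons (s, y)))) => //.
    - by apply: measurableT_comp.
    - by apply: measurableT_comp.
    - move=> y u; have := dG (tcons (s, y)) u; rewrite ij tset_tconsS.
      by under eq_fun do rewrite tset_tconsS.
    - move=> y; have := cG' (tcons (s, y)); rewrite ij.
      by under eq_fun do rewrite tset_tconsS.
  rewrite integralZl//; first by rewrite IHs mule0.
  apply: (@integrable_gauss_stein d m j (fun y => G (tcons (s, y)))
      (fun y => G' (tcons (s, y))) K) => //; exact: measurableT_comp.
rewrite -(integral21_prod_meas1 intHc).
rewrite (eq_integral (cst 0%E)) ?integral_cst ?mul0e// => y _.
rewrite /fubini_G /= i0.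
under eq_integral do rewrite gauss_pdf_cons !tnth_tcons0 mulrA EFinM.
have dGy (s : R) : is_derive s 1 (fun u => G (tcons (u, y))) (G' (tcons (s, y))).
  have := dG (tcons (s, y)) s; rewrite i0 tset_tcons0.
  by under eq_fun do rewrite tset_tcons0.
have cG'y : continuous (fun u => G' (tcons (u, y))).
  by have := cG' (tcons (0, y)); rewrite i0; under eq_fun do rewrite tset_tcons0.
have K0 : 0 <= K by apply: le_trans (GK (tcons (m0, m))).
have GKy s : `|G (tcons (s, y))| <= K * (1 + `|s - m0|).
  by rewrite (le_trans (GK _))// ler_peMr// lerDl.
have S : (\int[mu]_s (((s - m0) * G (tcons (s, y)) - G' (tcons (s, y))) *
    normal_pdf m0 1 s)%:E = 0)%E.
  rewrite -[RHS](@normal_stein R m0 1 _ _ K ltr01 dGy cG'y GKy (fun s => G'K _)).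
  by apply: eq_integral => s _; rewrite expr1n mul1r.
rewrite integralZr//.
  by rewrite sqrtr1 S mul0e.
rewrite sqrtr1.
apply: (@integrable_normal_quadratic _ m0 1
  (fun s => (s - m0) * G (tcons (s, y)) - G' (tcons (s, y))) (2 * K)) => //.
  have mpair : measurable_fun setT (fun s : R => tcons (s : measurableTypeR R, y)).
    by apply: measurableT_comp (@measurable_tcons _ _) _; exact: measurable_pair2.
  apply: measurable_funB; last exact: measurableT_comp.
  by apply: measurable_funM; [exact: measurable_funB|exact: measurableT_comp].
move=> s; rewrite (le_trans (ler_normB _ _))// normrM.
apply: (@le_trans _ _ (`|s - m0| * K + K)); first by rewrite lerD// ler_wpM2l.
rewrite (_ : _ * K + K = K * (`|s - m0| + 1)); last by ring.
rewrite (mulrC 2) -mulrA ler_wpM2l//.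
by have := norm_le1Dsqr (s - m0); have := sqr_ge0 (s - m0); lra.
Qed.

End gauss_stein.
End tuple_integral.

(** * Bayes risks and the lower bound *)

Section posterior.
Context {R : realType}.
Local Notation mu := (@lebesgue_measure R).
Implicit Types (m c s v x theta : R).

Lemma normal_pdf_sqrt m v x : 0 < v -> normal_pdf m (Num.sqrt v) x =
  (Num.sqrt (v * pi * 2))^-1 * expR (- (x - m) ^+ 2 / (v * 2)).
Proof.
move=> v0; rewrite normal_pdf_prod ?gt_eqF ?sqrtr_gt0//.
by rewrite /normal_peak /normal_fun sqr_sqrtr ?(ltW v0)// !mulr_natr.
Qed.

(** Completing the square: the joint density of observation and parameter is the marginal N(c, 1 +
    v) times the normal posterior. *)
Lemma normal_pdf_posterior c v x theta : 0 < v ->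
  normal_pdf theta (Num.sqrt 1) x * normal_pdf c (Num.sqrt v) theta =
  normal_pdf c (Num.sqrt (1 + v)) x *
    normal_pdf (c + v / (1 + v) * (x - c)) (Num.sqrt (v / (1 + v))) theta.
Proof.
move=> v0; have v1 : 0 < 1 + v by rewrite addr_gt0.
have vv : 0 < v / (1 + v) by rewrite divr_gt0.
rewrite !normal_pdf_sqrt// [LHS]mulrACA [RHS]mulrACA -!expRD.
rewrite -(invfM (Num.sqrt (1 * pi * 2))) -(invfM (Num.sqrt ((1 + v) * pi * 2))).
congr (_^-1 * expR _).
  rewrite -!sqrtrM ?mulr_ge0 ?pi_ge0 ?(ltW v1)//.
  by congr Num.sqrt; field; rewrite gt_eqF.
by field; rewrite !gt_eqF.
Qed.

Definition posterior_mean d (c : d.-tuple R) v (x : d.-tuple R) : d.-tuple R :=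
  [tuple tnth c i + v / (1 + v) * (tnth x i - tnth c i) | i < d].

Lemma gauss_pdf_posterior d (c x theta : d.-tuple R) v : 0 < v ->
  gauss_pdf theta 1 x * gauss_pdf c v theta =
  gauss_pdf c (1 + v) x * gauss_pdf (posterior_mean c v x) (v / (1 + v)) theta.
Proof.
move=> v0; rewrite /gauss_pdf -!big_split/=; apply: eq_bigr => i _.
by rewrite normal_pdf_posterior// tnth_mktuple.
Qed.

Lemma integrable_mean_square m s c : 0 < s ->
  mu.-integrable setT (EFin \o (fun t => (c - t) ^+ 2 * normal_pdf m s t)).
Proof.
move=> s0.
apply: (@integrable_normal_quadratic _ _ _ _ (2 + 2 * (c - m) ^+ 2)) => //.
  by apply: measurable_funX; exact: measurable_funB.
move=> x; rewrite ger0_norm ?sqr_ge0//.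
have -> : (c - x) ^+ 2 = 2 * (c - m) ^+ 2 + 2 * (x - m) ^+ 2 - (c + x - 2 * m) ^+ 2 by ring.
have H1 := sqr_ge0 (c + x - 2 * m); have H2 := sqr_ge0 (c - m); have H3 := sqr_ge0 (x - m).
have H4 := mulr_ge0 H2 H3; set u := (c - m) ^+ 2 in H2 H4 *; set w := (x - m) ^+ 2 in H3 H4 *.
rewrite mulrDr mulr1 mulrDl; lra.
Qed.

(** The function (t - m)^2 - 2 (c - m) (t - m) has mean s^2 and differs from (c - t)^2 by the square
    (c - m)^2. *)
Lemma normal_mean_square_ge m s c : 0 < s ->
  ((s ^+ 2)%:E <= \int[mu]_t ((c - t) ^+ 2 * normal_pdf m s t)%:E)%E.
Proof.
move=> s0.
have int2 : mu.-integrable setT (EFin \o (fun x => (x - m) ^+ 2 * normal_pdf m s x)).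
  apply: (@integrable_normal_quadratic _ _ _ _ 1) => //.
    by apply: measurable_funX; exact: measurable_funB.
  by move=> x; rewrite mul1r ger0_norm ?sqr_ge0// lerDr.
have int1 : mu.-integrable setT (EFin \o (fun x => (x - m) * normal_pdf m s x)).
  apply: (@integrable_normal_quadratic _ _ _ _ 1) => //.
    exact: measurable_funB.
  by move=> x; rewrite mul1r norm_le1Dsqr.
have int1' : mu.-integrable setT
    (fun x => (2 * (c - m))%:E * ((x - m) * normal_pdf m s x)%:E)%E.
  exact: integrableZl.
have <- : (\int[mu]_t (((t - m) ^+ 2 * normal_pdf m s t)%:E -
    (2 * (c - m))%:E * ((t - m) * normal_pdf m s t)%:E) = (s ^+ 2)%:E)%E.
  rewrite integralB// integralZl//.
  by rewrite (normal_centered m s0) mule0 sube0 normal_variance.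
apply: le_integral => //; first exact: integrableB.
  exact: integrable_mean_square.
move=> t _; rewrite -EFinM -EFinB lee_fin mulrA -mulrBl ler_wpM2r ?normal_pdf_ge0//.
rewrite -subr_ge0.
have -> : (c - t) ^+ 2 - ((t - m) ^+ 2 - 2 * (c - m) * (t - m)) = (c - m) ^+ 2 by ring.
exact: sqr_ge0.
Qed.

Lemma gauss_mean_square_ge d (c m : d.-tuple R) v : 0 < v ->
  ((d%:R * v)%:E <= \int[lebesgue_tuple R d]_theta
     (sqnorm (tsub c theta) * gauss_pdf m v theta)%:E)%E.
Proof.
move=> v0; have s0 : 0 < Num.sqrt v by rewrite sqrtr_gt0.
under eq_integral => theta _.
  rewrite /sqnorm mulr_suml -sumEFin.
  under eq_bigr => i _ do rewrite tnth_mktuple.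
  over.
rewrite ge0_integral_sum//; last 2 first.
- move=> i; apply/measurable_EFinP/measurable_funM; last exact: measurable_gauss_pdf.
  by apply/measurable_funX/measurable_funB => //; exact: measurable_tnth.
- by move=> i theta _; rewrite lee_fin mulr_ge0 ?sqr_ge0 ?gauss_pdf_ge0.
rewrite (_ : (d%:R * v)%:E = (\sum_(i < d) v%:E)%E); last first.
  by rewrite sumEFin big_const_ord iter_addr_0 mulr_natl.
apply: lee_sum => i _; rewrite -[v in v%:E]sqr_sqrtr; last exact: ltW.
have fm : measurable_fun setT (fun s => (tnth c i - s) ^+ 2).
  by apply/measurable_funX/measurable_funB.
have int2 : mu.-integrable setT
    (EFin \o (fun t => (tnth c i - t) ^+ 2 * normal_pdf (tnth m i) (Num.sqrt v) t)).
  exact: integrable_mean_square.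
rewrite (integral_gauss_coord fm int2).
exact: normal_mean_square_ge.
Qed.

End posterior.

(** * The lower bound d for the maximal risk *)

Section minimax_lower_bound.
Context {R : realType} {d : nat}.
Implicit Types (delta : d.-tuple R -> d.-tuple R) (theta x : d.-tuple R).

Lemma measurable_gauss_pdf2 (v : R) : 0 < v ->
  measurable_fun setT (fun p : d.-tuple R * d.-tuple R => gauss_pdf p.1 v p.2).
Proof.
move=> v0; apply: measurable_prod => i _.
under eq_fun do rewrite normal_pdf_sqrt//.
apply: measurable_funM => //; apply: measurableT_comp => //.
apply: measurable_funM => //; apply: measurableT_comp => //.
apply: measurable_funX; apply: measurable_funB.
  exact: (measurableT_comp (measurable_tnth i) measurable_snd).
exact: (measurableT_comp (measurable_tnth i) measurable_fst).
Qed.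

Lemma measurable_sqnorm_tsub (disp : measure_display)
    (X : measurableType disp) (f g : X -> d.-tuple R) :
  measurable_fun setT f -> measurable_fun setT g ->
  measurable_fun setT (fun p => sqnorm (tsub (f p) (g p))).
Proof.
move=> mf mg; under eq_fun do rewrite /sqnorm.
under eq_fun do under eq_bigr do rewrite tnth_mktuple.
apply: measurable_sum => i; apply: measurable_funX.
apply: measurable_funB.
  exact: (measurableT_comp (measurable_tnth i) mf).
exact: (measurableT_comp (measurable_tnth i) mg).
Qed.

Lemma sqnorm_ge0 x : 0 <= sqnorm x.
Proof. by apply: sumr_ge0 => i _; exact: sqr_ge0. Qed.

(** The maximal risk is at least the average risk under the prior N(0, t I_d), and this is at least
    d times the posterior variance t / (1 + t), whatever the estimator. *)
Lemma sup_risk_gauss_prior delta (t : R) : measurable_fun setT delta -> 0 < t ->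
  ((d%:R * (t / (1 + t)))%:E <= sup_risk delta)%E.
Proof.
move=> md t0.
have t1 : 0 < 1 + t by rewrite addr_gt0.
have tt : 0 < t / (1 + t) by rewrite divr_gt0.
have risk_ge0 theta : (0 <= risk theta delta)%E.
  by apply: integral_ge0 => x _; rewrite lee_fin mulr_ge0 ?sqnorm_ge0 ?gauss_pdf_ge0.
have risk_le theta : (risk theta delta <= sup_risk delta)%E.
  by apply: ereal_sup_ubound; exists theta.
have [->|Soo] := eqVneq (sup_risk delta) +oo%E; first exact: leey.
have Sfin : sup_risk delta \is a fin_num.
  rewrite ge0_fin_numE ?ltey ?Soo//.
  exact: le_trans (risk_ge0 _) (risk_le [tuple 0 | i < d]).
pose c : d.-tuple R := [tuple 0 | i < d].
pose prior := gauss_pdf c t.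
pose F (p : d.-tuple R * d.-tuple R) :=
  (sqnorm (tsub (delta p.2) p.1) * gauss_pdf p.1 1 p.2 * prior p.1)%:E.
have mF : measurable_fun setT F.
  apply/measurable_EFinP/measurable_funM; first apply: measurable_funM.
  - apply: measurable_sqnorm_tsub => //.
    by apply: measurableT_comp => //; exact: measurable_snd.
  - exact: measurable_gauss_pdf2.
  - by apply: measurableT_comp => //; exact: measurable_gauss_pdf.
have F0 p : (0 <= F p)%E by rewrite lee_fin !mulr_ge0 ?sqnorm_ge0 ?gauss_pdf_ge0.
have upper : (\int[lebesgue_tuple R d]_theta \int[lebesgue_tuple R d]_x F (theta, x) <=
    sup_risk delta)%E.
  apply: (@le_trans _ _ (\int[lebesgue_tuple R d]_theta
      (sup_risk delta * (prior theta)%:E))%E).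
    apply: ge0_le_integral => //.
    - by move=> theta _; exact: integral_ge0.
    - exact: measurable_fun_fubini_tonelli_F.
    - rewrite -(fineK Sfin); apply/measurable_EFinP/measurable_funM => //.
      exact: measurable_gauss_pdf.
    - move=> theta _; rewrite /F /=.
      under eq_integral do rewrite EFinM.
      rewrite ge0_integralZr//.
      + by apply: lee_wpmul2r; [rewrite lee_fin gauss_pdf_ge0|exact: risk_le].
      + apply/measurable_EFinP/measurable_funM; last exact: measurable_gauss_pdf.
        exact: measurable_sqnorm_tsub.
      + by move=> x _; rewrite lee_fin mulr_ge0 ?sqnorm_ge0 ?gauss_pdf_ge0.
      + by rewrite lee_fin gauss_pdf_ge0.
  rewrite ge0_integralZl//.
  - by rewrite integral_gauss_pdf mule1.
  - by apply/measurable_EFinP; exact: measurable_gauss_pdf.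
  - by move=> theta _; rewrite lee_fin gauss_pdf_ge0.
  - by apply: le_trans (risk_le c).
apply: le_trans upper.
(* Integrating over theta first exposes the posterior, whose mean square about any point is at least
   its variance. *)
rewrite -(fubini_tonelli1 _ mF F0) (fubini_tonelli2 _ mF F0).
apply: (@le_trans _ _ (\int[lebesgue_tuple R d]_x
    ((gauss_pdf c (1 + t) x)%:E * (d%:R * (t / (1 + t)))%:E))%E).
  rewrite ge0_integralZr//.
  - by rewrite integral_gauss_pdf mul1e.
  - by apply/measurable_EFinP; exact: measurable_gauss_pdf.
  - by move=> x _; rewrite lee_fin gauss_pdf_ge0.
  - by rewrite lee_fin mulr_ge0// ltW.
apply: ge0_le_integral => //.
- move=> x _; rewrite -EFinM lee_fin; apply: mulr_ge0; first exact: gauss_pdf_ge0.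
  by apply: mulr_ge0 => //; exact: ltW.
- apply/measurable_EFinP/measurable_funM => //; exact: measurable_gauss_pdf.
- exact: measurable_fun_fubini_tonelli_G.
move=> x _; rewrite /fubini_G /F /=.
under eq_integral do rewrite -mulrA gauss_pdf_posterior// mulrCA EFinM.
rewrite ge0_integralZl//.
- by apply: lee_wpmul2l; [rewrite lee_fin gauss_pdf_ge0|exact: gauss_mean_square_ge].
- apply/measurable_EFinP/measurable_funM; last exact: measurable_gauss_pdf.
  exact: measurable_sqnorm_tsub.
- by move=> theta _; rewrite lee_fin mulr_ge0 ?sqnorm_ge0 ?gauss_pdf_ge0.
- by rewrite lee_fin gauss_pdf_ge0.
Qed.

Lemma sup_risk_ge delta : measurable_fun setT delta -> (d%:R%:E <= sup_risk delta)%E.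
Proof.
move=> md; have H := fun t t0 => @sup_risk_gauss_prior delta t md t0.
case: (sup_risk delta) H => [s H||H].
- rewrite lee_fin leNgt; apply/negP => sd.
  (* The bound d t / (1 + t) <= s amounts to t (d - s) <= s, which fails because t (d - s) = |s| +
     1. *)
  pose t := (`|s| + 1) / (d%:R - s).
  have ds : 0 < d%:R - s by rewrite subr_gt0.
  have t0 : 0 < t by rewrite divr_gt0// ltr_wpDl.
  have := H _ t0; rewrite lee_fin mulrA ler_pdivrMr ?addr_gt0//.
  have : t * (d%:R - s) = `|s| + 1 by rewrite /t divfK ?gt_eqF.
  have := ler_norm s; lra.
- by rewrite leey.
- by have := H 1 ltr01; rewrite leeNy_eq.
Qed.

End minimax_lower_bound.

(** * The posterior mean *)

Section mixture_density.
Context {R : realType} {d k : nat}.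
Local Notation mu := (@lebesgue_measure R).
Variable h : R -> R.
Hypothesis h_gt0 : forall x : R, 0 < x -> x < 1 -> 0 < h x.
Hypothesis h_int : mu.-integrable `]0, 1[ (EFin \o h).
Variables (a : R) (w : 'I_k -> R) (target : 'I_k -> d.-tuple R).
Hypothesis a_ge1 : 1 <= a.
Hypothesis w_gt0 : forall i : 'I_k, 0 < w i.
Implicit Types (theta x : d.-tuple R) (l : R).

Let m01 : measurable (`]0, 1[%classic : set (measurableTypeR R)).
Proof. exact: measurable_itv. Qed.

(** Extension by 0 outside (0, 1), so that Fubini's theorem can be used on the full product
    space. *)
Let hD : R -> R := h \_ `]0, 1[.

Let hD_ge0 l : 0 <= hD l.
Proof.
rewrite /hD patchE; case: ifPn => // /set_mem /=; rewrite in_itv/= => /andP[l0 l1].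
exact/ltW/h_gt0.
Qed.

Let mhD : measurable_fun setT hD.
Proof.
apply/(measurable_restrictT h m01).
by apply/measurable_EFinP; exact: measurable_int h_int.
Qed.

Let int_hD : mu.-integrable setT (EFin \o hD).
Proof.
rewrite /hD -restrict_EFin.
by apply/(@integrable_mkcond _ _ _ mu _ (EFin \o h) m01).
Qed.

Let mixv l := a / l - 1.

Let mixv_gt0 l : 0 < l < 1 -> 0 < mixv l.
Proof.
case/andP=> l0 l1; rewrite subr_gt0 ltr_pdivlMr// mul1r.
exact: lt_le_trans a_ge1.
Qed.

(* A closed form of [normal_pdf m (Num.sqrt (a / l - 1)) y] with powers in place
   of inverses, which makes its joint measurability in [l] and [y] apparent. *)
Let ndens (m l y : R) := ((a - l) * l `^ (- 1) * pi * 2) `^ (- 2^-1) *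
  expR (- (y - m) ^+ 2 * ((a - l) `^ (- 1) * l / 2)).

Let ndensE (m l y : R) : 0 < l < 1 ->
  ndens m l y = normal_pdf m (Num.sqrt (mixv l)) y.
Proof.
move=> l01; have v0 := mixv_gt0 l01; case/andP: l01 => l0 l1.
have al : 0 < a - l by rewrite subr_gt0 (lt_le_trans l1).
rewrite normal_pdf_sqrt// /ndens !powRN !powRr1 ?(ltW l0) ?(ltW al)//.
rewrite powR12_sqrt; last first.
  by rewrite !mulr_ge0 ?pi_ge0 ?invr_ge0 ?(ltW al) ?(ltW l0).
congr (_^-1 * expR _).
  by congr Num.sqrt; rewrite /mixv; field; rewrite gt_eqF.
by rewrite /mixv; field; rewrite mulN1r (gt_eqF l0) (gt_eqF al).
Qed.

Let K1 (j : 'I_k) theta l : R :=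
  (\prod_(i < d) ndens (tnth (target j) i) l (tnth theta i)) * hD l.

Let K theta l : R := \sum_(j < k) w j * K1 j theta l.

Let mK1 j : measurable_fun setT (fun p : d.-tuple R * measurableTypeR R => K1 j p.1 p.2).
Proof.
apply: measurable_funM; last by apply: measurableT_comp => //; exact: mhD.
apply: measurable_prod => i _.
have m2 : measurable_fun setT (fun p : d.-tuple R * measurableTypeR R => p.2 : R).
  exact: measurable_snd.
have ma : measurable_fun setT (fun p : d.-tuple R * measurableTypeR R => a - p.2).
  exact: measurable_funB.
have my : measurable_fun setT (fun p : d.-tuple R * measurableTypeR R =>
    (tnth p.1 i - tnth (target j) i)).
  apply: measurable_funB => //.
  exact: (measurableT_comp (measurable_tnth i) measurable_fst).
apply: measurable_funM.
  apply: (measurableT_comp (measurable_powR _)).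
  apply: measurable_funM => //; apply: measurable_funM => //; apply: measurable_funM => //.
  exact: (measurableT_comp (measurable_powR _)).
apply: measurableT_comp => //; apply: measurable_funM.
  by apply: measurableT_comp => //; exact: measurable_funX.
apply: measurable_funM => //; apply: measurable_funM => //.
exact: (measurableT_comp (measurable_powR _)).
Qed.

Let mK : measurable_fun setT (fun p : d.-tuple R * measurableTypeR R => K p.1 p.2).
Proof. by apply: measurable_sum => j; apply: measurable_funM => //; exact: mK1. Qed.

Let K1_in j theta l : 0 < l < 1 ->
  K1 j theta l = gauss_pdf (target j) (mixv l) theta * h l.
Proof.
move=> l01; congr (_ * _); last by rewrite /hD patchE mem_set//= in_itv.
by apply: eq_bigr => i _; rewrite ndensE.
Qed.

Let K1_out j theta l : ~~ (0 < l < 1) -> K1 j theta l = 0.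
Proof.
move=> l01; rewrite /K1 /hD patchE memNset ?mulr0//=.
by rewrite in_itv/=; exact/negP.
Qed.

Let K1_ge0 j theta l : 0 <= K1 j theta l.
Proof.
have [l01|l01] := boolP (0 < l < 1); last by rewrite K1_out.
rewrite K1_in//; case/andP: (l01) => l0 l1.
by rewrite mulr_ge0 ?gauss_pdf_ge0// ltW// h_gt0.
Qed.

Let K_ge0 theta l : 0 <= K theta l.
Proof. by rewrite sumr_ge0// => j _; rewrite mulr_ge0// ltW. Qed.

Let measurable_K1r j theta : measurable_fun setT (fun l : measurableTypeR R => K1 j theta l).
Proof. exact: (measurableT_comp (mK1 j) (measurable_pair1 theta)). Qed.

Lemma prior_multiE theta :
  prior_multi h a w target theta = (\int[mu]_l (K theta l)%:E)%E.
Proof.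
transitivity (\sum_(j < k) \int[mu]_l (w j * K1 j theta l)%:E)%E; last first.
  rewrite -ge0_integral_sum//.
  - by apply: eq_integral => l _; rewrite sumEFin.
  - by move=> j; apply/measurable_EFinP/measurable_funM => //; exact: measurable_K1r.
  - by move=> j l _; rewrite lee_fin mulr_ge0// ltW.
apply: eq_bigr => j _.
under [RHS]eq_integral do rewrite EFinM.
rewrite ge0_integralZl_EFin//; last 3 first.
- by move=> l _; rewrite lee_fin.
- by apply/measurable_EFinP; exact: measurable_K1r.
- exact: ltW.
congr (_ * _)%E; rewrite /prior_mix [LHS]integral_mkcond; apply: eq_integral => l _.
rewrite patchE; have [l01|l01] := boolP (0 < l < 1); last first.
  by rewrite K1_out// memNset//= in_itv/=; exact/negP.
have lD : `]0, 1[%classic l by rewrite /= in_itv.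
rewrite (mem_set lD) K1_in//.
congr (_ * _)%:E; apply: eq_bigr => i _.
have s0 : Num.sqrt (mixv l) != 0 by rewrite gt_eqF// sqrtr_gt0 mixv_gt0.
rewrite !tnth_mktuple tnth_nseq !normal_pdf_prod//.
by rewrite /normal_fun subr0.
Qed.

(** The prior density may be infinite at a target, so the constant is moved under the integral
    through nonnegativity of K; a negative c is treated through - c. *)
Lemma mule_prior_multi theta (c : R) :
  (c%:E * prior_multi h a w target theta = \int[mu]_l (c * K theta l)%:E)%E.
Proof.
rewrite prior_multiE.
have mKr : measurable_fun setT (fun l : measurableTypeR R => (K theta l)%:E).
  apply/measurable_EFinP.
  exact: (measurableT_comp mK (measurable_pair1 theta)).
have [c0|c0] := leP 0 c.
  by rewrite -ge0_integralZl_EFin// => l _; rewrite lee_fin.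
have -> : c%:E = (- (- c)%:E)%E by rewrite -EFinN opprK.
have c0' : 0 <= - c by rewrite oppr_ge0 ltW.
rewrite mulNe -ge0_integralZl_EFin//; last by move=> l _; rewrite lee_fin.
rewrite -integral_ge0N.
  by apply: eq_integral => l _; rewrite -EFinM -EFinN mulNr opprK.
by move=> l _; rewrite -EFinM lee_fin mulr_ge0.
Qed.

Let integral_K1 j l : (\int[lebesgue_tuple R d]_theta (K1 j theta l)%:E = (hD l)%:E)%E.
Proof.
have [l01|l01] := boolP (0 < l < 1); last first.
  rewrite (eq_integral (cst 0%E)) => [|theta _]; last by rewrite K1_out.
  rewrite integral0 /hD patchE memNset//=.
  by rewrite in_itv/=; exact/negP.
have lD : `]0, 1[%classic l by rewrite /= in_itv.
case/andP: (l01) => l0 l1.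
under eq_integral do rewrite K1_in// EFinM.
rewrite ge0_integralZr//.
- by rewrite integral_gauss_pdf mul1e /hD patchE mem_set.
- by apply/measurable_EFinP; exact: measurable_gauss_pdf.
- by move=> theta _; rewrite lee_fin gauss_pdf_ge0.
- by rewrite lee_fin ltW// h_gt0.
Qed.

Let measurable_K1l j l : measurable_fun setT (fun theta : d.-tuple R => K1 j theta l).
Proof. exact: (measurableT_comp (mK1 j) (measurable_pair2 l)). Qed.

Section affine_posterior.
Variables (x : d.-tuple R) (i : 'I_d) (alpha beta : R).

(** Affine functions of one coordinate treat both integrals of the posterior mean at once: alpha =
    1, beta = 0 gives the numerator and alpha = 0, beta = 1 the marginal. *)
Let g theta : R := (alpha * tnth theta i + beta) * gauss_pdf theta 1 x.

Let measurable_g : measurable_fun setT g.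
Proof.
apply: measurable_funM.
  apply: measurable_funD => //; apply: measurable_funM => //.
  exact: measurable_tnth.
exact: (measurableT_comp (measurable_gauss_pdf2 ltr01) (measurable_pair2 x)).
Qed.

Let g_bounded : exists B, forall theta, `|g theta| <= B.
Proof.
have [C C0 HC] := normal_pdf_moment_bound (tnth x i) (ltr01 : 0 < (1 : R)).
pose c := `|alpha| * (`|tnth x i| + 1) + `|beta|.
have c0 : 0 <= c by rewrite addr_ge0// mulr_ge0// addr_ge0.
pose P := \prod_(j < d | j != i) normal_peak (Num.sqrt (1 : R)).
have P0 : 0 <= P by apply: prodr_ge0 => j _; exact: normal_peak_ge0.
have s2 : (1 : R) * Num.sqrt 2 != 0 by rewrite mul1r gt_eqF// sqrtr_gt0.
exists (c * (C * normal_peak (1 * Num.sqrt 2)) * P) => theta.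
rewrite /g /gauss_pdf (bigD1 i)//= mulrA normrM ler_pM//.
  rewrite normrM (ger0_norm (normal_pdf_ge0 _ _ _)).
  have -> : normal_pdf (tnth theta i) (Num.sqrt 1) (tnth x i) =
      normal_pdf (tnth x i) 1 (tnth theta i).
    rewrite sqrtr1 !normal_pdf_prod ?oner_neq0// /normal_fun.
    have -> : (tnth x i - tnth theta i) ^+ 2 = (tnth theta i - tnth x i) ^+ 2 by ring.
    by [].
  apply: (@le_trans _ _ (c * ((1 + (tnth theta i - tnth x i) ^+ 2) *
      normal_pdf (tnth x i) 1 (tnth theta i)))).
    rewrite mulrA ler_wpM2r ?normal_pdf_ge0//.
    set y := tnth theta i; set z := tnth x i in c c0 *.
    have y1 : `|y| <= `|z| + `|y - z| by rewrite -[X in `|X| <= _](subrKC z); exact: ler_normD.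
    have y2 := norm_le1Dsqr (y - z).
    have y3 : 0 <= (y - z) ^+ 2 by exact: sqr_ge0.
    rewrite (le_trans (ler_normD _ _))// normrM /c mulrDl lerD//; last first.
      by rewrite ler_peMr// lerDl.
    rewrite -mulrA ler_wpM2l// (le_trans y1)//.
    have := mulr_ge0 (normr_ge0 z) y3; lra.
  rewrite ler_wpM2l// (le_trans (HC _))// ler_wpM2l//.
  exact: normal_pdf_ub.
rewrite ger0_norm; last by apply: prodr_ge0 => j _; exact: normal_pdf_ge0.
apply: ler_prod => j _; rewrite normal_pdf_ge0/=.
by apply: normal_pdf_ub; rewrite sqrtr1 oner_neq0.
Qed.

Let measurable_gK : measurable_fun setT
  (fun p : d.-tuple R * measurableTypeR R => (g p.1 * K p.1 p.2)%:E).
Proof.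
apply/measurable_EFinP/measurable_funM; last exact: mK.
exact: (measurableT_comp measurable_g measurable_fst).
Qed.

(** The Gaussian factor makes g bounded in theta, and K integrates over theta to a multiple of
    [hD l]. This justifies exchanging the integrals although g has no constant sign. *)
Let integrable_gK : (lebesgue_tuple R d \x mu)%E.-integrable setT
  (fun p : d.-tuple R * measurableTypeR R => (g p.1 * K p.1 p.2)%:E).
Proof.
apply/(integrable21ltyP _ _ measurable_gK).
have [B gB] := g_bounded.
have B0 : 0 <= B by apply: le_trans (gB x).
have mKl l : measurable_fun setT (fun theta : d.-tuple R => (K theta l)%:E).
  by apply/measurable_EFinP; exact: (measurableT_comp mK (measurable_pair2 l)).
have le1 l : (\int[lebesgue_tuple R d]_theta `|(g theta * K theta l)%:E| <=
    (B * \sum_(j < k) w j)%:E * (hD l)%:E)%E.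
  apply: (@le_trans _ _ (\int[lebesgue_tuple R d]_theta (B%:E * (K theta l)%:E))%E).
    apply: ge0_le_integral => //.
    - apply: measurableT_comp => //.
      exact: (measurableT_comp measurable_gK (measurable_pair2 l)).
    - by apply: emeasurable_funM.
    - move=> theta _; rewrite -EFinM lee_fin normrM (ger0_norm (K_ge0 _ _)).
      by rewrite ler_wpM2r.
  rewrite ge0_integralZl_EFin//; last by move=> theta _; rewrite lee_fin.
  rewrite EFinM -muleA lee_wpmul2l ?lee_fin//.
  under eq_integral do rewrite /K -sumEFin.
  rewrite ge0_integral_sum//.
  - rewrite -sumEFin ge0_sume_distrl => [|j _]; last by rewrite lee_fin ltW.
    rewrite le_eqVlt; apply/orP; left; apply/eqP; apply: eq_bigr => j _.
    under eq_integral do rewrite EFinM.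
    rewrite ge0_integralZl_EFin//; first by rewrite integral_K1.
    + by move=> theta _; rewrite lee_fin.
    + by apply/measurable_EFinP; exact: measurable_K1l.
    + exact: ltW.
  - move=> j; apply/measurable_EFinP/measurable_funM => //; exact: measurable_K1l.
  - by move=> j theta _; rewrite lee_fin mulr_ge0// ltW.
have int2 : mu.-integrable setT (fun l => (B * \sum_(j < k) w j)%:E * (hD l)%:E)%E.
  exact: integrableZl.
apply: (@le_lt_trans _ _ (\int[mu]_l ((B * \sum_(j < k) w j)%:E * (hD l)%:E))%E); last first.
  rewrite integralZl// -ge0_fin_numE.
    by rewrite fin_numM// integrable_fin_num.
  rewrite mule_ge0// ?lee_fin ?mulr_ge0 ?sumr_ge0// => [j _|]; first exact: ltW.
  by apply: integral_ge0 => l _; rewrite lee_fin.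
apply: ge0_le_integral => //.
- by move=> l _; exact: integral_ge0.
- have mabs : measurable_fun setT
      (fun p : d.-tuple R * measurableTypeR R => `|(g p.1 * K p.1 p.2)%:E|%E).
    exact: measurableT_comp.
  exact: (measurable_fun_fubini_tonelli_G _ mabs).
- exact: measurable_int int2.
- by move=> l _; exact: le1.
Qed.

Let integrable_affine_normal m v : 0 < v -> mu.-integrable setT
  (EFin \o (fun s => (alpha * s + beta) * normal_pdf m (Num.sqrt v) s)).
Proof.
move=> v0; apply: (@integrable_normal_quadratic _ _ _ _ (`|alpha| * (`|m| + 1) + `|beta|)).
- by rewrite sqrtr_gt0.
- by apply: measurable_funD => //; exact: measurable_funM.
move=> s.
have y1 : `|s| <= `|m| + `|s - m| by rewrite -[X in `|X| <= _](subrKC m); exact: ler_normD.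
have y2 := norm_le1Dsqr (s - m).
have y3 : 0 <= (s - m) ^+ 2 by exact: sqr_ge0.
rewrite (le_trans (ler_normD _ _))// normrM mulrDl lerD//; last first.
  by rewrite ler_peMr// lerDl.
rewrite -mulrA ler_wpM2l// (le_trans y1)//.
have := mulr_ge0 (normr_ge0 m) y3; lra.
Qed.

Let affine_normal m v : 0 < v ->
  (\int[mu]_s ((alpha * s + beta) * normal_pdf m (Num.sqrt v) s)%:E =
    (alpha * m + beta)%:E)%E.
Proof.
move=> v0; have s0 : 0 < Num.sqrt v by rewrite sqrtr_gt0.
have int1 : mu.-integrable setT
    (EFin \o (fun s => (s - m) * normal_pdf m (Num.sqrt v) s)).
  apply: (@integrable_normal_quadratic _ _ _ _ 1) => //.
    exact: measurable_funB.
  by move=> s; rewrite mul1r norm_le1Dsqr.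
have int0 : mu.-integrable setT (EFin \o normal_pdf m (Num.sqrt v)).
  exact: integrable_normal_pdf.
transitivity (\int[mu]_s (alpha%:E * ((s - m) * normal_pdf m (Num.sqrt v) s)%:E +
    (alpha * m + beta)%:E * (normal_pdf m (Num.sqrt v) s)%:E))%E.
  by apply: eq_integral => s _; rewrite -!EFinM -EFinD; congr EFin; ring.
rewrite integralD//; [|exact: (integrableZl _ _ int1)|exact: (integrableZl _ _ int0)].
rewrite integralZl// (normal_centered m s0) mule0 add0e integralZl//.
by rewrite integral_normal_pdf mule1.
Qed.

(** Conjugacy for fixed l: the prior variance a / l - 1 gives the marginal variance a / l and a
    posterior mean that keeps the fraction 1 - l / a of x - theta_j. *)
Let inner_gK l : 0 < l < 1 ->
  (\int[lebesgue_tuple R d]_theta (g theta * K theta l)%:E =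
  (\sum_(j < k) w j * (h l * gauss_pdf (target j) (a / l) x *
     (alpha * (tnth (target j) i + (1 - l / a) * (tnth x i - tnth (target j) i)) + beta)))%:E)%E.
Proof.
move=> l01; have v0 := mixv_gt0 l01; case/andP: (l01) => l0 l1.
have a0 : 0 < a by exact: lt_le_trans a_ge1.
pose v' := mixv l / (1 + mixv l).
have v1 : 1 + mixv l = a / l by rewrite /mixv addrC subrK.
have v'0 : 0 < v' by rewrite divr_gt0// addr_gt0.
have v'E : v' = 1 - l / a.
  by rewrite /v' v1 /mixv; field; rewrite !gt_eqF.
pose q j theta := (w j * (h l * gauss_pdf (target j) (a / l) x)) *
  ((alpha * tnth theta i + beta) * gauss_pdf (posterior_mean (target j) (mixv l) x) v' theta).
have mf : measurable_fun setT (fun s : R => alpha * s + beta).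
  by apply: measurable_funD => //; exact: measurable_funM.
have intq j : (lebesgue_tuple R d).-integrable setT (fun theta => (q j theta)%:E).
  rewrite /q; under eq_fun do rewrite EFinM.
  apply: integrableZl => //.
  exact: (integrable_gauss_coord mf (integrable_affine_normal _ v'0)).
transitivity (\int[lebesgue_tuple R d]_theta (\sum_(j < k) (q j theta)%:E))%E.
  apply: eq_integral => theta _; rewrite sumEFin; congr EFin.
  rewrite /K mulr_sumr; apply: eq_bigr => j _.
  rewrite K1_in// /g /q -v1.
  rewrite (_ : _ * (w j * (_ * h l)) = w j * h l * (alpha * tnth theta i + beta) *
     (gauss_pdf theta 1 x * gauss_pdf (target j) (mixv l) theta)); last by ring.
  by rewrite (gauss_pdf_posterior _ _ _ v0) -/v'; ring.
rewrite integral_sum// -sumEFin; apply: eq_bigr => j _.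
rewrite /q; under eq_integral do rewrite EFinM.
rewrite integralZl//; last first.
  exact: (integrable_gauss_coord mf (integrable_affine_normal _ v'0)).
rewrite (integral_gauss_coord mf (integrable_affine_normal _ v'0)) (affine_normal _ v'0).
rewrite -EFinM; congr EFin.
by rewrite tnth_mktuple -/v' v'E; ring.
Qed.

Let C := (Num.sqrt (2 * pi * a))^-1 ^+ d.

(** As a function of l, the marginal density is the weight of I_(d/2) at |x - c|^2 / a, up to the
    constant C, which cancels in the posterior mean. *)
Let gauss_pdf_scaled c l : 0 < l ->
  gauss_pdf c (a / l) x =
  C * (l `^ (d%:R / 2) * expR (- (l * (sqnorm (tsub x c) / a) / 2))).
Proof.
move=> l0; have a0 : 0 < a by exact: lt_le_trans a_ge1.
have al : 0 < a / l by rewrite divr_gt0.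
transitivity (\prod_(j < d) ((Num.sqrt (2 * pi * a))^-1 * Num.sqrt l *
    expR (- (l * ((tnth x j - tnth c j) ^+ 2 / a) / 2)))).
  apply: eq_bigr => j _; rewrite normal_pdf_sqrt//; congr (_ * expR _).
    rewrite (_ : a / l * pi * 2 = (2 * pi * a) / l); last by ring.
    by rewrite sqrtrM ?mulr_ge0 ?pi_ge0 ?(ltW a0)// sqrtrV ?(ltW l0)// invfM invrK.
  by field; rewrite !gt_eqF.
rewrite big_split/= big_split/= !prodr_const card_ord -/C -(mulrA C).
congr (_ * (_ * _)).
  rewrite -powR_mulrn ?sqrtr_ge0// -powR12_sqrt ?(ltW l0)// -powRrM.
  by congr (_ `^ _); rewrite mulrC.
rewrite -expR_sum; congr expR.
rewrite sumrN; congr (- _); rewrite -mulr_suml; congr (_ / _).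
rewrite -mulr_sumr; congr (_ * _); rewrite -mulr_suml; congr (_ / _).
by apply: eq_bigr => j _; rewrite tnth_mktuple.
Qed.

Lemma affine_posterior_integral :
  (\int[lebesgue_tuple R d]_theta
     (((alpha * tnth theta i + beta) * gauss_pdf theta 1 x)%:E *
      prior_multi h a w target theta) =
   (C * \sum_(j < k) w j *
     ((alpha * tnth x i + beta) * laplace h (d%:R / 2) (sqnorm (tsub x (target j)) / a) -
      alpha / a * (tnth x i - tnth (target j) i) *
        laplace h (d%:R / 2 + 1) (sqnorm (tsub x (target j)) / a)))%:E)%E.
Proof.
have p0 : 0 <= d%:R / 2 :> R by rewrite divr_ge0.
pose t j := sqnorm (tsub x (target j)) / a.
pose L j l := laplace_fun h (d%:R / 2) (t j) l.
have intL j : mu.-integrable `]0, 1[ (EFin \o L j).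
  exact: integrable_laplace_fun.
have intxL j : mu.-integrable `]0, 1[ (EFin \o (fun l => l * L j l)).
  exact: integrable_laplace_funS.
transitivity (\int[lebesgue_tuple R d]_theta \int[mu]_l (g theta * K theta l)%:E)%E.
  by apply: eq_integral => theta _; rewrite mule_prior_multi.
have := integral12_prod_meas1 integrable_gK; rewrite /fubini_F/= => ->.
rewrite -(integral21_prod_meas1 integrable_gK) /fubini_G/=.
pose T l := \sum_(j < k) (C * (w j * (alpha * tnth x i + beta)) * L j l -
   C * (w j * (alpha / a * (tnth x i - tnth (target j) i))) * (l * L j l)).
transitivity (\int[mu]_(l in `]0%R, 1%R[) (T l)%:E)%E.
  rewrite [RHS]integral_mkcond; apply: eq_integral => l _.
  have [l01|l01] := boolP (0 < l < 1); last first.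
    rewrite patchE memNset//=; last by rewrite in_itv/=; exact/negP.
    rewrite (eq_integral (cst 0%E)) ?integral0// => theta _.
    by rewrite /K big1 ?mulr0// => j _; rewrite K1_out ?mulr0.
  have lD : `]0, 1[%classic l by rewrite /= in_itv.
  rewrite patchE (mem_set lD) inner_gK//=; congr EFin; apply: eq_bigr => j _.
  case/andP: l01 => l0 l1; rewrite gauss_pdf_scaled// /L /laplace_fun -/(t j).
  ring.
have intZ (f : R -> R) c : mu.-integrable `]0, 1[ (EFin \o f) ->
    mu.-integrable `]0, 1[ (fun l => c%:E * (f l)%:E)%E.
  by move=> intf; exact: (@integrableZl _ _ _ _ _ m01 c (EFin \o f) intf).
have intT j : mu.-integrable `]0, 1[ (fun l =>
    (C * (w j * (alpha * tnth x i + beta)))%:E * (L j l)%:E -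
    (C * (w j * (alpha / a * (tnth x i - tnth (target j) i))))%:E * (l * L j l)%:E)%E.
  exact: (@integrableB _ _ _ _ _ m01 _ _ (intZ _ _ (intL j)) (intZ _ _ (intxL j))).
transitivity (\int[mu]_(l in `]0%R, 1%R[) \sum_(j < k)
   ((C * (w j * (alpha * tnth x i + beta)))%:E * (L j l)%:E -
    (C * (w j * (alpha / a * (tnth x i - tnth (target j) i))))%:E * (l * L j l)%:E))%E.
  by apply: eq_integral => l _; rewrite /T -sumEFin.
rewrite integral_sum// mulr_sumr -sumEFin; apply: eq_bigr => j _.
rewrite (@integralB _ _ _ _ _ m01 _ _ (intZ _ _ (intL j)) (intZ _ _ (intxL j))).
rewrite (@integralZl _ _ _ _ _ m01 (EFin \o L j) (intL j)).
rewrite (@integralZl _ _ _ _ _ m01 (EFin \o (fun l => l * L j l)) (intxL j)).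
have -> : (\int[mu]_(l in `]0%R, 1%R[) (L j l)%:E = (laplace h (d%:R / 2) (t j))%:E)%E.
  by rewrite -(fineK (integrable_fin_num m01 (intL j))).
have -> : (\int[mu]_(l in `]0%R, 1%R[) (l * L j l)%:E = (laplace h (d%:R / 2 + 1) (t j))%:E)%E.
  by rewrite laplaceS -(fineK (integrable_fin_num m01 (intxL j))).
by rewrite -!EFinM -EFinB; congr EFin; rewrite -/(t j); ring.
Qed.

End affine_posterior.

End mixture_density.

(** * The excess risk *)

Section shrinkage_inequality.
Context {R : realFieldType} {k d : nat}.
Variables (alpha s : 'I_k -> R) (y : 'I_k -> 'I_d -> R) (c K : R).

Let n j := \sum_(i < d) y j i ^+ 2.

(** In the application alpha_j = w_j I_p(t_j) and s_j = I_(p+1)(t_j) / I_p(t_j), so n_j s_j is a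
    r(t_j). In the first alternative the left side is at most 0. In the second, both sides are
    double sums over j and l with the weights alpha_j alpha_l and are compared term by term. *)
Lemma shrinkage_inequality :
  (forall j, 0 <= alpha j) -> (forall j, 0 <= s j) ->
  (forall j l, n j <= n l -> s l <= s j) ->
  (forall j l, n j <= n l -> n j * s j <= n l * s l) ->
  0 <= K -> (forall j, 2 * (n j * s j - c) <= K * (n j * s j)) ->
  (forall j, n j * s j <= c) \/
  (forall j l, \sum_(i < d) (y j i - y l i) ^+ 2 <= (1 - K) * (n j + n l)) ->
  2 * (\sum_j alpha j) * (\sum_j alpha j * s j * (n j * s j - c)) <=
  \sum_(i < d) (\sum_j alpha j * s j * y j i) ^+ 2.
Proof.
move=> alpha0 s0 s_mono ns_mono K0 nsK [ns_le|dist_le].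
  apply: (@le_trans _ _ 0); last by apply: sumr_ge0 => i _; exact: sqr_ge0.
  apply: mulr_ge0_le0; first by rewrite mulr_ge0// sumr_ge0.
  by apply: sumr_le0 => j _; rewrite mulr_ge0_le0 ?mulr_ge0// subr_le0.
pose ip j l := \sum_(i < d) y j i * y l i.
have normE : \sum_(i < d) (\sum_j alpha j * s j * y j i) ^+ 2 =
    \sum_j \sum_l alpha j * alpha l * (s j * s l * ip j l).
  transitivity (\sum_(i < d) \sum_j \sum_l
      alpha j * alpha l * (s j * s l * (y j i * y l i))).
    apply: eq_bigr => i _; rewrite expr2 mulr_suml; apply: eq_bigr => j _.
    by rewrite mulr_sumr; apply: eq_bigr => l _; ring.
  rewrite exchange_big/=; apply: eq_bigr => j _.
  rewrite exchange_big/=; apply: eq_bigr => l _.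
  by rewrite /ip !mulr_sumr.
have sumE : 2 * (\sum_j alpha j) * (\sum_j alpha j * s j * (n j * s j - c)) =
    \sum_j \sum_l alpha j * alpha l * (s j * (n j * s j - c) + s l * (n l * s l - c)).
  pose v j := s j * (n j * s j - c).
  transitivity (\sum_j (\sum_l alpha j * alpha l * v j +
      \sum_l alpha j * alpha l * v l)); last first.
    apply: eq_bigr => j _; rewrite -big_split/=.
    by apply: eq_bigr => l _; rewrite -mulrDr.
  rewrite big_split/= [X in _ + X]exchange_big/=.
  have -> : \sum_l \sum_j alpha j * alpha l * v l = \sum_j \sum_l alpha j * alpha l * v j.
    by apply: eq_bigr => j _; apply: eq_bigr => l _; rewrite (mulrC (alpha l)).
  rewrite -mulr2n -[RHS]mulr_natl -mulrA; congr (_ * _).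
  rewrite mulrC mulr_suml; apply: eq_bigr => j _.
  by rewrite mulr_sumr; apply: eq_bigr => l _; rewrite /v; ring.
rewrite normE sumE; apply: ler_sum => j _; apply: ler_sum => l _.
apply: ler_wpM2l; first by rewrite mulr_ge0.
have n0 i : 0 <= n i by apply: sumr_ge0 => m _; exact: sqr_ge0.
have ipE : 2 * ip j l = n j + n l - \sum_(i < d) (y j i - y l i) ^+ 2.
  by rewrite /ip /n mulr_sumr -big_split/= -sumrB; apply: eq_bigr => i _; ring.
have H1 : K * (n j + n l) <= 2 * ip j l by rewrite ipE; have := dist_le j l; lra.
(* [s] and [n * s] are oppositely ordered. *)
have H2 : (n j * s j - n l * s l) * (s j - s l) <= 0.
  have [jl|/ltW lj] := leP (n j) (n l).
    by rewrite mulr_le0_ge0// ?subr_le0 ?ns_mono// subr_ge0 s_mono.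
  by rewrite mulr_ge0_le0// ?subr_ge0 ?ns_mono// subr_le0 s_mono.
(* With ip the inner product, twice the left term is at most K (n_j s_j^2 + n_l s_l^2) <= K s_j s_l
   (n_j + n_l) <= 2 s_j s_l ip; the middle inequality is [H2] expanded. *)
have H3 := ler_wpM2l (s0 j) (nsK j); have H4 := ler_wpM2l (s0 l) (nsK l).
have H5 := ler_wpM2l (mulr_ge0 (s0 j) (s0 l)) H1.
have H6 := mulr_ge0_le0 K0 H2.
move: H3 H4 H5 H6; set u := n j; set v := n l; set p := s j; set q := s l; set z := ip j l.
lra.
Qed.

End shrinkage_inequality.

Lemma sqnorm_tset {R : realType} d (x c : d.-tuple R) i u :
  sqnorm (tsub (tset x i u) c) =
  (u - tnth c i) ^+ 2 + \sum_(j < d | j != i) (tnth x j - tnth c j) ^+ 2.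
Proof.
rewrite /sqnorm (bigD1 i)//= !tnth_mktuple eqxx; congr (_ + _).
by apply: eq_bigr => j ji; rewrite !tnth_mktuple (negbTE ji).
Qed.

Lemma is_derive_bigsum {R : realType} n (f : 'I_n -> R -> R) (x : R) (df : 'I_n -> R) :
  (forall i, is_derive x 1 (f i) (df i)) ->
  is_derive x 1 (fun u => \sum_(i < n) f i u) (\sum_(i < n) df i).
Proof.
move=> Df; have := is_derive_sum Df.
by congr is_derive; apply/funext => u; rewrite fct_sumE.
Qed.

(** * The shrinkage field and its divergence *)

Section shrinkage_field.
Context {R : realType} {d k : nat}.
Local Notation mu := (@lebesgue_measure R).
Variable h : R -> R.
Hypothesis h_gt0 : forall x : R, 0 < x -> x < 1 -> 0 < h x.
Hypothesis h_int : mu.-integrable `]0, 1[ (EFin \o h).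
Variables (a : R) (w : 'I_k -> R) (target : 'I_k -> d.-tuple R).
Hypothesis a_gt0 : 0 < a.
Hypothesis w_gt0 : forall i : 'I_k, 0 < w i.
Hypothesis w_sum : \sum_(i < k) w i = 1.
Implicit Types (x theta : d.-tuple R) (i : 'I_d) (j : 'I_k).

Local Notation p := (d%:R / 2 : R).
Let p_ge0 : 0 <= p. Proof. by rewrite divr_ge0. Qed.
Let p1_ge0 : 0 <= p + 1. Proof. by rewrite addr_ge0. Qed.

Definition scaled_dist x j := sqnorm (tsub x (target j)) / a.

Definition mixture x := \sum_(j < k) w j * laplace h p (scaled_dist x j).

(** This is - a times the i-th partial derivative of [mixture], the marginal density up to a
    constant factor. *)
Definition mixture_grad i x := \sum_(j < k)
  w j * ((tnth x i - tnth (target j) i) * laplace h (p + 1) (scaled_dist x j)).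

(** The derivative of [mixture_grad i] in the same coordinate i: the divergence involves only the
    diagonal of the Hessian. *)
Definition mixture_hess i x := \sum_(j < k) w j * (laplace h (p + 1) (scaled_dist x j) -
  (tnth x i - tnth (target j) i) ^+ 2 / a * laplace h (p + 1 + 1) (scaled_dist x j)).

(** The i-th partial derivative of the logarithm of the marginal density, in accordance with the
    formula x + grad m / m for the posterior mean. *)
Definition shrinkage i x := - (a^-1 * (mixture_grad i x / mixture x)).

Definition shrinkage_diff i x := - (a^-1 * (mixture_hess i x / mixture x +
  a^-1 * (mixture_grad i x / mixture x) ^+ 2)).

Lemma mixture_gt0 x : 0 < mixture x.
Proof.
have [j0 _] : exists j : 'I_k, true.
  have /eqP : \sum_(i < k) w i != 0 by rewrite w_sum oner_neq0.
  case: k w => [|n] w'; first by rewrite big_ord0.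
  by exists ord0.
rewrite /mixture (bigD1 j0)//= ltr_wpDr ?mulr_gt0 ?laplace_gt0//.
by apply: sumr_ge0 => j _; rewrite mulr_ge0 ?ltW ?laplace_gt0.
Qed.

Lemma is_derive_laplace_coord q x j i (s : R) : 0 <= q ->
  is_derive s 1 (fun u => laplace h q (scaled_dist (tset x i u) j))
    (- ((s - tnth (target j) i) / a * laplace h (q + 1) (scaled_dist (tset x i s) j))).
Proof.
move=> q0; set c := target j.
pose C := \sum_(l < d | l != i) (tnth x l - tnth c l) ^+ 2.
pose t (u : R) : R := ((u - tnth c i) ^+ 2 + C) / a.
have tE u : scaled_dist (tset x i u) j = t u by rewrite /scaled_dist sqnorm_tset.
have Dt : is_derive s 1 t (2 * (s - tnth c i) / a).
  by apply: is_derive_eq; rewrite scaler0 subr0 /GRing.scale/=; ring.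
have DL := is_derive_laplace h_gt0 h_int (t s) q0.
have -> : (fun u => laplace h q (scaled_dist (tset x i u) j)) = laplace h q \o t.
  by apply/funext => u; rewrite tE.
rewrite tE; apply: (is_derive_eq (is_derive1_comp DL Dt)).
by set z := laplace _ _ _; field; rewrite gt_eqF.
Qed.

Lemma is_derive_mixture x i (s : R) :
  is_derive s 1 (fun u => mixture (tset x i u)) (- (a^-1 * mixture_grad i (tset x i s))).
Proof.
have D j : is_derive s 1 (fun u => w j * laplace h p (scaled_dist (tset x i u) j))
    (- (a^-1 * (w j * ((s - tnth (target j) i) *
       laplace h (p + 1) (scaled_dist (tset x i s) j))))).
  have D := is_derive_laplace_coord x j i s p_ge0.
  apply: is_derive_eq; rewrite /GRing.scale/= ?mulr0 ?addr0.
  by set z := laplace _ _ _; ring.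
apply: (is_derive_eq (is_derive_bigsum D)).
rewrite sumrN -mulr_sumr; congr (- (_ * _)); apply: eq_bigr => j _.
by rewrite tnth_mktuple eqxx.
Qed.

Lemma is_derive_mixture_grad x i (s : R) :
  is_derive s 1 (fun u => mixture_grad i (tset x i u)) (mixture_hess i (tset x i s)).
Proof.
have D j : is_derive s 1 (fun u => w j * ((u - tnth (target j) i) *
       laplace h (p + 1) (scaled_dist (tset x i u) j)))
    (w j * (laplace h (p + 1) (scaled_dist (tset x i s) j) -
     (s - tnth (target j) i) ^+ 2 / a * laplace h (p + 1 + 1) (scaled_dist (tset x i s) j))).
  have D := is_derive_laplace_coord x j i s p1_ge0.
  apply: is_derive_eq; rewrite /GRing.scale/= ?mulr0 ?addr0.
  by set z := laplace _ _ _; set z' := laplace _ _ _; ring.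
have := is_derive_bigsum D; congr is_derive; last first.
  by apply: eq_bigr => j _; rewrite tnth_mktuple eqxx.
by apply/funext => u; apply: eq_bigr => j _; rewrite tnth_mktuple eqxx.
Qed.

Lemma is_derive_shrinkage x i (s : R) :
  is_derive s 1 (fun u => shrinkage i (tset x i u)) (shrinkage_diff i (tset x i s)).
Proof.
have D1 := is_derive_mixture_grad x i s; have D2 := is_derive_mixture x i s.
have M0 : mixture (tset x i s) != 0 by rewrite gt_eqF ?mixture_gt0.
have D3 := is_deriveV M0 D2.
have := is_deriveN (is_deriveM (is_derive_cst a^-1 s 1) (is_deriveM D1 D3)).
move=> D; apply: (is_derive_eq D).
rewrite /shrinkage_diff /GRing.scale/=.
set N := mixture_grad _ _ in D1 D2 D3 D *; set M := mixture _ in M0 D1 D2 D3 D *.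
set Q := mixture_hess _ _.
by field; rewrite M0 gt_eqF.
Qed.

Lemma continuous_shrinkage_diff x i : continuous (fun u => shrinkage_diff i (tset x i u)).
Proof.
move=> s.
have cN := is_derive_continuous (is_derive_mixture_grad x i s).
have cM := is_derive_continuous (is_derive_mixture x i s).
have M0 : mixture (tset x i s) != 0 by rewrite gt_eqF ?mixture_gt0.
have cQ : {for s, continuous (fun u => mixture_hess i (tset x i u))}.
  pose q j u := w j * (laplace h (p + 1) (scaled_dist (tset x i u) j) -
    (u - tnth (target j) i) ^+ 2 / a * laplace h (p + 1 + 1) (scaled_dist (tset x i u) j)).
  have D j : is_derive s 1 (q j) ('D_1 (q j) s).
    have D1 := is_derive_laplace_coord x j i s p1_ge0.
    have D2 := is_derive_laplace_coord x j i s (addr_ge0 p1_ge0 ler01).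
    exact/derivableP/ex_derive.
  have -> : (fun u => mixture_hess i (tset x i u)) = (fun u => \sum_(j < k) q j u).
    by apply/funext => u; apply: eq_bigr => j _; rewrite /q tnth_mktuple eqxx.
  exact: is_derive_continuous (is_derive_bigsum D).
have cV := continuousV M0 cM.
have cNM := continuousM cN cV.
apply: (@continuousN _ _ _ (fun u => a^-1 * (mixture_hess i (tset x i u) / mixture (tset x i u) +
   a^-1 * (mixture_grad i (tset x i u) / mixture (tset x i u)) ^+ 2))).
apply: continuousM; first exact: cst_continuous.
apply: continuousD; first exact: continuousM cQ cV.
by apply: continuousM; [exact: cst_continuous|exact: (@continuousM _ _ _ _ _ cNM cNM)].
Qed.

Lemma measurable_laplace_dist q j : 0 <= q ->
  measurable_fun setT (fun x => laplace h q (scaled_dist x j)).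
Proof.
move=> q0; apply: (@measurableT_comp _ _ _ _ _ _ (laplace h q)).
  apply: continuous_measurable_fun => t.
  exact: is_derive_continuous (is_derive_laplace h_gt0 h_int t q0).
by apply: measurable_funM => //; exact: measurable_sqnorm_tsub.
Qed.

Lemma measurable_mixture : measurable_fun setT mixture.
Proof.
by apply: measurable_sum => j; apply: measurable_funM => //; exact: measurable_laplace_dist.
Qed.

Lemma measurable_mixture_grad i : measurable_fun setT (mixture_grad i).
Proof.
apply: measurable_sum => j; apply: measurable_funM => //; apply: measurable_funM.
  by apply: measurable_funB => //; exact: measurable_tnth.
exact: measurable_laplace_dist.
Qed.

Lemma measurable_mixture_hess i : measurable_fun setT (mixture_hess i).
Proof.
apply: measurable_sum => j; apply: measurable_funM => //; apply: measurable_funB.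
  exact: measurable_laplace_dist.
apply: measurable_funM; last by apply: measurable_laplace_dist; rewrite addr_ge0.
apply: measurable_funM => //; apply: measurable_funX.
by apply: measurable_funB => //; exact: measurable_tnth.
Qed.

Let measurable_mixtureV : measurable_fun setT (fun x => (mixture x)^-1).
Proof.
have -> : (fun x => (mixture x)^-1) = (fun x => mixture x `^ (- 1)).
  by apply/funext => x; rewrite powR_inv1// ltW// mixture_gt0.
exact: (measurableT_comp (measurable_powR _) measurable_mixture).
Qed.

Lemma measurable_shrinkage i : measurable_fun setT (shrinkage i).
Proof.
apply: measurableT_comp => //; apply: measurable_funM => //.
by apply: measurable_funM => //; exact: measurable_mixture_grad.
Qed.

Lemma measurable_shrinkage_diff i : measurable_fun setT (shrinkage_diff i).
Proof.
apply: measurableT_comp => //; apply: measurable_funM => //; apply: measurable_funD.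
  by apply: measurable_funM => //; exact: measurable_mixture_hess.
apply: measurable_funM => //; apply: measurable_funX.
by apply: measurable_funM => //; exact: measurable_mixture_grad.
Qed.

Section bounds.
Variable b : R.
Hypothesis b_ge0 : 0 <= b.
Hypothesis r_le : forall t, 0 <= t -> t * laplace h (p + 1) t <= b * laplace h p t.

Let dist_ge0 x j : 0 <= scaled_dist x j.
Proof. by rewrite /scaled_dist mulr_ge0 ?sqnorm_ge0// invr_ge0 ltW. Qed.

Let sqr_coord_le x i j : (tnth x i - tnth (target j) i) ^+ 2 / a <= scaled_dist x j.
Proof.
rewrite /scaled_dist ler_wpM2r ?invr_ge0 ?(ltW a_gt0)//.
rewrite /sqnorm (bigD1 i)//= tnth_mktuple lerDl.
by apply: sumr_ge0 => l _; exact: sqr_ge0.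
Qed.

Let norm_sum_le x (f : 'I_k -> R) c :
  (forall j, `|f j| <= c * laplace h p (scaled_dist x j)) ->
  `|(\sum_(j < k) w j * f j) / mixture x| <= c.
Proof.
move=> fc; rewrite normrM normfV (gtr0_norm (mixture_gt0 x)) ler_pdivrMr ?mixture_gt0//.
rewrite (le_trans (ler_norm_sum _ _ _))// /mixture mulr_sumr ler_sum// => j _.
by rewrite normrM (gtr0_norm (w_gt0 j)) mulrCA ler_wpM2l// ltW.
Qed.

(** With y a coordinate of x - theta_j, one has |y| <= 1 + y^2 <= 1 + a t, and [r_le] absorbs the
    factor t. *)
Lemma mixture_grad_le x i : `|mixture_grad i x / mixture x| <= 1 + a * b.
Proof.
apply: norm_sum_le => j; set t := scaled_dist x j; set y := tnth x i - _.
have B0 := laplace_gt0 h_gt0 h_int t p1_ge0.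
have BA := laplaceS_lt h_gt0 h_int t p_ge0.
have := r_le (dist_ge0 x j); have := sqr_coord_le x i j; rewrite -/t -/y => yt tB.
rewrite normrM (gtr0_norm B0).
have y1 := norm_le1Dsqr y.
have y2 : y ^+ 2 <= a * t by rewrite mulrC -ler_pdivrMr.
apply: (@le_trans _ _ ((1 + a * t) * laplace h (p + 1) t)).
  by rewrite ler_wpM2r ?(ltW B0)// (le_trans y1)// lerD2l.
have := ler_wpM2l (ltW a_gt0) tB; move: BA.
by set A' := laplace h p t; set B := laplace h (p + 1) t => ? ?; lra.
Qed.

(** The growing coefficient is at most t, and t I_(p+2) <= t I_(p+1) <= b I_p. *)
Lemma mixture_hess_le x i : `|mixture_hess i x / mixture x| <= 1 + b.
Proof.
apply: norm_sum_le => j; set t := scaled_dist x j; set y := tnth x i - _.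
have B0 := laplace_gt0 h_gt0 h_int t p1_ge0.
have C0 := laplace_gt0 h_gt0 h_int t (addr_ge0 p1_ge0 ler01).
have BA := laplaceS_lt h_gt0 h_int t p_ge0.
have CB := laplaceS_lt h_gt0 h_int t p1_ge0.
have t0 : 0 <= t := dist_ge0 x j.
have := r_le t0; have := sqr_coord_le x i j; rewrite -/t -/y => yt tB.
have y0 : 0 <= y ^+ 2 / a by rewrite mulr_ge0 ?sqr_ge0// invr_ge0 ltW.
rewrite (le_trans (ler_normB _ _))// (gtr0_norm B0) (ger0_norm (mulr_ge0 y0 (ltW C0))).
have H1 := ler_pM y0 (ltW C0) yt (ltW CB).
rewrite mulrDl mul1r; apply: lerD; first exact: ltW.
exact: le_trans H1 tB.
Qed.

Lemma shrinkage_bounded : exists K, forall x i, `|shrinkage i x| <= K /\ `|shrinkage_diff i x| <= K.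
Proof.
have ai0 : 0 <= a^-1 by rewrite invr_ge0 ltW.
have ab0 : 0 <= 1 + a * b by rewrite addr_ge0// mulr_ge0// ltW.
pose K1 := a^-1 * (1 + a * b); pose K2 := a^-1 * (1 + b + a^-1 * (1 + a * b) ^+ 2).
have K10 : 0 <= K1 by exact: mulr_ge0.
have K20 : 0 <= K2.
  rewrite mulr_ge0// addr_ge0//; first by rewrite addr_ge0.
  by rewrite mulr_ge0// sqr_ge0.
exists (K1 + K2) => x i; split.
  rewrite /shrinkage normrN normrM (ger0_norm ai0) -[leLHS]addr0 lerD//.
  by rewrite ler_wpM2l// mixture_grad_le.
rewrite /shrinkage_diff normrN normrM (ger0_norm ai0) -[leLHS]add0r lerD//.
rewrite ler_wpM2l// (le_trans (ler_normD _ _))// lerD ?mixture_hess_le//.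
rewrite normrM (ger0_norm ai0) ler_wpM2l// normrX lerXn2r ?nnegrE//.
exact: mixture_grad_le.
Qed.

End bounds.

(* With [x + shrinkage] as the estimator, this is Stein's condition
   [2 div g + |g|^2 <= 0] for the unbiased estimate of the excess risk. *)
Lemma shrinkage_div_le0 x (c := d%:R - 2 : R) :
  let t j := scaled_dist x j in
  let s j := laplace h (p + 1) (t j) / laplace h p (t j) in
  let y j i := tnth x i - tnth (target j) i in
  (forall u, 0 <= u -> u * laplace h (p + 1 + 1) u * laplace h p u <=
    2 * laplace h (p + 1) u * laplace h p u + u * laplace h (p + 1) u ^+ 2) ->
  2 * (\sum_j w j * laplace h p (t j)) *
    (\sum_j w j * laplace h p (t j) * s j *
      ((\sum_(i < d) y j i ^+ 2) * s j - a * c)) <=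
    \sum_(i < d) (\sum_j w j * laplace h p (t j) * s j * y j i) ^+ 2 ->
  \sum_(i < d) (2 * shrinkage_diff i x + shrinkage i x ^+ 2) <= 0.
Proof.
move=> t s y r_derive key.
have M0 := mixture_gt0 x; set M := mixture x in M0 *.
have A0 j : 0 < laplace h p (t j) by exact: laplace_gt0.
have sA j : laplace h p (t j) * s j = laplace h (p + 1) (t j).
  by rewrite mulrC divfK// gt_eqF.
have tE j : \sum_(i < d) y j i ^+ 2 = a * t j.
  rewrite /t /scaled_dist mulrC divfK ?gt_eqF//.
  by apply: eq_bigr => i _; rewrite tnth_mktuple.
have t0 j : 0 <= t j by rewrite mulr_ge0 ?sqnorm_ge0// invr_ge0 ltW.
have hessE : \sum_(i < d) mixture_hess i x = \sum_j w j *
    (d%:R * laplace h (p + 1) (t j) - t j * laplace h (p + 1 + 1) (t j)).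
  rewrite exchange_big/=; apply: eq_bigr => j _; rewrite -mulr_sumr; congr (_ * _).
  rewrite sumrB sumr_const card_ord; congr (_ - _); first by rewrite [RHS]mulr_natl.
  rewrite -mulr_suml; congr (_ * _); rewrite -mulr_suml /t /scaled_dist; congr (_ / _).
  by apply: eq_bigr => i _; rewrite tnth_mktuple.
(* The inequality r' >= 0 eliminates I_(p+2): it gives d I_(p+1) - t I_(p+2) >= - I_(p+1) (t s - c),
   where c = d - 2. *)
have hess_ge : - \sum_j w j * laplace h p (t j) * s j * (t j * s j - c) <=
    \sum_(i < d) mixture_hess i x.
  rewrite hessE -sumrN; apply: ler_sum => j _.
  rewrite -2!mulrA -mulrN ler_wpM2l ?(ltW (w_gt0 j))//.
  rewrite mulrA sA mulrBr -(ler_pM2r (A0 j)).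
  have := r_derive _ (t0 j); have sA' := sA j; move: sA' (A0 j).
  rewrite -sA /c; set A' := laplace h p (t j); set C := laplace h (p + 1 + 1) (t j).
  move: (t j) (s j) => u v _ _; nra.
have gradE : \sum_(i < d) mixture_grad i x ^+ 2 =
    \sum_(i < d) (\sum_j w j * laplace h p (t j) * s j * y j i) ^+ 2.
  apply: eq_bigr => i _; congr (_ ^+ 2); apply: eq_bigr => j _.
  by rewrite -(mulrA (w j)) sA -mulrA; congr (_ * _); rewrite mulrC.
have {key} : 2 * M * (a * \sum_j w j * laplace h p (t j) * s j * (t j * s j - c)) <=
    \sum_(i < d) mixture_grad i x ^+ 2.
  rewrite gradE; apply: le_trans key; rewrite le_eqVlt; apply/orP; left; apply/eqP.
  congr (_ * _); rewrite mulr_sumr; apply: eq_bigr => j _.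
  by rewrite tE; ring.
move: hess_ge; set S := \sum_j _; set Q := \sum_(i < d) _; set N := \sum_(i < d) _ => SQ SN.
have ME : mixture x = M by [].
clearbody M.
(* The squared gradient enters 2 div g with coefficient - 2 and |g|^2 with coefficient 1, so N
   remains with one sign. The bounds Q >= - S and N >= 2 a M S then make the last factor
   nonnegative. *)
have -> : \sum_(i < d) (2 * shrinkage_diff i x + shrinkage i x ^+ 2) =
    - (a ^- 2 * M ^- 2) * (2 * a * M * Q + N).
  rewrite /Q /N mulrDr !mulr_sumr -big_split/=; apply: eq_bigr => i _.
  by rewrite /shrinkage_diff /shrinkage ME; field; rewrite !gt_eqF.
rewrite mulNr oppr_le0 mulr_ge0//.
  by rewrite mulr_ge0// invr_ge0 sqr_ge0.
have := ler_wpM2l (mulr_ge0 (ltW a_gt0) (ltW M0)) SQ; lra.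
Qed.

End shrinkage_field.

(** * Risk of x + g through Stein's identity *)

Section stein_risk.
Context {R : realType} {d : nat}.
Local Notation mu := (@lebesgue_measure R).
Variables (delta : d.-tuple R -> d.-tuple R) (g g' : 'I_d -> d.-tuple R -> R) (K : R).
Hypothesis measurable_g : forall i, measurable_fun setT (g i).
Hypothesis measurable_g' : forall i, measurable_fun setT (g' i).
Hypothesis delta_g : forall x i, tnth (delta x) i = tnth x i + g i x.
Hypothesis is_derive_g : forall i (x : d.-tuple R) (s : R),
  is_derive s 1 (fun u => g i (tset x i u)) (g' i (tset x i s)).
Hypothesis continuous_g' : forall i (x : d.-tuple R), continuous (fun u => g' i (tset x i u)).
Hypothesis g_le : forall i x, `|g i x| <= K.
Hypothesis g'_le : forall i x, `|g' i x| <= K.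

Lemma measurable_shift : measurable_fun setT delta.
Proof.
apply/measurable_fun_tnthP => i.
rewrite (_ : _ \o _ = fun x => tnth x i + g i x); last by apply/funext => x; exact: delta_g.
by apply: measurable_funD => //; exact: measurable_tnth.
Qed.

(** Expand |x + g - theta|^2. The terms [s i] have mean 0 by Stein's identity, so d is the integral
    of the sum of q + 2 s; this sum minus the loss times the density is - (2 div g + |g|^2) times
    the density. *)
Lemma risk_le_dim theta :
  (forall x, \sum_(i < d) (2 * g' i x + g i x ^+ 2) <= 0) ->
  (risk theta delta <= d%:R%:E)%E.
Proof.
move=> div_le0.
pose q i x := (tnth x i - tnth theta i) ^+ 2 * gauss_pdf theta 1 x.
pose s i x := ((tnth x i - tnth theta i) * g i x - g' i x) * gauss_pdf theta 1 x.
have mq1 i : measurable_fun setT (fun y : R => (y - tnth theta i) ^+ 2).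
  by apply: measurable_funX; exact: measurable_funB.
have int1 i : mu.-integrable setT (EFin \o (fun y =>
    (y - tnth theta i) ^+ 2 * normal_pdf (tnth theta i) (Num.sqrt 1) y)).
  apply: (@integrable_normal_quadratic _ _ _ _ 1) => //.
  by move=> y; rewrite mul1r ger0_norm ?sqr_ge0// lerDr.
have intq i : (lebesgue_tuple R d).-integrable setT (EFin \o q i).
  exact: (integrable_gauss_coord (mq1 i) (int1 i)).
have Iq i : (\int[lebesgue_tuple R d]_x (q i x)%:E = 1)%E.
  rewrite (integral_gauss_coord (mq1 i) (int1 i)) normal_variance ?sqrtr1//.
  by rewrite expr1n.
have ints i : (lebesgue_tuple R d).-integrable setT (EFin \o s i).
  exact: integrable_gauss_stein.
have Is i : (\int[lebesgue_tuple R d]_x (s i x)%:E = 0)%E.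
  exact: gauss_stein.
have int2s i : (lebesgue_tuple R d).-integrable setT (fun x => 2%:E * (s i x)%:E)%E.
  exact: (@integrableZl _ _ _ _ _ measurableT 2 (EFin \o s i) (ints i)).
have intqs i : (lebesgue_tuple R d).-integrable setT (fun x => (q i x)%:E + 2%:E * (s i x)%:E)%E.
  exact: (@integrableD _ _ _ _ _ measurableT _ _ (intq i) (int2s i)).
have -> : (d%:R%:E = \int[lebesgue_tuple R d]_x
    \sum_(i < d) ((q i x)%:E + 2%:E * (s i x)%:E))%E.
  rewrite integral_sum// (eq_bigr (fun=> 1%E)) => [|i _].
    by rewrite sumEFin sumr_const card_ord.
  rewrite (@integralD _ _ _ _ _ measurableT _ _ (intq i) (int2s i)).
  rewrite (@integralZl _ _ _ _ _ measurableT (EFin \o s i) (ints i)).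
  by rewrite Is mule0 adde0 Iq.
have le1 x : sqnorm (tsub (delta x) theta) * gauss_pdf theta 1 x <=
    \sum_(i < d) (q i x + 2 * s i x).
  have -> : \sum_(i < d) (q i x + 2 * s i x) = (sqnorm (tsub (delta x) theta) -
      \sum_(i < d) (2 * g' i x + g i x ^+ 2)) * gauss_pdf theta 1 x.
    rewrite /sqnorm -sumrB mulr_suml; apply: eq_bigr => i _.
    by rewrite tnth_mktuple delta_g /q /s; ring.
  by rewrite ler_wpM2r ?gauss_pdf_ge0// lerBrDr gerDl.
rewrite /risk; apply: ge0_le_integral => //.
- by move=> x _; rewrite lee_fin mulr_ge0 ?sqnorm_ge0 ?gauss_pdf_ge0.
- apply/measurable_EFinP/measurable_funM; last exact: measurable_gauss_pdf.
  by apply: measurable_sqnorm_tsub => //; exact: measurable_shift.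
- by apply: emeasurable_sum => i; exact: measurable_int (intqs i).
- by move=> x _; rewrite sumEFin lee_fin; exact: le1.
Qed.

End stein_risk.

Section bayes_shrinkage.
Context {R : realType} {d k : nat}.
Local Notation mu := (@lebesgue_measure R).
Variable h : R -> R.
Hypothesis h_gt0 : forall x : R, 0 < x -> x < 1 -> 0 < h x.
Hypothesis h_int : mu.-integrable `]0, 1[ (EFin \o h).
Variables (a : R) (w : 'I_k -> R) (target : 'I_k -> d.-tuple R).
Hypothesis a_ge1 : 1 <= a.
Hypothesis w_gt0 : forall i : 'I_k, 0 < w i.
Hypothesis w_sum : \sum_(i < k) w i = 1.

Lemma bayes_prior_multi x i :
  tnth (bayes (prior_multi h a w target) x) i = tnth x i + shrinkage h a w target i x.
Proof.
have a0 : 0 < a := lt_le_trans ltr01 a_ge1.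
have M0 := mixture_gt0 h_gt0 h_int a target w_gt0 w_sum x.
set C := (Num.sqrt (2 * pi * a))^-1 ^+ d.
have C0 : 0 < C.
  by rewrite exprn_gt0// invr_gt0 sqrtr_gt0 !mulr_gt0// pi_gt0.
have E := affine_posterior_integral h_gt0 h_int target a_ge1 w_gt0 x i.
have E1 : (\int[lebesgue_tuple R d]_theta
    ((tnth theta i * gauss_pdf theta 1 x)%:E * prior_multi h a w target theta))%E =
    (C * (tnth x i * mixture h a w target x - a^-1 * mixture_grad h a w target i x))%:E.
  transitivity (\int[lebesgue_tuple R d]_theta
    (((1 * tnth theta i + 0) * gauss_pdf theta 1 x)%:E * prior_multi h a w target theta))%E.
    by apply: eq_integral => theta _; rewrite mul1r addr0.
  rewrite E; congr (_ * _)%:E.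
  rewrite /mixture /mixture_grad !mulr_sumr -sumrB; apply: eq_bigr => j _.
  by rewrite /scaled_dist; set L := laplace _ _ _; set L' := laplace _ _ _; ring.
have E0 : marginal (prior_multi h a w target) x = (C * mixture h a w target x)%:E.
  transitivity (\int[lebesgue_tuple R d]_theta
    (((0 * tnth theta i + 1) * gauss_pdf theta 1 x)%:E * prior_multi h a w target theta))%E.
    by apply: eq_integral => theta _; rewrite mul0r add0r mul1r.
  rewrite E; congr (_ * _)%:E.
  rewrite /mixture; apply: eq_bigr => j _.
  by rewrite /scaled_dist; set L := laplace _ _ _; set L' := laplace _ _ _; ring.
rewrite tnth_mktuple E1 E0 /= /shrinkage.
set M := mixture _ _ _ _ _ in M0 *; set N := mixture_grad _ _ _ _ _ _.
by field; rewrite !gt_eqF.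
Qed.

End bayes_shrinkage.

(** * The critical value t^* of r *)

Section critical_point.
Context {R : realType} {d : nat}.
Local Notation mu := (@lebesgue_measure R).
Variable h : R -> R.
Hypothesis h_gt0 : forall x : R, 0 < x -> x < 1 -> 0 < h x.
Hypothesis h_int : mu.-integrable `]0, 1[ (EFin \o h).
Hypothesis h_ratio : forall c x y : R,
  0 < c -> c < 1 -> 0 < x -> x <= y -> y < 1 -> h (c * x) * h y <= h (c * y) * h x.
Hypothesis d_gt2 : 2 < d%:R :> R.
Local Notation p := (d%:R / 2 : R).
Let p_ge0 : 0 <= p. Proof. by rewrite divr_ge0. Qed.

Lemma r_hE t : r_h d h t = t * laplace h (p + 1) t / laplace h p t.
Proof.
have c0 : 0 < (2 * pi : R) `^ (- p) by rewrite powR_gt0// mulr_gt0// pi_gt0.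
have L0 := laplace_gt0 h_gt0 h_int t p_ge0.
have DL := is_derive_laplace h_gt0 h_int t p_ge0.
have Df : is_derive t 1 (f_h d h) ((2 * pi) `^ (- p) * (- (laplace h (p + 1) t / 2))).
  have D : is_derive t 1 (fun u => (2 * pi) `^ (- p) * laplace h p u)
      ((2 * pi) `^ (- p) * (- (laplace h (p + 1) t / 2))).
    by apply: is_derive_eq; rewrite ?scaler0 ?addr0.
  exact: D.
rewrite /r_h (is_derive_derive1 Df) /f_h -/(laplace h p t).
move: c0 L0; set c := _ `^ _; set L := laplace h p t; set L' := laplace _ _ _ => c0 L0.
by field; rewrite !gt_eqF.
Qed.

Let critical_set := [set t : R | 0 < t /\ r_h d h t <= d%:R - 2].

Let critical_set_ub t : 0 < t -> d%:R - 2 < r_h d h t -> ubound critical_set t.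
Proof.
move=> t0 rt s [s0 rs]; rewrite leNgt; apply/negP => ts.
have := laplace_r_nondecreasing h_gt0 h_int h_ratio p_ge0 t0 (ltW ts).
by rewrite -!r_hE leNgt => /negP; apply; exact: le_lt_trans rs rt.
Qed.

Let has_sup_critical_set : has_sup critical_set.
Proof.
split.
  (* The point d - 2 belongs to the set, since I_(p+1) < I_p gives r(t) < t for positive t. *)
  exists (d%:R - 2); split; first by rewrite subr_gt0.
  rewrite r_hE ler_pdivrMr ?laplace_gt0// ler_wpM2l ?subr_ge0 ?(ltW d_gt2)//.
  exact/ltW/laplaceS_lt.
(* A point with r > d - 2 bounds the set from above by monotonicity of r; for an unbounded set [sup]
   would be 0. *)
have p1 : 1 < p by rewrite ltr_pdivlMr// mul1r.
have /existsNP[t] := @laplace_r_unbounded _ _ h_gt0 h_int p p1.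
move=> /not_implyP[t0 /negP]; rewrite -ltNge => rt.
exists t; apply: critical_set_ub => //.
by rewrite r_hE ltr_pdivlMr ?laplace_gt0//; congr (_ < _): rt; congr (_ * _); field.
Qed.

Lemma tstar_gt0 : 0 < tstar d h.
Proof.
have [s [s0 rs]] := has_sup_critical_set.1; apply: (lt_le_trans s0).
exact: (sup_upper_bound has_sup_critical_set).
Qed.

Lemma tstar_le t : 0 < t -> d%:R - 2 < r_h d h t -> tstar d h <= t.
Proof.
move=> t0 rt; apply: ge_sup; first exact: has_sup_critical_set.1.
exact: critical_set_ub.
Qed.

End critical_point.

Lemma sqdiam_ge {R : realType} d k (target : 'I_k -> d.-tuple R) i j :
  sqnorm (tsub (target i) (target j)) <= sqdiam target.
Proof.
have [->|ij] := eqVneq i j.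
  rewrite (_ : sqnorm _ = 0) ?bigmax_ge_id//.
  by rewrite /sqnorm big1// => l _; rewrite tnth_mktuple subrr expr0n.
exact: (@le_bigmax_cond _ R _ 0 (i, j) (fun q => q.1 != q.2)
  (fun q => sqnorm (tsub (target q.1) (target q.2)))).
Qed.

(** The squared triangle inequality with a weight e, with equality when u - v = e v. For e = rho
    this is the case |v| = sqrt D / rho, |u - v| = sqrt D, so nothing is lost when it is used to
    bound |v| from below. *)
Lemma sqr_sum_young {R : realFieldType} d (u v : 'I_d -> R) (e : R) : 0 < e ->
  \sum_(i < d) u i ^+ 2 <=
  (1 + e) * \sum_(i < d) v i ^+ 2 + (1 + e^-1) * \sum_(i < d) (u i - v i) ^+ 2.
Proof.
move=> e0; rewrite !mulr_sumr -big_split/=; apply: ler_sum => i _.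
set x := u i; set y := v i; have H := sqr_ge0 (e * y - (x - y)).
have -> : (1 + e) * y ^+ 2 + (1 + e^-1) * (x - y) ^+ 2 =
    x ^+ 2 + e^-1 * (e * y - (x - y)) ^+ 2 by field; rewrite gt_eqF.
by rewrite lerDl mulr_ge0// invr_ge0 ltW.
Qed.

Lemma tsub_targetE {R : realType} d (x c c' : d.-tuple R) :
  \sum_(i < d) (tnth x i - tnth c i - (tnth x i - tnth c' i)) ^+ 2 = sqnorm (tsub c' c).
Proof. by apply: eq_bigr => i _; rewrite tnth_mktuple; congr (_ ^+ 2); ring. Qed.

(** * From the bounds on rho and a to the pairwise inequality *)

Section close_targets.
Context {R : realFieldType} {k d : nat}.
Variables (t A B w : 'I_k -> R) (y : 'I_k -> 'I_d -> R) (a b c rho D ts : R).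
Hypotheses (a_gt0 : 0 < a) (w_gt0 : forall j, 0 < w j).
Hypotheses (A_gt0 : forall j, 0 < A j) (B_gt0 : forall j, 0 < B j).
Hypotheses (t_ge0 : forall j, 0 <= t j) (yE : forall j, \sum_(i < d) y j i ^+ 2 = a * t j).
Hypothesis mean_nonincreasing : forall j l, t j <= t l -> B l * A j <= B j * A l.
Hypothesis r_nondecreasing : forall j l, 0 < t j -> t j <= t l ->
  t j * B j / A j <= t l * B l / A l.
Hypothesis r_le : forall j, t j * B j <= b * A j.
Hypotheses (c_gt0 : 0 < c) (rho_gt0 : 0 < rho) (rho_lt1 : rho < 1).
Hypothesis rho_le : rho * (2 * b - 2 * c) <= 2 * c - b.
Hypotheses (ts_gt0 : 0 < ts) (ts_le : forall j, 0 < t j -> c < t j * B j / A j -> ts <= t j).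
Hypothesis D_ge : forall j l, \sum_(i < d) (y j i - y l i) ^+ 2 <= D.
Hypothesis a_ge : D / ts * (1 + rho^-1) ^+ 2 <= a.

(** With this K, 2 (r - c) <= K r reads (1 + 2 rho) r <= 2 (1 + rho) c; its left side increases in
    r, and at r = b it is exactly [rho_le]. *)
Let K := (1 + rho)^-1.
Let rho1 : 0 < 1 + rho. Proof. by rewrite addr_gt0. Qed.
Let K_ge0 : 0 <= K. Proof. by rewrite invr_ge0 ltW. Qed.

Let r_excess_le r : r <= b -> 2 * (r - c) <= K * r.
Proof.
move=> rb; rewrite -(ler_pM2l rho1) (mulVKf (lt0r_neq0 rho1)).
have := ler_wpM2r (ltW rho_gt0) rb; have := ler_wpM2r (ltW rho_gt0) (ltW rho_lt1).
move: rho_le; lra.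
Qed.

(* One target at squared distance at least [D (1 + 1 / rho) ^ 2] from [x] forces
   all of them to be at squared distance at least [D / rho ^ 2]. *)
Let far_targets j : ts <= t j -> forall l, D / rho ^+ 2 <= \sum_(i < d) y l i ^+ 2.
Proof.
move=> tsj l; have nj : D * (1 + rho^-1) ^+ 2 <= a * t j.
  apply: le_trans (ler_wpM2l (ltW a_gt0) tsj).
  by rewrite -ler_pdivrMr// mulrAC.
have := D_ge j l; have := sqr_sum_young (y j) (y l) rho_gt0; rewrite yE.
move: nj; set n := a * t j; set n' := \sum_(i < d) _; set q := \sum_(i < d) _.
move=> nj nle qD.
have ri0 : 0 < 1 + rho^-1 by rewrite addr_gt0// invr_gt0.
have H : D * (1 + rho^-1) ^+ 2 <= (1 + rho) * n' + (1 + rho^-1) * D.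
  by apply: (le_trans nj); apply: (le_trans nle); rewrite lerD2l ler_wpM2l// ltW.
rewrite -(ler_pM2l rho1).
suff -> : (1 + rho) * (D / rho ^+ 2) = D * (1 + rho^-1) ^+ 2 - (1 + rho^-1) * D.
  by rewrite lerBlDr.
by field; rewrite gt_eqF.
Qed.

Lemma close_targets_shrinkage :
  2 * (\sum_j w j * A j) *
    (\sum_j w j * A j * (B j / A j) * ((\sum_(i < d) y j i ^+ 2) * (B j / A j) - a * c)) <=
  \sum_(i < d) (\sum_j w j * A j * (B j / A j) * y j i) ^+ 2.
Proof.
apply: (@shrinkage_inequality _ _ _ (fun j => w j * A j) (fun j => B j / A j) y (a * c) K).
- by move=> j; rewrite mulr_ge0// ltW.
- by move=> j; rewrite divr_ge0// ltW.
- move=> j l; rewrite !yE ler_pM2l// => jl.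
  by rewrite ler_pdivrMr// mulrAC ler_pdivlMr// mean_nonincreasing.
- move=> j l; rewrite !yE ler_pM2l// => jl; rewrite -!mulrA ler_pM2l// !mulrA.
  (* [r_nondecreasing] concerns positive arguments; at t_j = 0 the left side is 0. *)
  have [tj|tj] := eqVneq (t j) 0.
    by rewrite tj !mul0r !mulr_ge0// ?invr_ge0 ltW.
  by apply: r_nondecreasing => //; rewrite lt_neqAle eq_sym tj t_ge0.
- exact: K_ge0.
- move=> j; rewrite !yE.
  have rb : t j * B j / A j <= b by rewrite ler_pdivrMr// r_le.
  have := ler_wpM2l (ltW a_gt0) (r_excess_le rb); rewrite -!mulrA.
  by set r := _ / _; set u := t j => ?; lra.
have [r_small|/existsNP[j /negP]] := pselect (forall j, t j * (B j / A j) <= c).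
  by left=> j; rewrite yE -mulrA ler_pM2l.
rewrite -ltNge => rj; right=> l m.
have tj : 0 < t j.
  rewrite lt_neqAle t_ge0 andbT; apply/eqP => tj.
  by move: rj; rewrite -tj mul0r ltNge (ltW c_gt0).
have far := far_targets (ts_le tj _); rewrite -mulrA in far; move/(_ rj) in far.
have D0 : 0 <= D by apply: le_trans (D_ge j j); apply: sumr_ge0 => i _; exact: sqr_ge0.
apply: (le_trans (D_ge l m)).
have H := lerD (far l) (far m).
have K1 : 0 <= 1 - K by rewrite subr_ge0 invf_le1// lerDl ltW.
apply: le_trans (ler_wpM2l K1 H).
(* Since 1 - K = rho / (1 + rho), the two squared distances D / rho^2 give 2 D / (rho (1 + rho)),
   which is at least D because rho < 1. *)
rewrite (_ : (1 - K) * _ = D * (2 / (rho * (1 + rho)))); last first.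
  by rewrite /K; field; rewrite !gt_eqF.
rewrite ler_peMr// ler_pdivlMr ?mulr_gt0// mul1r mulrDr mulr1.
by apply: lerD; rewrite ?mulr_ile1// ltW.
Qed.

End close_targets.

Theorem theorem4 (R : realType) (d : nat)
    (A : R) (h : R -> R) (h1 b rho a : R)
    (k : nat) (target : 'I_k -> d.-tuple R) (w : 'I_k -> R)
    (h_gt0 : forall lambda : R, 0 < lambda -> lambda < 1 -> 0 < h lambda)
    (h_int : lebesgue_measure.-integrable `]0, 1[ (EFin \o h))
    (h_ac : loc_abs_continuous01 h)
    (ell_nd : ae_nondecreasing `]0, 1[ (ell h))
    (ell_ge : {ae lebesgue_measure, forall lambda : R,
       0 < lambda -> lambda < 1 -> A <= ell h lambda})
    (ell_int : (\int[lebesgue_measure]_(lambda in `]0%R, 1%R[)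
       (lambda `^ (d%:R / 2) * h lambda * `|ell h lambda|)%:E < +oo)%E)
    (h_lim0 : lambda `^ (d%:R / 2 + 1) * h lambda @[lambda --> 0^'+] --> 0)
    (h_lim1 : h lambda @[lambda --> 1^'-] --> h1)
    (b_ge : d%:R + 2 - 2 * A <= b)
    (b_gt : d%:R - 2 < b)
    (b_lt : b < 2 * (d%:R - 2))
    (target_inj : injective target)
    (w_gt0 : forall i : 'I_k, 0 < w i)
    (w_sum : \sum_(i < k) w i = 1)
    (rho_gt0 : 0 < rho)
    (rho_lt1 : rho < 1)
    (rho_le : rho <= (2 * (d%:R - 2) - b) / (2 * b - 2 * (d%:R - 2)))
    (a_ge : Num.max 1 (sqdiam target / tstar d h * (1 + rho^-1) ^+ 2) <= a) :
  minimax (bayes (prior_multi h a w target)).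
Proof.
have d_gt2 : 2 < d%:R :> R by lra.
have b_gt0 : 0 < b by lra.
have [a_ge1 aD] : 1 <= a /\ sqdiam target / tstar d h * (1 + rho^-1) ^+ 2 <= a.
  by move: a_ge; rewrite ge_max => /andP.
have a0 : 0 < a by exact: lt_le_trans a_ge1.
have p0 : 0 <= d%:R / 2 :> R by rewrite divr_ge0.
set p := d%:R / 2 in p0.
have p10 : 0 <= p + 1 by rewrite addr_ge0.
have h_ratio c x y := @mixing_ratio_nondecreasing _ _ h_gt0 h_ac c x y ell_nd.
(* The exponent for which the gamma bound on r is exactly b; [b_ge] says that A0 <= A, and b > 0
   makes p + 1 - A0 positive. *)
pose A0 := (d%:R + 2 - b) / 2.
have ell_ge0 : {ae lebesgue_measure, forall z : R, 0 < z -> z < 1 -> A0 <= ell h z}.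
  have aeF := ae_filter_ringOfSetsType (@lebesgue_measure R).
  apply: filterS ell_ge => z Hz z0 z1; apply: le_trans (Hz z0 z1).
  by rewrite /A0; lra.
have h_pow x y := @mixing_powR_nonincreasing _ _ h_gt0 h_ac A0 x y ell_ge0.
have bE : 2 * (p + 1 - A0) = b by rewrite /p /A0; field.
have r_le t : 0 <= t -> t * laplace h (p + 1) t <= b * laplace h p t.
  move=> t0; rewrite -bE; apply: (laplace_r_le h_gt0 h_int p0 t0) => //.
  by rewrite -(@pmulr_rgt0 _ 2)// bE.
have L0 t : 0 < laplace h p t by exact: laplace_gt0.
have LS0 t : 0 < laplace h (p + 1) t by exact: laplace_gt0.
have ts0 : 0 < tstar d h by exact: tstar_gt0.
have rho_le' : rho * (2 * b - 2 * (d%:R - 2)) <= 2 * (d%:R - 2) - b.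
  by rewrite -ler_pdivlMr//; lra.
have div_le0 x :
    \sum_(i < d) (2 * shrinkage_diff h a w target i x + shrinkage h a w target i x ^+ 2) <= 0.
  apply: (shrinkage_div_le0 h_gt0 h_int a0 w_gt0 w_sum).
    by move=> u u0; exact: laplace_r_derive_ge0.
  pose t j := scaled_dist a target x j.
  have t0 j : 0 <= t j by rewrite mulr_ge0 ?sqnorm_ge0// invr_ge0 ltW.
  have c_gt0 : 0 < d%:R - 2 :> R by rewrite subr_gt0.
  apply: (@close_targets_shrinkage _ _ _ t (fun j => laplace h p (t j))
    (fun j => laplace h (p + 1) (t j)) w _ a b _ rho (sqdiam target) (tstar d h)
    a0 w_gt0 (fun j => L0 _) (fun j => LS0 _) t0 _ _ _ (fun j => r_le _ (t0 j))
    c_gt0 rho_gt0 rho_lt1 rho_le' ts0).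
  - move=> j; rewrite /t /scaled_dist mulrC divfK ?gt_eqF//.
    by apply: eq_bigr => i _; rewrite tnth_mktuple.
  - by move=> j l; exact: laplace_mean_nonincreasing.
  - by move=> j l; exact: laplace_r_nondecreasing.
  - move=> j tj rj; apply: (tstar_le h_gt0 h_int h_ratio d_gt2 tj).
    by rewrite (r_hE h_gt0 h_int).
  - by move=> j l; rewrite tsub_targetE; exact: sqdiam_ge.
  - exact: aD.
have r_le' : forall u, 0 <= u -> u * laplace h (d%:R / 2 + 1) u <= b * laplace h (d%:R / 2) u.
  exact: r_le.
have [B HB] := shrinkage_bounded h_gt0 h_int target a0 w_gt0 w_sum (ltW b_gt0) r_le'.
have g_le i x := (HB x i).1; have g'_le i x := (HB x i).2.
have bayesE := bayes_prior_multi h_gt0 h_int target a_ge1 w_gt0 w_sum.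
have mg := measurable_shrinkage h_gt0 h_int a target w_gt0 w_sum.
have mg' := measurable_shrinkage_diff h_gt0 h_int a target w_gt0 w_sum.
have Dg i x s := is_derive_shrinkage h_gt0 h_int target a0 w_gt0 w_sum x i s.
have cg' i x : continuous (fun u => shrinkage_diff h a w target i (tset x i u)).
  exact: continuous_shrinkage_diff.
have mbayes : measurable_fun setT (bayes (prior_multi h a w target)).
  exact: measurable_shift mg bayesE.
(* The number d separates the two sides: the risk of this estimator is at most d at every theta, and
   every measurable estimator has maximal risk at least d. *)
split=> //; apply/eqP; rewrite eq_le; apply/andP; split.
  apply: le_ereal_inf_tmp => _ [delta mdelta <-].
  apply: le_trans (sup_risk_ge mdelta).
  apply: ge_ereal_sup => _ [theta _ <-].
  exact: (risk_le_dim mg mg' bayesE Dg cg' g_le g'_le theta div_le0).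
by apply: ereal_inf_lbound; exists (bayes (prior_multi h a w target)).
Qed.
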